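(* Suppose the weight sequence $\mathbf{w}$ has type II or III, and let $v_0$ be a uniformly random vertex of $\mathcal{T}_n$. Let $\bar{\mathcal{T}}^*$ denote the pointed fringe subtree of $\mathcal{T}^*$ at its unique vertex of infinite outdegree. Then $$H(\mathcal{T}_n,v_0,\Omega_n)\to\bar{\mathcal{T}}^*$$ in distribution in $\mathfrak{T}^\bullet$.
   Context: A weight sequence $\mathbf{w}=(\omega_k)_{k\ge0}$ consists of non-negative reals with $\omega_0>0$ and $\omega_k>0$ for some $k\ge2$; $\mathcal{T}_n$ is the random plane tree with $n$ vertices drawn with probability proportional to $\prod_v\omega_{d^+(v)}$ ($n\equiv1\bmod\gcd\{i:\omega_i>0\}$). Let $\phi(z)=\sum_k\omega_kz^k$ with radius $\rho_\phi$, $\psi(t)=t\phi'(t)/\phi(t)$ and $\nu=\lim_{t\nearrow\rho_\phi}\psi(t)$ when $\rho_\phi>0$. Type II: $\rho_\phi>0$, $0<\nu<1$, $\tau:=\rho_\phi$. Type III: $\rho_\phi=0$, $\tau:=\nu:=0$. $\xi$ has law $\Pr{\xi=k}=\tau^k\omega_k/\phi(\tau)$, $\mu=\mathbb{E}\xi=\min(\nu,1)$, $\mathcal{T}$ is a Galton–Watson tree with offspring $\xi$, $\hat\xi\in\mathbb{N}\cup\{\infty\}$ has $\Pr{\hat\xi=k}=k\Pr{\xi=k}$, $\Pr{\hat\xi=\infty}=1-\mu$. Let $N_k$ be the number of vertices of $\mathcal{T}_n$ with outdegree $k$. $(\Omega_n)$ is a fixed deterministic sequence with $\Omega_n\to\infty$,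 $\Omega_n=o(n)$, such that for every sequence $K_n\to\infty$ with $K_n\le\Omega_n$ one has $\sum_{k\le K_n}kN_k=\mu n+o_p(n)$ and $\sum_{k>K_n}kN_k=(1-\mu)n+o_p(n)$ (such a sequence exists). Space $\mathfrak{T}^\bullet$: pointed plane trees (possibly infinite, with possibly infinite outdegrees) are encoded as families of outdegrees indexed by the vertices of a universal tree $\mathcal{U}^\bullet_\infty$ with a backward spine $u_0,u_1,\dots$ ($u_i$ parent of $u_{i-1}$; pointed vertex $u_0$); non-spine vertices get values in $\overline{\mathbb{N}}_0=\mathbb{N}_0\cup\{\infty\}$, and $u_i$ ($i\ge1$) gets a value in $\{*\}\sqcup(\overline{\mathbb{N}}_0\times\overline{\mathbb{N}}_0)$ (numbers of children left/right of $u_{i-1}$, or $*$ if absent); one-point compactification on $\overline{\mathbb{N}}_0$, product topology. For a pointed tree $(T,v)$ and an ancestor $a$ of $v$, the pointed fringe subtree $f^\bullet((T,v),a)$ is the subtree of $T$ consisting of $a$ and its descendants, rooted at $a$ and pointed at $v$. $H(\mathcal{T}_n,v_0,\Omega_n)$ is the pointed fringe subtree of $(\mathcal{T}_n,v_0)$ at the youngest (closest) ancestor of $v_0$ having outdegree $>\Omega_n$, and equals a placeholder $\diamond$ if no such ancestor exists. $\mathcal{T}^*$: $u_0$ is the root of an independent copy of $\mathcal{T}$; for $i=1,2,\dots$, $u_i$ receives offspring according to an independent copy $\hat\xi_i$ of $\hat\xi$, a uniformly chosen child is $u_{i-1}$, all others are roots of independent copies of $\mathcal{T}$ (if $\hat\xi_i=\infty$,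 infinitely many children on both sides of $u_{i-1}$). With $i_1<i_2$ the first two indices with $\hat\xi_i=\infty$, the construction stops and $u_{i_2-1}$ is the root; $u_{i_1}$ is the unique vertex of infinite degree. *)

(* Defs.v *)
From HB Require Import structures.
From mathcomp Require Import all_boot all_order all_algebra.
From mathcomp Require Import all_classical all_reals all_analysis.
Set Implicit Arguments. Unset Strict Implicit. Unset Printing Implicit Defensive.
Import Order.TTheory GRing.Theory Num.Theory.
Import numFieldNormedType.Exports.
Local Open Scope classical_set_scope.
Local Open Scope ring_scope.

Definition weight_seq (R : realType) (w : nat -> R) : Prop :=
  (forall k, 0 <= w k) /\ 0 < w 0%N /\ exists k, (2 <= k)%N /\ 0 < w k.

Definition phi (R : realType) (w : nat -> R) (t : R) : R :=
  limn (series (fun k => w k * t ^+ k)).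

Definition radius (R : realType) (w : nat -> R) : \bar R :=
  ereal_sup [set t%:E | t in
    [set t : R | 0 <= t /\ cvgn (series (fun k => w k * t ^+ k))]].

Definition psi (R : realType) (w : nat -> R) (t : R) : R :=
  t * derive1 (phi w) t / phi w t.

Definition type_II_or_III (R : realType) (w : nat -> R) (tau nu : R) : Prop :=
  (radius w = 0%E /\ tau = 0 /\ nu = 0) \/
  (0 < tau /\ radius w = tau%:E /\
   (psi w t @[t --> tau^'-] --> nu) /\ 0 < nu /\ nu < 1).

Definition mu (R : realType) (nu : R) : R := Num.min nu 1.

Definition xi_law (R : realType) (w : nat -> R) (tau : R) (k : nat) : R :=
  tau ^+ k * w k / phi w tau.

Definition is_span (R : realType) (w : nat -> R) (d : nat) : Prop :=
  (forall i, 0 < w i -> (d %| i)%N) /\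
  (forall e, (forall i, 0 < w i -> (e %| i)%N) -> (e %| d)%N).

(* words of length < n with letters < n; every plane tree with n vertices
   is a set of such words *)
Definition word (n : nat) := {i : 'I_n & (i : nat).-tuple 'I_n}.

Definition wval (n : nat) (x : word n) : seq nat := map (@nat_of_ord n) (tagged x).

Definition inT (n : nat) (S : {set word n}) (u : seq nat) : bool :=
  [exists x in S, wval x == u].

Definition is_ptree (n : nat) (S : {set word n}) : bool :=
  [&& inT S [::], #|S| == n,
      [forall x in S, inT S (take (size (wval x)).-1 (wval x))] &
      [forall x in S, (last 0%N (wval x) == 0%N) ||
          inT S (rcons (take (size (wval x)).-1 (wval x)) (last 0%N (wval x)).-1)]].

(* outdegree of the word u in S (0 if u is not a vertex) *)
Definition outdeg (n : nat) (S : {set word n}) (u : seq nat) : nat :=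
  #|[set x in S | (size (wval x) == (size u).+1) && (take (size u) (wval x) == u)]|.

Definition Nk (n : nat) (S : {set word n}) (k : nat) : nat :=
  #|[set x in S | outdeg S (wval x) == k]|.

Definition tree_wt (R : realType) (w : nat -> R) (n : nat) (S : {set word n}) : R :=
  \prod_(x in S) w (outdeg S (wval x)).

Definition Zn (R : realType) (w : nat -> R) (n : nat) : R :=
  \sum_(S : {set word n} | is_ptree S) tree_wt w S.

Definition PrTn (R : realType) (w : nat -> R) (n : nat) (A : {set word n} -> bool) : R :=
  \sum_(S : {set word n} | is_ptree S && A S) tree_wt w S / Zn w n.

(* N_0 bar = one-point compactification of discrete N; None = infinity *)
Definition nbar : topologicalType := one_point_compactification nat.
Definition nbar2 : topologicalType := (nbar * nbar)%type.
Definition unitT : topologicalType := discrete_topology unit.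
(* value space at the spine vertices u_i (i >= 1): {*} disjoint union N0bar^2 *)
Definition SVf (b : bool) : topologicalType := if b then nbar2 else unitT.
Definition SV : topologicalType := {b : bool & SVf b}.
Definition star : SV := existT SVf false tt.
Definition spair (a b : nbar) : SV := existT SVf true ((a, b) : nbar2).

Definition Lft := false.
Definition Rgt := true.

(* non-spine vertices of U^bullet_infty:
   (None, w)          = the vertex u_0 w (descendant of u_0 along word w)
   (Some (j, s, l), w) = descendant along w of the l-th child (l = 0,1,...,
                         counted outward from u_j) on side s (Lft/Rgt) of
                         u_{j+1}, where u_j is the spine child of u_{j+1} *)
Definition nsv := (option (nat * bool * nat) * seq nat)%type.

(* frak T^bullet: outdegrees of non-spine vertices, and values at u_{j+1}
   (index j) of the spine; product topology *)
Definition Tbul : topologicalType :=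
  (prod_topology (fun _ : nsv => nbar) * prod_topology (fun _ : nat => SV))%type.

(* encoding of the pointed fringe subtree f^bullet((T, v), a) where T is
   given by its outdegree function deg, v is a vertex (word) and
   a = take h v is an ancestor of v (h < size v) *)
Definition fringe_enc (deg : seq nat -> nat) (v : seq nat) (h : nat) : Tbul :=
  let k := (size v - h)%N in
  (fun (q : nsv) =>
     match q with
     | (None, u) => (Some (deg (v ++ u)) : nbar)
     | (Some (j, s, l), u) =>
         if (j.+1 <= k)%N then
           let ui := take (size v - j.+1) v in
           let c := nth 0%N v (size v - j.+1) in
           let letter := if s then Some (c + 1 + l)%N
                         else (if (l < c)%N then Some (c - 1 - l)%N else None) in
           match letter with
           | Some a => (Some (deg (rcons ui a ++ u)) : nbar)
           | None => (Some 0%N : nbar)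
           end
         else (Some 0%N : nbar)
     end,
   fun (j : nat) =>
     if (j.+1 <= k)%N then
       let ui := take (size v - j.+1) v in
       let c := nth 0%N v (size v - j.+1) in
       spair (Some c) (Some (deg ui - c - 1)%N)
     else star).

(* H(T, v, Omega): pointed fringe subtree at the youngest (proper) ancestor
   of v with outdegree > Omega; None plays the role of the placeholder *)
Definition H_enc (R : realType) (deg : seq nat -> nat) (v : seq nat) (Om : R) : option Tbul :=
  if [exists h : 'I_(size v), Om < (deg (take h v))%:R]
  then Some (fringe_enc deg v (\max_(h < size v | Om < (deg (take h v))%:R) h))
  else None.

Definition EH (R : realType) (w : nat -> R) (n : nat) (Om : R) (F : option Tbul -> R) : R :=
  \sum_(S : {set word n} | is_ptree S) \sum_(x in S)
     (tree_wt w S / (Zn w n * n%:R)) * F (H_enc (outdeg S) (wval x) Om).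

Definition Omega_ok (R : realType) (w : nat -> R) (d : nat) (muv : R) (Om : nat -> R) : Prop :=
  (Om n @[n --> \oo] --> +oo) /\
  ((fun n => Om n / n%:R) @ \oo --> 0) /\
  forall K : nat -> R, (K n @[n --> \oo] --> +oo) -> (forall n, K n <= Om n) ->
  forall eps : R, 0 < eps ->
    ((fun m => let n := (d * m + 1)%N in
        PrTn w (fun S : {set word n} => eps * n%:R <
          `| (\sum_(k < n | k%:R <= K n) (k * Nk S k)%N%:R) - muv * n%:R |)) @ \oo --> 0) /\
    ((fun m => let n := (d * m + 1)%N in
        PrTn w (fun S : {set word n} => eps * n%:R <
          `| (\sum_(k < n | K n < k%:R) (k * Nk S k)%N%:R) - (1 - muv) * n%:R |)) @ \oo --> 0).

Definition Pr d (Om : measurableType d) (R : realType) (P : probability Om R)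
  (A : set Om) : R := fine (P A).

Definition gw_present (x : seq nat -> nat) (w : seq nat) : bool :=
  [forall k : 'I_(size w), (nth 0%N w k < x (take k w))%N].

(* Encoding of bar T^* from
   X q   : offspring number attached to the non-spine vertex q (i.i.d. xi);
           the subtree rooted at each potential non-spine root is a GW tree
   Xh j  : hat xi_{j+1} (None = infinity), offspring number of u_{j+1}
   Pos j : position (0 = leftmost) of u_j among the children of u_{j+1} *)
Definition Tbar_enc (X : nsv -> nat) (Xh : nat -> option nat) (Pos : nat -> nat) : Tbul :=
  let alive (j : nat) := [forall j' : 'I_j, Xh j' != None] in
  (fun (q : nsv) =>
     match q with
     | (None, u) =>
         if gw_present (fun u' => X (None, u')) u then (Some (X q) : nbar)
         else (Some 0%N : nbar)
     | (Some (j, s, l), u) =>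
         let exists_root :=
           alive j && match Xh j with
                      | None => true
                      | Some k => if s then (l < k - 1 - Pos j)%N else (l < Pos j)%N
                      end in
         if exists_root && gw_present (fun u' => X (Some (j, s, l), u')) u
         then (Some (X q) : nbar) else (Some 0%N : nbar)
     end,
   fun (j : nat) =>
     if alive j then
       match Xh j with
       | None => spair None None
       | Some k => spair (Some (Pos j)) (Some (k - 1 - Pos j)%N)
       end
     else star).

Definition Tstar_vars d (Om : measurableType d) (R : realType) (P : probability Om R)
  (w : nat -> R) (tau nu : R)
  (X : nsv -> Om -> nat) (Xh : nat -> Om -> option nat) (Pos : nat -> Om -> nat) : Prop :=
  let Z := fun j o => (Xh j o, Pos j o) in
  (forall q k, measurable (X q @^-1` [set k])) /\
  (forall j z, measurable (Z j @^-1` [set z])) /\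
  (forall q k, Pr P (X q @^-1` [set k]) = xi_law w tau k) /\
  (forall j, Pr P (Xh j @^-1` [set None]) = 1 - mu nu) /\
  (forall j k l, Pr P (Z j @^-1` [set (Some k, l)]) =
     if (l < k)%N then (k%:R * xi_law w tau k) / k%:R else 0) /\
  (forall (sA : seq nsv) (sB : seq nat) (a : nsv -> nat) (b : nat -> option nat * nat),
     uniq sA -> uniq sB ->
     Pr P ((\bigcap_(q in [set` sA]) (X q @^-1` [set a q])) `&`
           (\bigcap_(j in [set` sB]) (Z j @^-1` [set b j])))
     = (\prod_(q <- sA) Pr P (X q @^-1` [set a q])) *
       (\prod_(j <- sB) Pr P (Z j @^-1` [set b j]))).

(* Main.v *)
(** The depth-first code of the conditioned tree, rotated so as to start at the
    uniform vertex, is a word of length n and sum n - 1 drawn with probability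
    proportional to its weight (cycle lemma).  Its letters are exchangeable, so
    the probability that it starts with a word c is the mean of a product of
    empirical letter frequencies.  Words of equal length and sum have
    probabilities in the ratio of their weights, which forces every limit of the
    empirical frequencies to be a tilting C w_k t^k of the weights; the
    hypothesis on Omega fixes its mean, hence identifies it with the law of xi.
    So the code seen from the uniform vertex starts with c with probability
    tending to law(c).  Summing over the possible codes of the parent and the
    elder siblings, the part of this event where the parent has small outdegree
    has limit mu law(c), so the part where it has outdegree > Omega_n has limit
    (1 - mu) law(c); moreover such a vertex is typically far from both ends of
    its sibling list.

    A configuration (c, u) consists of 2L+1 trees (with code c) and a vertex u of
    the middle one.  In the finite tree it occurs at 2L+1 consecutive children of
    a vertex of outdegree > Omega_n, the marked vertex being u in the middle
    tree; translating from the first of these siblings to the marked vertex is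
    injective, so for a uniform marked vertex the occurrence has probability at
    least (1 - mu) law(c) - o(1).  In the limit tree it has probability exactly
    (1 - mu) law(c).  Distinct configurations are disjoint, and since a
    Galton-Watson tree is finite with mean size 1 / (1 - mu), finitely many of
    them carry mass close to 1.  On one configuration both trees are uniformly
    close in the compact space of pointed trees, so a continuous function has
    nearly the same mean under both laws. *)
Require Import Defs.
From HB Require Import structures.
From mathcomp Require Import all_boot all_order all_algebra all_fingroup.
From mathcomp Require Import primitive_action alt.
From mathcomp Require Import all_classical all_reals all_analysis.
From mathcomp Require Import measurable_realfun.
From mathcomp Require Import zify ring lra.
Set Implicit Arguments. Unset Strict Implicit. Unset Printing Implicit Defensive.
Import Order.TTheory GRing.Theory Num.Theory.
Import numFieldNormedType.Exports.

(** * Depth-first codes of plane trees *)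

(** The weights satisfy no regularity condition, so no local limit theorem and no asymptotics of the
    partition function are at hand: every limit comes from exact identities on bridges. For words c,
    c' of equal length and sum, the square of W(c')p(c) - W(c)p(c'), with p the empirical products,
    has a mean built from the words cc, cc' and c'c', whose exact probabilities cancel. This yields
    concentration, not only convergence of means. The hypothesis on Omega concerns cutoffs tending
    to infinity; a diagonal sequence turns it into a statement on a fixed cutoff, which survives a
    limit of empirical measures. Below vertices of large outdegree only an upper bound is direct, by
    subtracting occurrences preceded by one of finitely many parent words; the lower bound follows
    since the words of one length have total probability one. In the final comparison lower bounds
    on disjoint events suffice, because their limits add up to nearly one. Finitely many coordinates
    see only L siblings on each side of the top spine child; the numbers of siblings are compared
    with infinity in the compactification. *)

Fixpoint forest_code (m : nat) (s : seq nat) : bool :=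
  if s is k :: s' then (0 < m) && forest_code (m.-1 + k) s' else m == 0.

(** A letter k removes one pending vertex and adds k, so both predicates follow a Łukasiewicz walk
    started at [m]: [forest_code] asks that it first hits 0 at the end of [s], [stays_pos] that it
    never does. *)
Fixpoint stays_pos (m : nat) (s : seq nat) : bool :=
  (0 < m) && (if s is k :: s' then stays_pos (m.-1 + k) s' else true).

Lemma forest_code_size m s : forest_code m s -> size s = sumn s + m.
Proof.
elim: s m => [|k s IH] m /=; first by move/eqP->.
by case/andP=> m0 /IH ->; lia.
Qed.

Lemma forest_code_cat m p s1 s2 :
  forest_code m s1 -> forest_code p s2 -> forest_code (m + p) (s1 ++ s2).
Proof.
elim: s1 m => [|k s IH] m /=; first by move/eqP->.
case/andP=> m0 /IH H /H {H}; rewrite addn_gt0 m0 /=.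
by congr forest_code; lia.
Qed.

Lemma forest_code_prefix m s r r' :
  forest_code m s -> forest_code m r -> s ++ r' = r -> s = r.
Proof.
elim: s m r => [|k s IH] m [|j r] //=; first by move/eqP->.
by case/andP=> _ H1 /andP[_ H2] [kj]; subst j => /(IH _ _ H1 H2) ->.
Qed.

Lemma forest_code_proper_prefix m s1 s2 :
  forest_code m (s1 ++ s2) -> s2 != [::] -> size s1 < sumn s1 + m.
Proof.
elim: s1 m => [|k s IH] m /=; first by case: s2 => //= j s2 /andP[].
by case/andP=> m0 /IH H /H; lia.
Qed.

Lemma stays_pos_leq m p s : m <= p -> stays_pos m s -> stays_pos p s.
Proof.
elim: s m p => [|k s IH] m p /= mp; first by rewrite !andbT; lia.
case/andP=> m0 H; apply/andP; split; first lia.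
by apply: IH H; lia.
Qed.

Lemma forest_stays_pos m p s1 s2 :
  forest_code m s1 -> stays_pos p s2 -> stays_pos (m + p) (s1 ++ s2).
Proof.
elim: s1 m => [|k s IH] m /=; first by move/eqP->.
case/andP=> m0 /IH H /H {H} H; apply/andP; split; first lia.
by move: H; congr stays_pos; lia.
Qed.

Lemma stays_pos_cat_forest m s1 s2 :
  stays_pos m s1 -> forest_code (m + sumn s1 - size s1) s2 ->
  forest_code m (s1 ++ s2).
Proof.
elim: s1 m => [|k s IH] m /=; first by move=> _; rewrite addn0 subn0.
case/andP=> m0 H1 H2; rewrite m0 /=; apply: IH => //.
by move: H2; congr forest_code; lia.
Qed.

(** [s1] ends when the walk with steps k - 1 first reaches its minimum -p. The induction prepends a
    letter k: either it becomes the parent of the first k of the p trees, or k > p and the minimum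
    moves back to time 0. *)
Lemma forest_split s : exists s1 s2 p,
  [/\ s = s1 ++ s2, forest_code p s1 & stays_pos 1 s2].
Proof.
elim: s => [|k s [s1 [s2 [p [-> H1 H2]]]]].
  by exists [::], [::], 0.
case: (leqP k p) => kp.
  exists (k :: s1), s2, (p - k).+1; split => //=.
  by move: H1; congr forest_code; lia.
exists [::], (k :: s1 ++ s2), 0; split => //=; rewrite add0n.
have {1}-> : k = p + (k - p) by lia.
by apply: forest_stays_pos => //; apply: stays_pos_leq H2; lia.
Qed.

(** Existence half of the cycle lemma: start reading at the first minimum. The condition on the sum
    makes the counter after [s2] equal to the number p of trees coded by [s1]. *)
Lemma rot_tree_code s : size s = (sumn s).+1 ->
  exists2 i, i < size s & forest_code 1 (rot i s).
Proof.
have [s1 [s2 [p [-> H1 H2]]]] := forest_split s => Hs.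
have E1 := forest_code_size H1.
have H : forest_code 1 (s2 ++ s1).
  apply: stays_pos_cat_forest => //.
  move: Hs; rewrite size_cat sumn_cat E1 => Hs.
  by have -> : 1 + sumn s2 - size s2 = p by lia.
have [s20|s20] := eqVneq s2 [::].
  exists 0; first by rewrite Hs.
  by move: H; rewrite s20 cats0 rot0.
exists (size s1); last by rewrite rot_size_cat.
by move: s20; rewrite -size_eq0 -lt0n size_cat -{1}(addn0 (size s1)) ltn_add2l.
Qed.

(** Uniqueness half of the cycle lemma: under a nontrivial rotation both pieces are proper prefixes
    of tree codes, so each has length at most its sum, whereas the total length exceeds the total
    sum by one. *)
Lemma rot_tree_code_unique s i : i < size s ->
  forest_code 1 s -> forest_code 1 (rot i s) -> i = 0.
Proof.
case: i => // i Hi; rewrite -{1}(cat_take_drop i.+1 s) /rot => H1 H2.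
have d0 : drop i.+1 s != [::] by rewrite -size_eq0 size_drop -lt0n subn_gt0.
have t0 : take i.+1 s != [::] by rewrite -size_eq0 size_take Hi.
have := forest_code_proper_prefix H1 d0.
have := forest_code_proper_prefix H2 t0.
have := forest_code_size H1.
by rewrite size_cat sumn_cat; lia.
Qed.

(** * Depth-first exploration with a stack *)

Definition children (u : seq nat) (k : nat) : seq (seq nat) :=
  [seq rcons u i | i <- iota 0 k].

(* Depth-first exploration with a stack of pending words: [walk st s] lists the
   words popped when the j-th popped word gets [nth 0 s j] children, and
   [stack_after st s] is the remaining stack. *)
Fixpoint walk (st : seq (seq nat)) (s : seq nat) : seq (seq nat) :=
  if s is k :: s' then
    if st is u :: st' then u :: walk (children u k ++ st') s' else [::]
  else [::].

Fixpoint stack_after (st : seq (seq nat)) (s : seq nat) : seq (seq nat) :=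
  if s is k :: s' then
    if st is u :: st' then stack_after (children u k ++ st') s' else [::]
  else st.

(** Counterpart of [walk] for a tree given by its outdegrees instead of its code; [m] is fuel. *)
Fixpoint run (deg : seq nat -> nat) (st : seq (seq nat)) (m : nat) :=
  if m is m'.+1 then
    if st is u :: st' then u :: run deg (children u (deg u) ++ st') m' else [::]
  else [::].

Definition verts (t : seq nat) : seq (seq nat) := walk [:: [::]] t.

(** For a tree code, a word that is not a vertex has index [size t] and gets the default 0, in
    agreement with [outdeg]. *)
Definition tree_deg (t : seq nat) (u : seq nat) : nat := nth 0 t (index u (verts t)).

Lemma size_children u k : size (children u k) = k.
Proof. by rewrite size_map size_iota. Qed.

Lemma mem_children u k v :
  (v \in children u k) = [exists i : 'I_k, v == rcons u i].
Proof.
apply/mapP/existsP => [[i]|[i /eqP->]].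
  by rewrite mem_iota => /= ik ->; exists (Ordinal ik).
by exists (i : nat) => //; rewrite mem_iota /=.
Qed.

Lemma rcons_children u k i : (rcons u i \in children u k) = (i < k).
Proof.
rewrite mem_map ?mem_iota //.
by move=> a b /eqP; rewrite eqseq_rcons => /andP[_ /eqP].
Qed.

Lemma children_cat u v k : children (u ++ v) k = map (cat u) (children v k).
Proof. by rewrite /children -map_comp; apply: eq_map => i /=; rewrite rcons_cat. Qed.

Lemma walk_map_cat u st s : walk (map (cat u) st) s = map (cat u) (walk st s).
Proof.
elim: s st => [|k s IH] [|v st] //=.
by rewrite children_cat -map_cat IH.
Qed.

Lemma walk_cat st s1 s2 :
  walk st (s1 ++ s2) = walk st s1 ++ walk (stack_after st s1) s2.
Proof.
elim: s1 st => [|k s IH] [|v st] //=; first by case: (s2).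
by rewrite IH.
Qed.

Lemma stack_after_cat st s1 s2 :
  stack_after st (s1 ++ s2) = stack_after (stack_after st s1) s2.
Proof.
elim: s1 st => [|k s IH] [|v st] //=; by case: (s2).
Qed.

Lemma walk_forest st st2 s : forest_code (size st) s ->
  walk (st ++ st2) s = walk st s.
Proof.
elim: s st => [|k s IH] [|v st] //= H; congr (_ :: _).
by rewrite catA IH // size_cat size_children addnC.
Qed.

Lemma stack_after_forest st st2 s : forest_code (size st) s ->
  stack_after (st ++ st2) s = st2.
Proof.
elim: s st => [|k s IH] [|v st] //= H.
by rewrite catA IH // size_cat size_children addnC.
Qed.

Lemma stack_after_forest_code st s r : forest_code (size st) (s ++ r) ->
  forest_code (size (stack_after st s)) r.
Proof.
elim: s st => [|k s IH] [|v st] //= H; apply: IH.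
by rewrite size_cat size_children addnC.
Qed.

Lemma walk_tree u st t : forest_code 1 t ->
  walk (u :: st) t = map (cat u) (verts t).
Proof.
move=> H; rewrite -[u :: st]/([:: u] ++ st) walk_forest // -walk_map_cat /=.
by rewrite cats0.
Qed.

Lemma size_walk st s : forest_code (size st) s -> size (walk st s) = size s.
Proof.
elim: s st => [|k s IH] [|v st] //= H.
by rewrite IH // size_cat size_children addnC.
Qed.

Lemma mem_stack_walk st s : forest_code (size st) s ->
  {subset st <= walk st s}.
Proof.
elim: s st => [|k s IH] [|v st] //= H u; rewrite !inE => /orP[->//|us].
apply/orP; right; apply: IH; first by rewrite size_cat size_children addnC.
by rewrite mem_cat us orbT.
Qed.

(** Invariant of the stack: pending words root disjoint subtrees, so no word is visited twice and a
    visited word is never a prefix of an earlier one. *)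
Definition antichain (st : seq (seq nat)) : bool :=
  pairwise (fun u v => ~~ prefix u v && ~~ prefix v u) st.

Lemma prefix_size_leq (u v : seq nat) : prefix u v -> size u <= size v.
Proof. by case/prefixP=> r ->; rewrite size_cat leq_addr. Qed.

Lemma prefix_rcons_eq (u v : seq nat) i :
  prefix v (rcons u i) = prefix v u || (v == rcons u i).
Proof.
elim: u v => [|a u IH] [|b v] //=.
by rewrite eqseq_cons IH; case: (b == a).
Qed.

Lemma antichain_children u k st : antichain (u :: st) ->
  antichain (children u k ++ st).
Proof.
rewrite /antichain /= => /andP[/allP Hu Hst].
rewrite pairwise_cat Hst andbT; apply/andP; split.
  apply/allrelP => a v; rewrite mem_children => /existsP[i /eqP->] /Hu/andP[H1 H2].
  apply/andP; split.
    apply: contra H1 => /prefixP[r ->]; by rewrite cat_rcons prefix_prefix.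
  rewrite prefix_rcons_eq negb_or H2 /=.
  by apply: contra H1 => /eqP->; rewrite prefix_rcons.
rewrite pairwise_map; apply: (@sub_pairwise _ (fun i j => i != j)).
  move=> i j ij /=; rewrite !prefix_rcons_eq !eqseq_rcons eqxx /= (negbTE ij) eq_sym (negbTE ij).
  by rewrite !orbF; apply/andP; split; apply/negP => /prefix_size_leq; rewrite size_rcons ltnn.
by rewrite -uniq_pairwise iota_uniq.
Qed.

Lemma walk_ext st s v : v \in walk st s -> exists2 u, u \in st & prefix u v.
Proof.
elim: s st => [|k s IH] [|u st] //=; rewrite inE => /orP[/eqP->|/IH[u']].
  by exists u; rewrite ?inE ?eqxx ?prefix_refl.
rewrite mem_cat => /orP[|Hu' p]; last by exists u' => //; rewrite inE Hu' orbT.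
rewrite mem_children => /existsP[i /eqP->] /prefixP[r ->]; exists u; rewrite ?inE ?eqxx //.
by rewrite cat_rcons prefix_prefix.
Qed.

Lemma walk_next_not_prefix u st k s v : antichain (u :: st) ->
  v \in walk (children u k ++ st) s -> ~~ prefix v u.
Proof.
rewrite /antichain /= => /andP[/allP Hu _] /walk_ext[u'].
rewrite mem_cat => /orP[Hu'|Hu'] Hp; apply/negP => vu.
  move: Hu' Hp; rewrite mem_children => /existsP[i /eqP ->].
  by move/prefix_size_leq; rewrite size_rcons; move/prefix_size_leq: vu; lia.
have /= /andP[_ H] := Hu _ Hu'; by move: H; rewrite (prefix_trans Hp vu).
Qed.

Lemma walk_uniq st s : antichain st -> uniq (walk st s).
Proof.
elim: s st => [|k s IH] [|u st] //= Ha; apply/andP; split; last first.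
  by apply: IH; apply: antichain_children.
by apply/negP => /(walk_next_not_prefix Ha); rewrite prefix_refl.
Qed.

Lemma walk_parent st s v : v \in walk st s ->
  v \in st \/ exists u i, u \in walk st s /\ v = rcons u i.
Proof.
elim: s st => [|k s IH] [|u st] //=; rewrite inE => /orP[/eqP->|/IH].
  by left; rewrite inE eqxx.
rewrite mem_cat mem_children => -[/orP[/existsP[i /eqP->]|H]|[u' [i [H ->]]]].
- by right; exists u, i; rewrite inE eqxx.
- by left; rewrite inE H orbT.
- by right; exists u', i; rewrite inE H orbT.
Qed.

Lemma walk_children st s u k i : antichain st -> forest_code (size st) s ->
  (u, k) \in zip (walk st s) s -> (rcons u i \in walk st s) = (i < k).
Proof.
elim: s st => [|k0 s IH] [|u0 st] //= Ha H.
have H' : forest_code (size (children u0 k0 ++ st)) s.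
  by rewrite size_cat size_children addnC.
have Ha' := antichain_children k0 Ha.
rewrite !inE => /orP[/eqP[-> ->]|Hz].
  have -> : (rcons u0 i == u0) = false.
    by apply/negP => /eqP/(congr1 size); rewrite size_rcons; lia.
  apply/idP/idP => [/walk_ext[v]|ik]; last first.
    by apply: mem_stack_walk => //; rewrite mem_cat rcons_children ik.
  rewrite mem_cat mem_children => /orP[/existsP[j /eqP->]|Hv].
    move/prefixP=> [r] /eqP.
    case: r => [|a r]; first by rewrite cats0 eqseq_rcons => /andP[_ /eqP->].
    by move/eqP/(congr1 size); rewrite size_cat !size_rcons /=; lia.
  move: Ha; rewrite /antichain /= => /andP[/allP/(_ _ Hv)/andP[H1 H2] _].
  rewrite prefix_rcons_eq (negbTE H2) /= => /eqP Ev.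
  by move: H1; rewrite Ev prefix_rcons.
rewrite IH //; case: eqP => //= Eu.
have /(walk_next_not_prefix Ha) : u \in walk (children u0 k0 ++ st) s.
  by have := map_f fst Hz; rewrite -/(unzip1 _) unzip1_zip ?size_walk.
by rewrite -Eu prefix_rcons.
Qed.

Lemma gw_present_rcons x u i :
  gw_present x (rcons u i) = gw_present x u && (i < x u).
Proof.
apply/forallP/andP => [H|[/forallP H Hi] [k]].
  split.
    apply/forallP => k; have kl : k < size (rcons u i) by rewrite size_rcons; case: k => /= k; lia.
    have := H (Ordinal kl); case: k kl => k ku kl /=.
    by rewrite nth_rcons ku -cats1 takel_cat // ltnW.
  have kl : size u < size (rcons u i) by rewrite size_rcons.
  by have := H (Ordinal kl); rewrite /= nth_rcons ltnn eqxx -cats1 take_size_cat.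
move=> kr; have := kr; rewrite {1}size_rcons ltnS leq_eqVlt => /orP[/eqP E|ku] /=.
  by rewrite E nth_rcons ltnn eqxx -cats1 take_size_cat.
by rewrite nth_rcons ku -cats1 takel_cat ?(ltnW ku) // (H (Ordinal ku)).
Qed.

Section TreeCode.
Variables (t : seq nat) (Ht : forest_code 1 t).

Lemma size_verts : size (verts t) = size t.
Proof. exact: size_walk. Qed.

Lemma verts_uniq : uniq (verts t).
Proof. exact: walk_uniq. Qed.

Lemma root_verts : [::] \in verts t.
Proof. by apply: (@mem_stack_walk [:: [::]]) => //; rewrite inE. Qed.

Lemma tree_deg_verts : map (tree_deg t) (verts t) = t.
Proof.
apply: (@eq_from_nth _ 0); rewrite size_map size_verts // => i it.
rewrite (nth_map [::]) ?size_verts // /tree_deg index_uniq ?size_verts //.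
exact: verts_uniq.
Qed.

Lemma tree_deg_out u : u \notin verts t -> tree_deg t u = 0.
Proof.
move=> /memNindex E; rewrite /tree_deg E nth_default // size_verts //.
Qed.

Lemma rcons_verts u i : u \in verts t -> (rcons u i \in verts t) = (i < tree_deg t u).
Proof.
move=> Hu; apply: (@walk_children [:: [::]]) => //.
rewrite -/(verts t) -[X in zip _ X]tree_deg_verts.
have -> : zip (verts t) (map (tree_deg t) (verts t)) =
          map (fun v => (v, tree_deg t v)) (verts t).
  by elim: (verts t) => //= a l ->.
exact: map_f.
Qed.

Lemma verts_parent u i : rcons u i \in verts t -> u \in verts t.
Proof.
case/walk_parent; first by rewrite inE; case: u.
by case=> u' [j [Hu' /eqP]]; rewrite eqseq_rcons => /andP[/eqP-> _].
Qed.

Lemma gw_present_verts (x : seq nat -> nat) : {in verts t, x =1 tree_deg t} ->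
  forall u, gw_present x u = (u \in verts t).
Proof.
move=> Hx; elim/last_ind => [|u i IH].
  by rewrite root_verts; apply/forallP => -[].
rewrite gw_present_rcons IH; case Hu: (u \in verts t) => /=.
  by rewrite rcons_verts // Hx.
by apply/esym/negP => /verts_parent; rewrite Hu.
Qed.

End TreeCode.

Lemma walk_run deg st m : walk st (map deg (run deg st m)) = run deg st m.
Proof. by elim: m st => [|m IH] [|u st] //=; rewrite IH. Qed.

Lemma run_walk deg st s m : forest_code (size st) s -> map deg (walk st s) = s ->
  size s <= m -> run deg st m = walk st s.
Proof.
elim: s st m => [|k s IH] [|u st] //= [|m] //= H [E1 E2] sm; congr (_ :: _).
rewrite E1 IH //; first by rewrite size_cat size_children addnC.
Qed.

(** Stopping with fuel left means that the stack was emptied, so the outdegrees read form a complete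
    forest. *)
Lemma run_forest_code deg st m : size (run deg st m) < m ->
  forest_code (size st) (map deg (run deg st m)).
Proof.
elim: m st => [|m IH] [|u st] //=; rewrite ltnS => /IH.
by rewrite size_cat size_children addnC.
Qed.

(** * Plane trees as sets of words *)

(** The letters of the children of a vertex form an initial segment, whose length is its
    cardinality; this turns [outdeg], defined by counting, into a threshold for the letters. *)
Lemma tally_downclosed (n : nat) (Q : pred nat) :
  (forall i, Q i -> i < n) -> (forall i, Q i.+1 -> Q i) ->
  forall i, Q i = (i < #|[set j : 'I_n | Q j]|).
Proof.
move=> Hn Hd.
have [k Hk] : exists k, forall i, Q i = (i < k).
  have Hex : exists k, ~~ Q k by exists n; apply/negP => /Hn; rewrite ltnn.
  exists (ex_minn Hex) => i; case: ex_minnP => k Hk Hmin.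
  case: (ltnP i k) => [ik|ki].
    by apply/negPn/negP => /Hmin; rewrite leqNgt ik.
  apply/negP => Hi; move/negP: Hk; apply.
  by rewrite -(subnK ki) in Hi; elim: (i - k) Hi => // m IH /Hd.
have kn : k <= n.
  by case: k Hk => // k Hk; apply: Hn; rewrite Hk.
move=> i; rewrite Hk; congr (i < _).
have -> : [set j : 'I_n | Q j] = [set widen_ord kn j | j : 'I_k].
  apply/setP => j; rewrite inE Hk; apply/idP/imsetP => [jk|[j' _ ->] /=].
    by exists (Ordinal jk) => //; apply/val_inj.
  exact: ltn_ord.
rewrite card_imset ?card_ord // => a b /(congr1 val) /= ab; exact/val_inj.
Qed.

Section Words.
Variable n : nat.

Lemma wval_inj : injective (@wval n).
Proof.
move=> [i s] [j t]; rewrite /wval /= => /(inj_map val_inj) E.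
have Eij : i = j.
  by apply/val_inj; rewrite /= -(size_tuple s) -(size_tuple t) E.
by subst j; congr existT; apply/val_inj.
Qed.

Lemma wval_size (x : word n) : size (wval x) < n.
Proof. by case: x => i s; rewrite /wval size_map size_tuple. Qed.

Lemma wval_letters (x : word n) : all (fun i => i < n) (wval x).
Proof. by case: x => i s; rewrite /wval all_map; apply/allP => j _ /=. Qed.

Lemma wval_surj (u : seq nat) : size u < n -> all (fun i => i < n) u ->
  exists x : word n, wval x = u.
Proof.
move=> Hs Ha; case: n Hs Ha => // m Hs Ha.
have Hsz : size (map (@inord m) u) == Ordinal Hs by rewrite size_map.
exists (existT _ (Ordinal Hs) (Tuple Hsz)).
rewrite /wval /= -map_comp -[RHS]map_id; apply/eq_in_map => i /(allP Ha) Hi /=.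
by rewrite inordK.
Qed.

Variable S : {set word n}.

Lemma inTP u : reflect (exists2 x, x \in S & wval x = u) (inT S u).
Proof.
apply: (iffP existsP) => [[x /andP[H /eqP <-]]|[x H <-]]; exists x => //.
by rewrite H eqxx.
Qed.

Lemma mem_inT x : inT S (wval x) = (x \in S).
Proof.
apply/inTP/idP => [[y Hy /wval_inj <-] //|Hx]; by exists x.
Qed.

Lemma take_rcons_belast (T : Type) (u : seq T) i :
  take (size (rcons u i)).-1 (rcons u i) = u.
Proof. by rewrite size_rcons -cats1 take_size_cat. Qed.

Lemma rcons_take_last (s u : seq nat) : size s = (size u).+1 ->
  take (size u) s = u -> s = rcons u (last 0 s).
Proof.
case/lastP: s => // s a; rewrite size_rcons last_rcons => -[E].
by rewrite -cats1 -E take_size_cat // => ->; rewrite cats1.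
Qed.

Hypothesis HS : is_ptree S.

Lemma ptree_root : inT S [::].
Proof. by case/and4P: HS. Qed.

Lemma ptree_card : #|S| = n.
Proof. by case/and4P: HS => _ /eqP. Qed.

Lemma ptree_parent u i : inT S (rcons u i) -> inT S u.
Proof.
case/inTP => x Hx E; case/and4P: HS => _ _ /forallP/(_ x)/implyP/(_ Hx) H _.
by move: H; rewrite E take_rcons_belast.
Qed.

Lemma ptree_left_sibling u i : inT S (rcons u i.+1) -> inT S (rcons u i).
Proof.
case/inTP => x Hx E; case/and4P: HS => _ _ _ /forallP/(_ x)/implyP/(_ Hx) H.
by move: H; rewrite E take_rcons_belast last_rcons.
Qed.

Lemma ptree_outdeg u i : inT S (rcons u i) = (i < outdeg S u).
Proof.
rewrite (@tally_downclosed n (fun i => inT S (rcons u i))); last first.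
- exact: ptree_left_sibling.
- move=> j /inTP[x _ E]; have := wval_letters x.
  by rewrite E all_rcons => /andP[].
congr (i < _).
have Hx (j : 'I_n) : inT S (rcons u j) -> exists2 x : word n, x \in S & wval x = rcons u j.
  by move/inTP.
rewrite /outdeg -!sum1dep_card.
(* [h] reads the last letter of a child; the default branch is never taken there, since letters of a
   word are below n. *)
pose h (x : word n) : 'I_n := if ((insub (last 0 (wval x))) : option 'I_n) is Some j then j else Ordinal (leq_ltn_trans (leq0n _) (wval_size x)).
rewrite (partition_big h (fun j : 'I_n => inT S (rcons u j))) /=; last first.
  move=> x /andP[Hx1 /andP[/eqP Hx2 /eqP Hx3]].
  have E : wval x = rcons u (last 0 (wval x)).
    exact: rcons_take_last.
  rewrite /h; case: insubP => [j _ Ej|]; first by rewrite Ej -E mem_inT.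
  by have := wval_letters x; rewrite {1}E all_rcons => /andP[-> _].
apply: eq_bigr => j Hj; have [x Hx1 Hx2] := Hx j Hj.
rewrite (big_pred1 x) // => y; apply/andP/eqP => [[/andP[H1 /andP[/eqP H2 /eqP H3]] /eqP H4]|->].
  apply: wval_inj; rewrite Hx2.
  have E : wval y = rcons u (last 0 (wval y)).
    exact: rcons_take_last.
  rewrite E; congr rcons; move: H4; rewrite /h.
  case: insubP => [k _ <- ->//|].
  by have := wval_letters y; rewrite {1}E all_rcons => /andP[-> _].
rewrite Hx1 Hx2 size_rcons eqxx /= -cats1 take_size_cat // eqxx; split=> //.
have Hl : last 0 (wval x) = j by rewrite Hx2 last_rcons.
apply/eqP/val_inj; rewrite /h; case: insubP => [k _ ->//|].
by rewrite Hl ltn_ord.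
Qed.

Lemma outdeg_notin u : ~~ inT S u -> outdeg S u = 0.
Proof.
move=> Hu; apply/eqP; rewrite -leqn0 leqNgt; apply: contra Hu.
by rewrite -ptree_outdeg => /ptree_parent.
Qed.

Lemma gw_present_ptree u v : inT S u ->
  gw_present (fun v => outdeg S (u ++ v)) v = inT S (u ++ v).
Proof.
move=> Hu; elim/last_ind: v => [|v i IH].
  by rewrite cats0 Hu; apply/forallP => -[].
rewrite gw_present_rcons IH -rcons_cat ptree_outdeg.
case: (boolP (inT _ _)) => //= /outdeg_notin->.
by [].
Qed.

Lemma gw_present_outdeg u v : inT S u ->
  (if gw_present (fun v => outdeg S (u ++ v)) v then outdeg S (u ++ v) else 0)
  = outdeg S (u ++ v).
Proof.
by move=> Hu; rewrite gw_present_ptree //; case: ifPn => // /outdeg_notin.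
Qed.

(** One unit of fuel more than the n vertices, so that the run is seen to stop early and
    [run_forest_code] applies. *)
Definition dfs : seq (seq nat) := run (outdeg S) [:: [::]] n.+1.

Definition tree_code : seq nat := map (outdeg S) dfs.

Lemma run_inT st m : all (inT S) st -> all (inT S) (run (outdeg S) st m).
Proof.
elim: m st => [|m IH] [|u st] //= /andP[Hu Hst]; rewrite Hu IH //.
rewrite all_cat Hst andbT; apply/allP => v; rewrite mem_children.
by case/existsP => i /eqP->; rewrite ptree_outdeg.
Qed.

Lemma dfs_inT : all (inT S) dfs.
Proof. by apply: run_inT; rewrite /= ptree_root. Qed.

Lemma walk_tree_code : verts tree_code = dfs.
Proof. exact: walk_run. Qed.

Lemma dfs_uniq : uniq dfs.
Proof. by rewrite -walk_tree_code; apply: walk_uniq. Qed.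

Lemma subset_size_ptree (s : seq (seq nat)) : uniq s -> all (inT S) s -> size s <= n.
Proof.
move=> Hu /allP Ha; rewrite -ptree_card cardE -(size_map (@wval n)).
apply: uniq_leq_size => // u /Ha/inTP[x Hx <-].
by apply: map_f; rewrite mem_enum.
Qed.

Lemma tree_code_forest : forest_code 1 tree_code.
Proof.
apply: (@run_forest_code _ [:: [::]]).
by rewrite ltnS; apply: subset_size_ptree; [apply: dfs_uniq | apply: dfs_inT].
Qed.

Lemma tree_deg_code : {in dfs, tree_deg tree_code =1 outdeg S}.
Proof.
move=> u Hu; rewrite /tree_deg walk_tree_code /tree_code (nth_map [::]) ?index_mem //.
by rewrite nth_index.
Qed.

Lemma mem_dfs u : (u \in dfs) = inT S u.
Proof.
rewrite -walk_tree_code -(@gw_present_verts _ tree_code_forest (outdeg S)).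
  exact: (gw_present_ptree _ ptree_root).
by rewrite walk_tree_code => v Hv; rewrite tree_deg_code.
Qed.

Lemma perm_dfs : perm_eq dfs (map (@wval n) (enum S)).
Proof.
apply: uniq_perm; [exact: dfs_uniq | by rewrite map_inj_uniq ?enum_uniq //; exact: wval_inj |].
move=> u; rewrite mem_dfs; apply/inTP/mapP => [[x Hx <-]|[x Hx ->]].
  by exists x => //; rewrite mem_enum.
by exists x => //; rewrite mem_enum in Hx.
Qed.

Lemma size_dfs : size dfs = n.
Proof. by rewrite (perm_size perm_dfs) size_map -cardE ptree_card. Qed.

Lemma size_tree_code : size tree_code = n.
Proof. by rewrite size_map size_dfs. Qed.

Lemma sumn_tree_code : (sumn tree_code).+1 = n.
Proof. by rewrite -size_tree_code (forest_code_size tree_code_forest) addn1. Qed.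

End Words.

Arguments dfs {n} S : simpl never.

Section OfCode.
Variables (n : nat) (t : seq nat) (Ht : forest_code 1 t) (Hn : size t = n).

Definition tree_of_code : {set word n} := [set x | wval x \in verts t].

Lemma verts_letters u : u \in verts t -> all (fun i => i < n) u.
Proof.
elim/last_ind: u => // u i IH Hu; rewrite all_rcons.
have Hu' := verts_parent Hu; rewrite IH // andbT.
move: Hu; rewrite rcons_verts // => /leq_trans -> //.
have E : map (tree_deg t) (verts t) = t by apply: tree_deg_verts.
have := map_f (tree_deg t) Hu'; rewrite E => Hm.
have : tree_deg t u <= sumn t.
  by move: (tree_deg t u) Hm => k; elim: (t) => //= a l IHl; rewrite inE => /orP[/eqP->|/IHl]; lia.
have := forest_code_size Ht; lia.
Qed.

Lemma verts_size u : u \in verts t -> size u < n.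
Proof.
move=> Hu; suff : size (map (fun k => take k u) (iota 0 (size u).+1)) <= size (verts t).
  by rewrite size_map size_iota size_verts // Hn.
apply: uniq_leq_size.
  rewrite map_inj_in_uniq ?iota_uniq // => a b; rewrite !mem_iota !add0n /= => Ha Hb.
  by move=> /(congr1 size); rewrite !size_takel //; lia.
move=> v /mapP[k _ ->]; rewrite -(cat_take_drop k u) in Hu.
elim/last_ind: (drop k u) Hu => [|r i IH]; first by rewrite cats0.
by rewrite -rcons_cat => /verts_parent.
Qed.

Lemma inT_of_code u : inT tree_of_code u = (u \in verts t).
Proof.
apply/inTP/idP => [[x]|Hu]; first by rewrite inE => H <-.
have [x Ex] := wval_surj (verts_size Hu) (verts_letters Hu).
by exists x => //; rewrite inE Ex.
Qed.

Lemma tree_of_code_ptree : is_ptree tree_of_code.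
Proof.
apply/and4P; split.
- by rewrite inT_of_code root_verts.
- apply/eqP; rewrite -[RHS]Hn -[RHS]size_verts //.
  have -> : size (verts t) = size (map (@wval n) (enum tree_of_code)).
    apply/perm_size/uniq_perm; first exact: verts_uniq.
      by rewrite map_inj_uniq ?enum_uniq //; exact: wval_inj.
    move=> u; rewrite -inT_of_code; apply/inTP/mapP => [[x Hx <-]|[x Hx ->]].
      by exists x => //; rewrite mem_enum.
    by exists x => //; rewrite mem_enum in Hx.
  by rewrite size_map -cardE.
- apply/forallP => x; apply/implyP; rewrite inE inT_of_code.
  case/lastP: (wval x) => [|u i]; first by rewrite root_verts.
  by rewrite take_rcons_belast => /verts_parent.
- apply/forallP => x; apply/implyP; rewrite inE inT_of_code.
  case/lastP: (wval x) => [|u i] //.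
  rewrite take_rcons_belast last_rcons => Hu.
  have Hp := verts_parent Hu; rewrite rcons_verts //.
  by move: Hu; rewrite rcons_verts //; case: i => //= i; lia.
Qed.

Lemma outdeg_of_code u : outdeg tree_of_code u = tree_deg t u.
Proof.
have H i : (i < outdeg tree_of_code u) = (i < tree_deg t u).
  rewrite -ptree_outdeg; last exact: tree_of_code_ptree.
  rewrite inT_of_code; case: (boolP (u \in verts t)) => Hu.
    by rewrite rcons_verts.
  rewrite tree_deg_out //; apply/negP => /verts_parent; exact/negP.
apply/eqP; rewrite eqn_leq; apply/andP; split; rewrite leqNgt -?H ?ltnn //.
by rewrite H ltnn.
Qed.

Lemma code_of_code : tree_code tree_of_code = t.
Proof.
have E : map (outdeg tree_of_code) (verts t) = t.
  by rewrite -[RHS]tree_deg_verts //; apply: eq_map; exact: outdeg_of_code.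
by rewrite /tree_code /dfs (@run_walk _ _ t) // Hn.
Qed.

End OfCode.

Lemma tree_code_inj n (S S' : {set word n}) : is_ptree S -> is_ptree S' ->
  tree_code S = tree_code S' -> S = S'.
Proof.
move=> HS HS' E; apply/setP => x.
by rewrite -!mem_inT -!mem_dfs // -!walk_tree_code E.
Qed.

(** * The cycle lemma as a bijection between pointed trees and bridges *)

Section Rotations.
Variable n : nat.

Definition fseq (f : {ffun 'I_n -> 'I_n}) : seq nat := [seq val (f i) | i <- enum 'I_n].

Definition rotcode (S : {set word n}) (x : word n) : seq nat :=
  rot (index (wval x) (dfs S)) (tree_code S).

(** When the length is n and the sum n - 1, every letter is below n and the default [i] is never
    taken; hence bridges can live in a finite type. *)
Definition ffun_of_seq (s : seq nat) : {ffun 'I_n -> 'I_n} :=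
  [ffun i : 'I_n => odflt i (insub (nth 0 s i))].

Definition bridges : {set {ffun 'I_n -> 'I_n}} := [set f | (sumn (fseq f)).+1 == n].

Definition pointed_trees : {set {set word n} * word n} :=
  [set p | is_ptree p.1 && (p.2 \in p.1)].

Definition bridge_of (p : {set word n} * word n) := ffun_of_seq (rotcode p.1 p.2).

Lemma size_fseq f : size (fseq f) = n.
Proof. by rewrite size_map size_enum_ord. Qed.

Lemma nth_fseq f (i : 'I_n) : nth 0 (fseq f) i = f i.
Proof. by rewrite (nth_map i) ?size_enum_ord // nth_ord_enum. Qed.

Lemma fseq_inj : injective fseq.
Proof.
by move=> f g E; apply/ffunP => i; apply/val_inj; rewrite /= -!nth_fseq E.
Qed.

Lemma leq_sumn k s : k \in s -> k <= sumn s.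
Proof. by elim: s => //= a l IHl; rewrite inE => /orP[/eqP->|/IHl]; lia. Qed.

Lemma ffun_of_seqK s : size s = n -> (sumn s).+1 = n -> fseq (ffun_of_seq s) = s.
Proof.
move=> Hs Hn; apply: (@eq_from_nth _ 0); rewrite size_fseq // => i Hi.
rewrite -[i]/(val (Ordinal Hi)) nth_fseq ffunE /=.
case: insubP => //=; rewrite -leqNgt => H.
have : nth 0 s i <= sumn s by apply: leq_sumn; rewrite mem_nth // Hs.
by lia.
Qed.

Lemma size_rotcode S x : is_ptree S -> size (rotcode S x) = n.
Proof. by move=> HS; rewrite size_rot size_tree_code. Qed.

Lemma sumn_rotcode S x : is_ptree S -> (sumn (rotcode S x)).+1 = n.
Proof. by move=> HS; rewrite sumn_rot sumn_tree_code. Qed.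

Lemma fseq_bridge_of p : p \in pointed_trees -> fseq (bridge_of p) = rotcode p.1 p.2.
Proof.
rewrite inE => /andP[HS _]; apply: ffun_of_seqK.
  exact: size_rotcode.
exact: sumn_rotcode.
Qed.

(** [t] is itself a rotation of [t'], and uniqueness in the cycle lemma makes this rotation trivial.
    Its offset may also be the full length, which is treated apart. *)
Lemma rot_tree_code_eq (t t' : seq nat) i i' :
  size t = size t' -> i < size t -> i' < size t ->
  forest_code 1 t -> forest_code 1 t' -> rot i t = rot i' t' -> t = t' /\ i = i'.
Proof.
move=> Es Hi Hi' H H' E.
have : t = rot (size t - i) (rot i' t').
  by rewrite -E -{1}(rotK i t) /rotr size_rot.
rewrite rot_add_mod -?Es ?leq_subr ?(ltnW Hi') //.
set j := if _ then _ else _ => Et.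
have jn : j <= size t by rewrite /j; case: ifP; lia.
have tt' : t = t'.
  have [jlt|jge] := ltnP j (size t).
    have j0 : j = 0 by apply: (@rot_tree_code_unique t'); rewrite -?Es -?Et.
    by rewrite Et j0 rot0.
  by rewrite Et rot_oversize // -Es.
split=> //; subst t'.
have [jlt|jge] := ltnP j (size t).
  have j0 : j = 0 by apply: (@rot_tree_code_unique t); rewrite -?Et.
  by move: j0; rewrite /j; case: ifP; lia.
by move: jge; rewrite /j; case: ifP; lia.
Qed.

Lemma bridge_of_inj : {in pointed_trees &, injective bridge_of}.
Proof.
move=> [S x] [S' x'] Hp Hp' /(congr1 fseq); rewrite !fseq_bridge_of //=.
move: Hp Hp'; rewrite !inE /= => /andP[HS Hx] /andP[HS' Hx'] E.
have Hi : index (wval x) (dfs S) < size (tree_code S).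
  by rewrite size_tree_code // -[X in _ < X](size_dfs HS) index_mem mem_dfs // mem_inT.
have Hi' : index (wval x') (dfs S') < size (tree_code S).
  by rewrite size_tree_code // -[X in _ < X](size_dfs HS') index_mem mem_dfs // mem_inT.
have [|Et Ei] := rot_tree_code_eq _ Hi Hi' (tree_code_forest HS) (tree_code_forest HS') E.
  by rewrite !size_tree_code.
have ES : S = S' by apply: tree_code_inj.
subst S'; congr pair; apply: wval_inj.
rewrite -[wval x](@nth_index _ [::] _ (dfs S)); last by rewrite mem_dfs // mem_inT.
by rewrite Ei nth_index // mem_dfs // mem_inT.
Qed.

Lemma bridge_of_surj : bridge_of @: pointed_trees = bridges.
Proof.
apply/setP => f; apply/imsetP/idP => [[p Hp ->]|].
  rewrite inE fseq_bridge_of //; move: Hp; rewrite inE => /andP[HS _].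
  by rewrite sumn_rotcode.
rewrite inE => /eqP Hf.
have [i Hi Ht] : exists2 i, i < size (fseq f) & forest_code 1 (rot i (fseq f)).
  by apply: rot_tree_code; rewrite size_fseq.
have Hsz : size (rot i (fseq f)) = n by rewrite size_rot size_fseq.
pose S := tree_of_code n (rot i (fseq f)).
have HS : is_ptree S by apply: tree_of_code_ptree.
(* The tree code is the bridge rotated by i, so the bridge starts at position n - i of the code,
   taken modulo n. *)
pose j := if i == 0 then 0 else n - i.
have jn : j < n.
  by rewrite /j; rewrite size_fseq in Hi; case: eqP; lia.
have /inTP[x Hx Ex] : inT S (nth [::] (dfs S) j).
  by rewrite -mem_dfs // mem_nth // size_dfs.
have Hq : (S, x) \in pointed_trees by rewrite inE; apply/andP; split.
exists (S, x) => //; apply: fseq_inj; rewrite fseq_bridge_of // /rotcode Ex.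
rewrite index_uniq ?dfs_uniq ?size_dfs // code_of_code // /j.
case: eqP => [->|_]; first by rewrite !rot0.
have -> : (n - i)%N = (size (rot i (fseq f)) - i)%N by rewrite Hsz.
by rewrite -[LHS](rotK i).
Qed.

End Rotations.

(** * Reading subtrees and siblings off the rotated code *)

Lemma size_walk_prefix st s r : forest_code (size st) (s ++ r) ->
  size (walk st s) = size s.
Proof.
elim: s st => [|k s IH] [|v st] //= H.
by rewrite IH // size_cat size_children addnC.
Qed.

Lemma prefix_rot (s u v : seq nat) i : i + size u <= size s ->
  prefix (u ++ v) (rot i s) -> prefix v (rot (i + size u) s).
Proof.
move=> H /prefixP[r Er]; rewrite addnC rotD; last by rewrite addnC.
by rewrite Er -catA rot_size_cat -catA prefix_prefix.
Qed.

Section Reading.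
Variables (n : nat) (S : {set word n}).
Hypothesis HS : is_ptree S.

Let t := tree_code S.

Definition stack_at (i : nat) : seq (seq nat) := stack_after [:: [::]] (take i t).

Definition rotcode_at (v : seq nat) : seq nat := rot (index v (dfs S)) t.

Let szt : size t = n. Proof. exact: size_tree_code. Qed.
Let Ht : forest_code 1 t. Proof. exact: tree_code_forest. Qed.

Lemma stack_at_forest i : forest_code (size (stack_at i)) (drop i t).
Proof. by apply: stack_after_forest_code; rewrite cat_take_drop. Qed.

Lemma dfs_drop i : i <= n -> drop i (dfs S) = walk (stack_at i) (drop i t).
Proof.
move=> Hi; rewrite -(walk_tree_code S) /verts -/t -{1}(cat_take_drop i t) walk_cat.
have E : size (walk [:: [::]] (take i t)) = i.
  rewrite (@size_walk_prefix _ _ (drop i t)) ?cat_take_drop //.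
  by rewrite size_takel // szt.
by rewrite -{1}E drop_size_cat.
Qed.

Lemma drop_code i : drop i t = map (outdeg S) (drop i (dfs S)).
Proof. by rewrite map_drop. Qed.

Lemma stack_at_cons i : i < n ->
  exists st, stack_at i = nth [::] (dfs S) i :: st.
Proof.
move=> Hi; have := dfs_drop (ltnW Hi).
rewrite (drop_nth [::]) ?size_dfs // (drop_nth 0) ?szt //.
by case: (stack_at i) => //= u st [->] _; exists st.
Qed.

Lemma stack_at_lt i u st : i <= n -> stack_at i = u :: st ->
  i < n /\ nth [::] (dfs S) i = u.
Proof.
move=> Hi Es; have := stack_at_forest i; rewrite Es /=.
case: (ltnP i n) => Hn; last by rewrite drop_oversize // szt.
by have [st' ] := stack_at_cons Hn; rewrite Es => -[-> _].
Qed.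

Lemma stack_atS i u st : i < n -> stack_at i = u :: st ->
  stack_at i.+1 = children u (nth 0 t i) ++ st.
Proof.
move=> Hi Es; rewrite /stack_at (take_nth 0) ?szt // -cats1 stack_after_cat.
by rewrite -/(stack_at i) Es.
Qed.

Lemma read_forest i m c r : i <= n -> forest_code m c -> m <= size (stack_at i) ->
  prefix (c ++ r) (rot i t) ->
  [/\ i + size c <= n, stack_at (i + size c) = drop m (stack_at i),
      take (size c) (drop i t) = c,
      take (size c) (drop i (dfs S)) = walk (take m (stack_at i)) c &
      prefix r (rot (i + size c) t)].
Proof.
move=> Hi Hc Hm Hp; have Hf := stack_at_forest i.
have Hd : size (drop i t) = n - i by rewrite size_drop szt.
have Hpc : prefix c (drop i t ++ take i t).
  by apply: prefix_trans Hp; rewrite prefix_prefix.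
have Ec : take (size c) (drop i t) = c.
  have [cd|dc] := leqP (size c) (size (drop i t)).
    by move: Hpc; rewrite prefixE takel_cat // => /eqP.
  move: Hpc => /prefixP[r' Er].
  have Ec : c = drop i t ++ drop (size (drop i t)) c.
    have E : drop i t = take (size (drop i t)) c.
      by rewrite -(takel_cat r' (ltnW dc)) -Er take_size_cat.
    by rewrite {1}E cat_take_drop.
  have nz : drop (size (drop i t)) c != [::] by rewrite -size_eq0 (size_drop (size (drop i t)) c) -lt0n subn_gt0.
  move: (Hc); rewrite Ec => /forest_code_proper_prefix/(_ nz).
  by rewrite (forest_code_size Hf) ltn_add2l ltnNge Hm.
have sc : i + size c <= n.
  have : size c <= size (drop i t) by rewrite -Ec size_take; case: ltnP => // /ltnW.
  by rewrite Hd; lia.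
have Es : size (take m (stack_at i)) = m by rewrite size_takel.
have Dt : drop i t = c ++ drop (size c) (drop i t) by rewrite -{1}Ec cat_take_drop.
split => //.
- rewrite /stack_at takeD Ec stack_after_cat -/(stack_at i).
  by rewrite -{1}(cat_take_drop m (stack_at i)) stack_after_forest ?Es.
- rewrite dfs_drop // Dt walk_cat.
  rewrite -{1}(cat_take_drop m (stack_at i)) walk_forest ?Es //.
  by rewrite take_size_cat // size_walk ?Es.
- by apply: prefix_rot => //; rewrite szt.
Qed.

(** After the letter k and the a trees coded by [g], the top of the stack is child number a of [y].
    Thus an occurrence of a parent word followed by [c] becomes an occurrence of [c] below a vertex
    of known outdegree. *)
Lemma read_parent i k g a c : i < n -> prefix (k :: g ++ c) (rot i t) ->
  forest_code a g -> a < k ->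
  let y := nth [::] (dfs S) i in
  [/\ outdeg S y = k, inT S (rcons y a) & prefix c (rotcode_at (rcons y a))].
Proof.
move=> Hi Hp Hg ak y; have [st Es] := stack_at_cons Hi.
have Ek : nth 0 t i = k.
  have : i < size t by rewrite szt.
  move=> /(drop_nth 0) Ed; move: Hp; rewrite /rot Ed /= => /andP[/eqP-> _] //.
have Hdeg : outdeg S y = k by rewrite -Ek /t /tree_code (nth_map [::]) ?size_dfs.
have Es1 := stack_atS Hi Es; rewrite Ek in Es1.
have Hp1 : prefix (g ++ c) (rot i.+1 t).
  have H : i + size [:: k] <= size t by rewrite addn1 szt.
  by rewrite -addn1; exact: (prefix_rot H Hp).
have [|H1 H2 _ _ H5] := read_forest Hi Hg _ Hp1.
  by rewrite Es1 size_cat size_children; lia.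
have Es2 : stack_at (i.+1 + size g) = rcons y a :: drop a.+1 (stack_at i.+1).
  rewrite H2 (drop_nth [::]); last by rewrite Es1 size_cat size_children; lia.
  congr (_ :: _); rewrite Es1 nth_cat size_children ak (nth_map 0) ?size_iota //.
  by rewrite nth_iota.
have [H6 H7] := stack_at_lt H1 Es2.
split => //.
  by rewrite -mem_dfs // -H7 mem_nth // size_dfs.
by rewrite /rotcode_at -H7 index_uniq ?size_dfs // dfs_uniq.
Qed.

(** Stack invariant: below a pending child lies its next sibling. It shows that the trees read from
    a vertex on are those of consecutive siblings. *)
Fixpoint sibling_chain (st : seq (seq nat)) : Prop :=
  if st is x :: st' then
    (forall y b, x = rcons y b -> b.+1 < outdeg S y ->
      exists st2, st' = rcons y b.+1 :: st2) /\ sibling_chain st'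
  else True.

Lemma sibling_chain_children y st : sibling_chain st ->
  sibling_chain (children y (outdeg S y) ++ st).
Proof.
move=> Hst; rewrite /children.
have : 0 + outdeg S y = outdeg S y by [].
move: {1 3}(outdeg S y) => k; elim: k 0 => [|k IH] b //= Hb; split.
  move=> y' b' /eqP; rewrite eqseq_rcons => /andP[/eqP <- /eqP <-] Hlt.
  case: k {IH} Hb => [|k] Hb; first by lia.
  by exists ([seq rcons y i | i <- iota b.+2 k] ++ st).
by apply: IH; rewrite -Hb addSnnS.
Qed.

Lemma stack_at_sibling i : i <= n -> sibling_chain (stack_at i).
Proof.
elim: i => [|i IH] Hi.
  rewrite /stack_at take0 /=; split => // y b /(congr1 size).
  by rewrite size_rcons.
have [st Es] := stack_at_cons Hi; rewrite (stack_atS Hi Es).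
have := IH (ltnW Hi); rewrite Es /= => -[_ H].
have -> : nth 0 t i = outdeg S (nth [::] (dfs S) i).
  by rewrite /t /tree_code (nth_map [::]) ?size_dfs.
exact: sibling_chain_children.
Qed.

Lemma sibling_chain_iota y m a st st1 : st = rcons y a :: st1 -> sibling_chain st ->
  a + m.+1 <= outdeg S y -> exists st2, st = [seq rcons y i | i <- iota a m.+1] ++ st2.
Proof.
elim: m a st st1 => [|m IH] a st st1 Es Hst Hm; first by exists st1; rewrite Es.
move: Hst; rewrite Es /= => -[/(_ y a erefl) H Hst1].
have [|st2 E2] := H; first by lia.
have [|st3 E3] := IH a.+1 st1 st2 E2 Hst1; first by lia.
by exists st3; rewrite E3.
Qed.

Lemma perm_children_dfs : perm_eq [seq v <- dfs S | v != [::]]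
  [seq rcons u i | u <- dfs S, i <- iota 0 (outdeg S u)].
Proof.
apply: uniq_perm; first by rewrite filter_uniq // dfs_uniq.
  apply: allpairs_uniq_dep; [exact: dfs_uniq | by move=> u _; exact: iota_uniq |].
  move=> [u i] [v j] _ _ /= /eqP; rewrite eqseq_rcons => /andP[/eqP -> /eqP ->].
  by [].
move=> v; rewrite mem_filter; apply/andP/allpairsPdep.
  case/lastP: v => [[//]|u i [_]]; rewrite mem_dfs // => Hv.
  exists u, i; split => //; first by rewrite mem_dfs //; exact: ptree_parent Hv.
  by rewrite mem_iota /= -ptree_outdeg.
move=> [u [i [Hu Hi ->]]]; split; first by rewrite -size_eq0 size_rcons.
by rewrite mem_dfs // ptree_outdeg // -[i < _]/(0 <= i < 0 + _) -mem_iota.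
Qed.

End Reading.

(** * Finite families of trees *)

Fixpoint forests (T : seq (seq nat)) (k : nat) : seq (seq nat) :=
  if k is k'.+1 then [seq t ++ f | t <- T, f <- forests T k'] else [:: [::]].

(** One parameter truncates both height and outdegrees, which keeps the family finite; every finite
    tree belongs to it once [h] is large. *)
Fixpoint trees (h : nat) : seq (seq nat) :=
  if h is h'.+1 then [seq k :: f | k <- iota 0 h, f <- forests (trees h') k] else [::].

Definition forest_size (g : seq nat) : nat := size g - sumn g.

(* Words u = k :: g that can precede a vertex x in depth-first order when the
   parent of x has k children and g codes the subtrees at the left siblings of x. *)
Definition parent_word (K : nat) (u : seq nat) : bool :=
  if u is k :: g then [&& k <= K, forest_size g < k & forest_code (forest_size g) g]
  else false.

Definition parent_words (T : seq (seq nat)) (K : nat) : seq (seq nat) :=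
  [seq k :: g | k <- iota 0 K.+1, g <- [seq f | a <- iota 0 k, f <- forests T a]].

Lemma forest_sizeE a g : forest_code a g -> forest_size g = a.
Proof. by rewrite /forest_size => /forest_code_size->; rewrite addKn. Qed.

Lemma forest_code_inj m (t t' f f' : seq nat) : forest_code m t -> forest_code m t' ->
  t ++ f = t' ++ f' -> t = t' /\ f = f'.
Proof.
move=> Ht Ht' E; suff Et : t = t'.
  by split=> //; move: E; rewrite Et => /eqP; rewrite eqseq_cat // eqxx => /eqP.
have [le|le] := leqP (size t) (size t').
  apply: (forest_code_prefix Ht Ht' (r' := drop (size t) t')).
  have := congr1 (take (size t')) E; rewrite [RHS]take_size_cat // take_cat ltnNge le /= => E2.
  by rewrite -E2 drop_size_cat.
apply/esym/(forest_code_prefix Ht' Ht (r' := drop (size t') t)).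
have := congr1 (take (size t)) E; rewrite [LHS]take_size_cat // take_cat ltnNge (ltnW le) /= => E2.
by rewrite {1}E2 drop_size_cat // -E2.
Qed.

Lemma allpairs_uniq_key (A B C : eqType) (s : seq A) (t : A -> seq B) (f : A -> B -> C) :
  uniq s -> (forall x, x \in s -> uniq (t x)) ->
  (forall x y x' y', x \in s -> y \in t x -> x' \in s -> y' \in t x' -> f x y = f x' y' -> x = x' /\ y = y') ->
  uniq [seq f x y | x <- s, y <- t x].
Proof.
move=> us ut inj; apply: allpairs_uniq_dep => // -[x y] [x' y'].
move=> /allpairsPdep[a [b [Ha Hb /(congr1 (fun p : {_ : A & B} => (tag p, tagged p)))/= [-> ->]]]].
move=> /allpairsPdep[a' [b' [Ha' Hb' /(congr1 (fun p : {_ : A & B} => (tag p, tagged p)))/= [-> ->]]]].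
by move=> /(inj _ _ _ _ Ha Hb Ha' Hb')[-> ->].
Qed.

Section Families.
Variables (T : seq (seq nat)).
Hypotheses (uT : uniq T) (cT : all (forest_code 1) T).

Lemma forests_code k : all (forest_code k) (forests T k).
Proof.
elim: k => //= k IH; apply/allP => _ /allpairsP[[t f] /= [tT fF ->]].
by rewrite -add1n forest_code_cat //; [exact: (allP cT) | exact: (allP IH)].
Qed.

Lemma forests_uniq k : uniq (forests T k).
Proof.
elim: k => //= k IH; apply: allpairs_uniq => // -[t f] [t' f'] /=.
move=> /allpairsP[[a b] /= [aT bF [-> ->]]] /allpairsP[[a' b'] /= [aT' bF' [-> ->]]].
by move=> /(forest_code_inj (allP cT _ aT) (allP cT _ aT'))[-> ->].
Qed.

Lemma parent_words_ok K : all (parent_word K) (parent_words T K).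
Proof.
apply/allP => _ /allpairsPdep[k [g [kK /allpairsPdep[a [f [ak fF ->]]] ->]]].
rewrite mem_iota /= in kK; rewrite mem_iota /= in ak.
have cf := allP (forests_code a) _ fF.
by rewrite /= (forest_sizeE cf) ak cf -ltnS kK.
Qed.

Lemma parent_words_uniq K : uniq (parent_words T K).
Proof.
apply: allpairs_uniq_key; first exact: iota_uniq; last by move=> k g k' g' _ _ _ _ [-> ->].
move=> k _; apply: allpairs_uniq_key; first exact: iota_uniq.
  by move=> a _; exact: forests_uniq.
move=> a f a' f' _ /(allP (forests_code _)) H1 _ /(allP (forests_code _)) H2 E.
by split => //; rewrite -(forest_sizeE H1) -(forest_sizeE H2) E.
Qed.

End Families.

Lemma treesS h : trees h.+1 = [seq k :: f | k <- index_iota 0 h.+1, f <- forests (trees h) k].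
Proof. by []. Qed.

Lemma trees_code h : all (forest_code 1) (trees h).
Proof.
elim: h => // h IH; apply/allP => _ /allpairsPdep[k [f [_ fF ->]]] /=.
exact: (allP (forests_code IH k)).
Qed.

Lemma trees_uniq h : uniq (trees h).
Proof.
elim: h => // h IH; apply: allpairs_uniq_key; first exact: iota_uniq.
  by move=> k _; apply: forests_uniq => //; exact: trees_code.
by move=> k f k' f' _ _ _ _ [-> ->].
Qed.

(** * Vertices seen from a path *)

Lemma tree_code_unique deg (t t' : seq nat) : forest_code 1 t -> forest_code 1 t' ->
  map deg (verts t) = t -> map deg (verts t') = t' -> t = t'.
Proof.
move=> H H' E E'; rewrite -E -E'; congr map.
rewrite /verts -(@run_walk deg [:: [::]] t (size t + size t') H E (leq_addr _ _)).
by rewrite (@run_walk deg [:: [::]] t' (size t + size t') H' E' (leq_addl _ _)).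
Qed.

Lemma gw_present_subtree t (base : seq nat) (x : seq nat -> nat) : forest_code 1 t ->
  base \in verts t ->
  (forall v, base ++ v \in verts t -> x v = tree_deg t (base ++ v)) ->
  forall v, (if gw_present x v then x v else 0) = tree_deg t (base ++ v).
Proof.
move=> Ht Hb Hx v.
have E : gw_present x v = (base ++ v \in verts t).
  elim/last_ind: v => [|v i IH]; first by rewrite cats0 Hb; apply/forallP => -[].
  rewrite gw_present_rcons IH -rcons_cat; case Hu: (base ++ v \in verts t) => /=.
    by rewrite rcons_verts // Hx.
  by apply/esym/negP => /verts_parent; rewrite Hu.
by rewrite E; case: ifPn => [/Hx //|/(tree_deg_out Ht) ->].
Qed.

Lemma verts_prefix t u v : u ++ v \in verts t -> u \in verts t.
Proof.
elim/last_ind: v => [|v i IH]; rewrite ?cats0 // -rcons_cat.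
by move/verts_parent.
Qed.

(* Position of a vertex w relative to the path from the root to u: a descendant
   of u, or a descendant of the l-th sibling on side s of the spine vertex u_j
   ([inl] of its name in the universal tree), or the spine vertex u_(j+1) itself
   ([inr j]). *)
Fixpoint locate (u w : seq nat) : nsv + nat :=
  match u with
  | [::] => inl (None, w)
  | c :: u' =>
    match w with
    | [::] => inr (size u')
    | a :: w' => if a == c then locate u' w'
        else inl (Some (size u', c < a, if c < a then a - c - 1 else c - 1 - a), w')
    end
  end.

Definition letter (s : bool) (c l : nat) : option nat :=
  if s then Some (c + 1 + l) else if l < c then Some (c - 1 - l) else None.

Definition place (u : seq nat) (e : nsv + nat) : option (seq nat) :=
  match e with
  | inl (None, w) => Some (u ++ w)
  | inl (Some (j, s, l), w) =>
      if letter s (nth 0 u (size u - j.+1)) l is Some a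
      then Some (rcons (take (size u - j.+1) u) a ++ w) else None
  | inr j => Some (take (size u - j.+1) u)
  end.

Lemma locate_desc u w : locate u (u ++ w) = inl (None, w).
Proof. by elim: u => //= c u ->; rewrite eqxx. Qed.

Lemma locate_spine p c r : locate (p ++ c :: r) p = inr (size r).
Proof. by elim: p => //= d p ->; rewrite eqxx. Qed.

Lemma letter_neq s c l a : letter s c l = Some a -> a != c.
Proof.
by rewrite /letter; case: s => [[<-]|]; [lia | case: ifP => // lc [<-]; lia].
Qed.

Lemma locate_side p c r s l a w : letter s c l = Some a ->
  locate (p ++ c :: r) (rcons p a ++ w) = inl (Some (size r, s, l), w).
Proof.
move=> Ha; elim: p => [|d p IH] /=; last by rewrite eqxx.
rewrite (negbTE (letter_neq Ha)); move: Ha; rewrite /letter; case: s => [[<-]|].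
  have -> : c < c + 1 + l by lia.
  by congr (inl (Some (_, _, _), _)); lia.
case: ifP => // lc [<-].
have -> : (c < c - 1 - l) = false by lia.
by congr (inl (Some (_, _, _), _)); lia.
Qed.

Lemma split_at u j : j < size u -> exists p r,
  [/\ u = p ++ nth 0 u (size u - j.+1) :: r, size r = j & p = take (size u - j.+1) u].
Proof.
move=> ju; exists (take (size u - j.+1) u), (drop (size u - j.+1).+1 u).
by rewrite -drop_nth ?cat_take_drop ?size_drop; [split => //; lia | lia].
Qed.

Lemma split_atE (p r : seq nat) c :
  nth 0 (p ++ c :: r) (size (p ++ c :: r) - (size r).+1) = c /\
  take (size (p ++ c :: r) - (size r).+1) (p ++ c :: r) = p.
Proof.
have -> : size (p ++ c :: r) - (size r).+1 = size p by rewrite size_cat /= addnK.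
by rewrite nth_cat ltnn subnn take_size_cat.
Qed.

Lemma place_locate u w : place u (locate u w) = Some w.
Proof.
have H : forall p, place (p ++ u) (locate u w) = Some (p ++ w).
  elim: u w => [|c u IH] [|a w] p /=.
  - by rewrite !cats0.
  - by rewrite cats0.
  - by have [_ ->] := split_atE p u c; rewrite cats0.
  - have [->|ac] := eqVneq a c; first by rewrite -!cat_rcons IH.
    rewrite /=; have [-> ->] := split_atE p u c.
    rewrite /letter; case: ltnP => ca.
      by rewrite cat_rcons; congr (Some (p ++ _ :: w)); lia.
    have -> : c - 1 - a < c by lia.
    by rewrite cat_rcons; congr (Some (p ++ _ :: w)); lia.
exact: (H [::]).
Qed.

Lemma locate_inj u : injective (locate u).
Proof. by move=> w w' E; apply: Some_inj; rewrite -!(place_locate u) E. Qed.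

Section Config.
Variables (L m : nat) (c u : seq nat).
Hypotheses (Hc : forest_code m c) (Hm : m = (2 * L).+1).

(** An artificial root of degree m carries the forest [c], so that a configuration is a plane tree
    pointed at [L :: u], the vertex [u] of the middle tree. *)
Let T := m :: c.
Let uL := L :: u.
Hypothesis Hu : uL \in verts T.
Let h := size u.

Lemma config_tree : forest_code 1 T.
Proof. by []. Qed.

Lemma config_root : tree_deg T [::] = m.
Proof. by []. Qed.

Definition config_deg (q : nsv) : nat :=
  if place uL (inl q) is Some w then tree_deg T w else 0.

(** [behead] removes the artificial root. It sits at spine index [size u], where the limit tree has
    its vertex of infinite degree instead of one with m children. *)
Definition config_queries : seq nsv :=
  pmap (fun e : nsv + nat => if e is inl q then Some q else None)
    [seq locate uL w | w <- behead (verts T)].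

Definition config_spine : seq nat :=
  pmap (fun e : nsv + nat => if e is inr j then Some j else None)
    [seq locate uL w | w <- behead (verts T)].

Definition config_Z (j : nat) : option nat * nat :=
  (Some (tree_deg T (take (h - j) uL)), nth 0 uL (h - j)).

(* The configuration determines only the first L siblings on either side of the
   top spine vertex: the values at the other ([~~ visible]) vertices are junk. *)
Definition config_point : Tbul :=
  (fun q : nsv => match q with
     | (None, _) => (Some (config_deg q) : nbar)
     | (Some (j, s, l), _) => if j <= h then (Some (config_deg q) : nbar) else (Some 0 : nbar)
     end,
   fun j => if j < h then let '(k, p) := config_Z j in
                spair (Some p) (Some (odflt 0 k - 1 - p))
            else if j == h then spair None None else star).

Definition visible (q : nsv) : bool :=
  match q with (None, _) => true | (Some (j, s, l), _) => (j == h) ==> (l < L) end.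

(** [Pos] at the index of the infinite vertex is left free: the encoding of the limit tree does not
    look at it. *)
Definition config_event (X : nsv -> nat) (Xh : nat -> option nat) (Pos : nat -> nat) : Prop :=
  [/\ forall q, q \in config_queries -> X q = config_deg q,
      forall j, j < h -> (Xh j, Pos j) = config_Z j & Xh h = None].

Lemma verts_rootE : verts T = [::] :: behead (verts T).
Proof. by []. Qed.

Lemma mem_behead_verts w : (w \in behead (verts T)) = (w != [::]) && (w \in verts T).
Proof.
rewrite verts_rootE inE; case: eqP => //= -> /=.
apply/negP => H; have := verts_uniq T; rewrite verts_rootE /=.
by rewrite -/(behead (verts T)) H.
Qed.

Lemma mem_queries q : reflect (exists2 w, w != [::] /\ w \in verts T & locate uL w = inl q)
  (q \in config_queries).
Proof.
rewrite mem_pmap; apply: (iffP mapP) => [[e /mapP[w Hw ->]]|[w [w0 Hw] E]].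
  case E: (locate uL w) => [q'|//] [->]; exists w => //.
  by move: Hw; rewrite mem_behead_verts => /andP[].
exists (inl q) => //; apply/mapP; exists w => //.
by rewrite mem_behead_verts w0.
Qed.

Lemma spine_vert p a r : uL = p ++ a :: r -> p \in verts T /\ a < tree_deg T p.
Proof.
move=> E; have H : rcons p a \in verts T.
  by apply: (@verts_prefix _ _ r); rewrite cat_rcons -E.
have Hp := verts_parent H; split => //.
by rewrite -rcons_verts.
Qed.

Lemma config_event_point X Xh Pos : config_event X Xh Pos ->
  let z := Tbar_enc X Xh Pos in
  (forall q, visible q -> z.1 q = config_point.1 q) /\ (forall j, z.2 j = config_point.2 j).
Proof.
case=> HX HZ Hh.
have alive j : [forall j' : 'I_j, Xh j' != None] = (j <= h).
  apply/forallP/idP => [H|jh j'].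
    by rewrite leqNgt; apply/negP => hj; have := H (Ordinal hj); rewrite /= Hh.
  by have := HZ j' (leq_trans (ltn_ord j') jh); rewrite /config_Z => -[-> _].
have sz : size uL = h.+1 by [].
move=> z; split; last first.
  move=> j; rewrite /z /Tbar_enc /config_point /= alive leq_eqVlt.
  case: (ltnP j h) => jh; first by rewrite orbT; have := HZ j jh; rewrite /config_Z => -[-> ->].
  by rewrite orbF; case: eqP => // ->; rewrite Hh.
case=> [[[[j s] l]|] w] /=; last first.
  move=> _.
  have := @gw_present_subtree T uL (fun u' => X (None, u')) config_tree Hu.
  have HD v : uL ++ v \in verts T -> X (None, v) = tree_deg T (uL ++ v).
    move=> Hv; rewrite HX //; apply/mem_queries; exists (uL ++ v); first by split.
    exact: locate_desc.
  by move=> /(_ HD w) E; rewrite /config_deg /= -[LHS]/(z.1 (None, w)) /z /Tbar_enc /= -E; case: ifP.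
move=> vis; rewrite alive; case: (leqP j h) => jh //=.
have jsz : j < size uL by rewrite sz ltnS.
have [p [r [Eu Er Ep]]] := split_at jsz.
set a := nth 0 uL (size uL - j.+1) in Eu.
have [pV aV] := spine_vert Eu.
rewrite /config_deg /= -/uL -/a -Ep.
(* A sibling exists in the limit tree iff it exists in [T]. At the top spine vertex the limit tree
   has infinitely many siblings but [T] only L on each side; for a visible coordinate both tests
   succeed. *)
have Exh : (match Xh j with None => true | Some k => if s then l < k - 1 - Pos j else l < Pos j end)
   = (if letter s a l is Some b then b < tree_deg T p else false).
  move: jh; rewrite leq_eqVlt => /orP[/eqP Ej|jh].
    have p0 : p = [::] by rewrite Ep sz Ej subnn take0.
    have aL : a = L by rewrite /a sz Ej subnn.
    move: vis; rewrite Ej eqxx /= => lL; rewrite -/h Hh p0 config_root Hm aL /letter.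
    by case: s; [lia | rewrite lL; lia].
  have := HZ j jh; rewrite /config_Z => -[-> ->].
  have E : h - j = size uL - j.+1 by rewrite sz.
  rewrite E -Ep -/a /letter; case: s => //; first by lia.
  by case: ltnP => // la; lia.
rewrite Exh; case El: (letter s a l) => [b|] //.
case: ltnP => bV.
  have bV' : rcons p b \in verts T by rewrite rcons_verts.
  have HD v : rcons p b ++ v \in verts T -> X (Some (j, s, l), v) = tree_deg T (rcons p b ++ v).
    move=> Hv; rewrite HX; first by rewrite /config_deg /= -/uL -/a El -Ep.
    apply/mem_queries; exists (rcons p b ++ v); first by split => //; case: (p).
    by rewrite Eu (locate_side _ _ _ El) Er.
  have := @gw_present_subtree T (rcons p b) (fun u' => X (Some (j, s, l), u')) config_tree bV' HD w.
  by move=> <- /=; case: ifP.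
rewrite tree_deg_out //; apply/negP => /verts_prefix.
by rewrite rcons_verts // ltnNge bV.
Qed.

End Config.

(** * Averages over pointed trees and the rotation correspondence *)

Local Open Scope ring_scope.

Section Average.
Variables (R : realType) (I : finType) (A : {set I}) (p : I -> R).
Hypothesis p0 : forall i, 0 <= p i.

Definition avg (F : I -> R) : R := (\sum_(i in A) p i * F i) / \sum_(i in A) p i.

Lemma avg_total_ge0 : 0 <= \sum_(i in A) p i.
Proof. by apply: sumr_ge0 => i _. Qed.

Lemma eq_avg F G : {in A, F =1 G} -> avg F = avg G.
Proof. by move=> E; congr (_ / _); apply: eq_bigr => i /E ->. Qed.

Lemma ler_avg F G : (forall i, i \in A -> 0 < p i -> F i <= G i) -> avg F <= avg G.
Proof.
move=> H; apply: ler_wpM2r; first by rewrite invr_ge0 avg_total_ge0.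
apply: ler_sum => i iA.
have := p0 i; rewrite le_eqVlt => /orP[/eqP<-|pi]; first by rewrite !mul0r.
by apply: ler_wpM2l => //; apply: H.
Qed.

Lemma avgD F G : avg (fun i => F i + G i) = avg F + avg G.
Proof.
by rewrite /avg -mulrDl -big_split /=; congr (_ / _); apply: eq_bigr => i _; rewrite mulrDr.
Qed.

Lemma avgZ a F : avg (fun i => a * F i) = a * avg F.
Proof.
rewrite /avg mulrA big_distrr /=; congr (_ / _); apply: eq_bigr => i _.
by rewrite mulrCA.
Qed.

Lemma avgZr a F : avg (fun i => F i * a) = avg F * a.
Proof. by rewrite mulrC -avgZ; apply: eq_avg => i _; rewrite mulrC. Qed.

Lemma avgN F : avg (fun i => - F i) = - avg F.
Proof.
rewrite -[RHS]mulN1r -avgZ; apply: eq_avg => i _; by rewrite mulN1r.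
Qed.

Lemma avgB F G : avg (fun i => F i - G i) = avg F - avg G.
Proof. by rewrite avgD avgN. Qed.

Lemma avg_sum (J : Type) (r : seq J) (Q : pred J) (F : J -> I -> R) :
  avg (fun i => \sum_(j <- r | Q j) F j i) = \sum_(j <- r | Q j) avg (F j).
Proof.
rewrite /avg -mulr_suml exchange_big /=; congr (_ / _).
by apply: eq_bigr => i _; rewrite mulr_sumr.
Qed.

Lemma avg_ge0 F : (forall i, i \in A -> 0 < p i -> 0 <= F i) -> 0 <= avg F.
Proof.
move=> H; have -> : 0 = avg (fun=> 0).
  by rewrite /avg; under eq_bigr do rewrite mulr0; rewrite big1 ?mul0r.
exact: ler_avg.
Qed.

Lemma avg_cst a : 0 < \sum_(i in A) p i -> avg (fun=> a) = a.
Proof.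
by move=> H; rewrite /avg -mulr_suml mulrAC divff ?mul1r // gt_eqF.
Qed.

Lemma avg_cst_le a : 0 <= a -> avg (fun=> a) <= a.
Proof.
move=> a0; have := avg_total_ge0; rewrite le_eqVlt => /orP[/eqP E|/avg_cst -> //].
by rewrite /avg -E invr0 mulr0.
Qed.

Lemma ler_norm_avg F : `|avg F| <= avg (fun i => `|F i|).
Proof.
rewrite ler_norml -avgN; apply/andP; split; apply: ler_avg => i _ _.
  by rewrite lerNl ler_normr lexx orbT.
exact: ler_norm.
Qed.

Lemma avg_prob_le1 (Q : I -> bool) : avg (fun i => (Q i)%:R) <= 1.
Proof.
have := @avg_cst_le 1 ler01; apply: le_trans.
by apply: ler_avg => i _ _; case: (Q i); rewrite ?ler01.
Qed.

Lemma avg_prob_ge0 (Q : I -> bool) : 0 <= avg (fun i => (Q i)%:R).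
Proof. by apply: avg_ge0. Qed.

End Average.

Section Model.
Variables (R : realType) (w : nat -> R) (n : nat).

Definition fwt (f : {ffun 'I_n -> 'I_n}) : R := \prod_(k <- fseq f) w k.

Definition avgB_ (F : seq nat -> R) : R :=
  avg (bridges n) fwt (fun f => F (fseq f)).

(* [avgT] is the expectation over (T_n, v_0) ([0] if no tree has positive weight). *)
Definition avgT (F : {set word n} -> word n -> R) : R :=
  avg (pointed_trees n) (fun q => tree_wt w q.1) (fun q => F q.1 q.2).

Lemma tree_wt_code (S : {set word n}) : is_ptree S ->
  tree_wt w S = \prod_(k <- tree_code S) w k.
Proof.
move=> HS; rewrite /tree_wt /tree_code big_map (perm_big _ (perm_dfs HS)) /=.
by rewrite big_map big_enum.
Qed.

Lemma fwt_bridge_of q : q \in pointed_trees n -> fwt (bridge_of q) = tree_wt w q.1.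
Proof.
move=> Hq; rewrite /fwt fseq_bridge_of //.
move: Hq; rewrite inE => /andP[HS _].
by rewrite tree_wt_code //; apply: perm_big; rewrite perm_rot.
Qed.

Lemma sum_bridges (F : seq nat -> R) :
  \sum_(f in bridges n) fwt f * F (fseq f) =
  \sum_(q in pointed_trees n) tree_wt w q.1 * F (rotcode q.1 q.2).
Proof.
rewrite -bridge_of_surj (big_imset _ (@bridge_of_inj n)) /=.
by apply: eq_bigr => q Hq; rewrite fwt_bridge_of // fseq_bridge_of.
Qed.

Lemma total_bridges :
  \sum_(f in bridges n) fwt f = \sum_(q in pointed_trees n) tree_wt w q.1.
Proof.
have := sum_bridges (fun=> 1).
by under eq_bigr do rewrite mulr1; move->; apply: eq_bigr => q _; rewrite mulr1.
Qed.

(** The bijection keeps weights, because rotation only permutes letters. On the side of bridges all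
    positions are alike. *)
Lemma avgT_rotcode (F : seq nat -> R) :
  avgT (fun S x => F (rotcode S x)) = avgB_ F.
Proof. by rewrite /avgT /avgB_ /avg -sum_bridges -total_bridges. Qed.

Lemma sum_pointed_trees (F : {set word n} -> word n -> R) :
  \sum_(q in pointed_trees n) tree_wt w q.1 * F q.1 q.2 =
  \sum_(S : {set word n} | is_ptree S) \sum_(x in S) tree_wt w S * F S x.
Proof.
rewrite pair_big_dep /=; apply: eq_bigl => q; by rewrite inE.
Qed.

Lemma total_pointed_trees :
  \sum_(q in pointed_trees n) tree_wt w q.1 = Zn w n * n%:R.
Proof.
have := sum_pointed_trees (fun _ _ => 1); under eq_bigr do rewrite mulr1.
move->; rewrite /Zn big_distrl /=; apply: eq_bigr => S HS.
under eq_bigr do rewrite mulr1.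
by rewrite sumr_const ptree_card // mulr_natr.
Qed.

Lemma EH_avgT Om (F : option Tbul -> R) :
  EH w n Om F = avgT (fun S x => F (H_enc (outdeg S) (wval x) Om)).
Proof.
rewrite /avgT /avg total_pointed_trees.
rewrite (sum_pointed_trees (fun S x => F (H_enc (outdeg S) (wval x) Om))).
rewrite /EH [RHS]mulr_suml; apply: eq_bigr => S _.
by rewrite [RHS]mulr_suml; apply: eq_bigr => x _; rewrite mulrAC.
Qed.

Lemma PrTn_avgT (Q : {set word n} -> bool) : (0 < n)%N ->
  PrTn w Q = avgT (fun S _ => (Q S)%:R).
Proof.
move=> n0; rewrite /avgT /avg total_pointed_trees.
rewrite (sum_pointed_trees (fun S _ => (Q S)%:R)) /PrTn big_mkcondr [RHS]mulr_suml.
apply: eq_bigr => S HS; rewrite sumr_const ptree_card //.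
case: (Q S) => /=; last by rewrite mulr0 mul0rn mul0r.
have nn : n%:R != 0 :> R by rewrite pnatr_eq0 -lt0n.
by rewrite mulr1 -[tree_wt w S *+ n]mulr_natr invfM mulrACA divff // mulr1.
Qed.

Lemma Nk_rotcode (S : {set word n}) x k : is_ptree S ->
  Nk S k = count_mem k (rotcode S x).
Proof.
move=> HS; rewrite (seq.permP (permEl (perm_rot _ _))).
rewrite /tree_code count_map (seq.permP (perm_dfs HS)) count_map.
rewrite -sum1_count big_enum_cond /= /Nk -sum1_card.
by apply: eq_bigl => y; rewrite inE.
Qed.

End Model.

Arguments fwt {R} w {n} f.

(** * Exchangeability of the letters of a bridge *)

Lemma perm_extends (n l : nat) (f g : 'I_l -> 'I_n) : (l <= n)%N ->
  injective f -> injective g -> exists s : {perm 'I_n}, forall i, s (f i) = g i.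
Proof.
move=> ln fi gi.
have tr := Sym_trans 'I_n; rewrite card_ord in tr.
have {tr} := ntransitive_weak ln tr => tr.
have Hf : [tuple f i | i < l] \in l.-dtuple([set: 'I_n]%g).
  by apply/dtuple_onP; split => [i j|i]; rewrite ?inE // !tnth_mktuple => /fi.
have Hg : [tuple g i | i < l] \in l.-dtuple([set: 'I_n]%g).
  by apply/dtuple_onP; split => [i j|i]; rewrite ?inE // !tnth_mktuple => /gi.
have [s _ E] := atransP2 tr Hf Hg.
exists s => i; have := congr1 (fun t => tnth t i) E.
by rewrite tnth_mktuple /= tnth_map tnth_mktuple.
Qed.

Section Exchangeable.
Variables (R : realType) (w : nat -> R) (n : nat).
Hypothesis w0 : forall k, 0 <= w k.

Lemma fwt_ge0 (f : {ffun 'I_n -> 'I_n}) : 0 <= fwt w f.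
Proof. by apply: prodr_ge0. Qed.

Lemma fwtE (f : {ffun 'I_n -> 'I_n}) : fwt w f = \prod_(i < n) w (f i).
Proof. by rewrite /fwt big_map big_enum. Qed.

Lemma bridgesE (f : {ffun 'I_n -> 'I_n}) :
  (f \in bridges n) = ((\sum_(i < n) f i).+1 == n)%N.
Proof. by rewrite inE sumnE big_map big_enum. Qed.

Lemma avg_perm (s : {perm 'I_n}) (F : {ffun 'I_n -> 'I_n} -> R) :
  avg (bridges n) (fwt w) (fun f => F [ffun i => f (s i)]) = avg (bridges n) (fwt w) F.
Proof.
rewrite /avg; congr (_ / _).
pose h (s : {perm 'I_n}) (f : {ffun 'I_n -> 'I_n}) := [ffun i => f (s i)].
have hK : cancel (h s) (h s^-1%g).
  by move=> f; apply/ffunP => i; rewrite !ffunE permKV.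
rewrite [RHS](reindex_inj (can_inj hK)) /=; apply: eq_big => f.
  rewrite !bridgesE (reindex_inj (@perm_inj _ s)) /=.
  by congr (_.+1 == _); apply: eq_bigr => i _; rewrite ffunE.
move=> _; congr (_ * _); rewrite !fwtE [LHS](reindex_inj (@perm_inj _ s)) /=.
by apply: eq_bigr => i _; rewrite ffunE.
Qed.

Definition prefix_prob (c : seq nat) : R := avgB_ w n (fun s => (prefix c s)%:R).

Lemma prefix_fseq (c : seq nat) (f : {ffun 'I_n -> 'I_n}) (cn : (size c <= n)%N) :
  prefix c (fseq f) = [forall i : 'I_(size c), f (widen_ord cn i) == nth 0 c i :> nat].
Proof.
rewrite prefixE; apply/eqP/forallP => [E i|H].
  by rewrite -nth_fseq; have := congr1 (fun s => nth 0%N s i) E; rewrite nth_take // => ->.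
apply: (@eq_from_nth _ 0) => [|i Hi].
  by rewrite size_takel // size_fseq.
rewrite size_takel ?size_fseq // in Hi.
rewrite nth_take //; have := H (Ordinal Hi).
by rewrite -nth_fseq => /eqP.
Qed.

Lemma avg_pattern (c : seq nat) (g : 'I_(size c) -> 'I_n) : injective g ->
  (size c <= n)%N ->
  avg (bridges n) (fwt w) (fun f => [forall i, f (g i) == nth 0 c i :> nat]%:R)
  = prefix_prob c.
Proof.
move=> gi cn.
have wi : injective (widen_ord cn) by move=> i j /(congr1 val) /= ij; apply/val_inj.
have [s Hs] := perm_extends cn wi gi.
rewrite /prefix_prob /avgB_.
rewrite -[RHS](avg_perm s); apply: eq_avg => f _ /=.
rewrite (prefix_fseq _ cn); congr (nat_of_bool _)%:R.
by apply: eq_forallb => i; rewrite ffunE Hs.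
Qed.

Lemma prefix_prob_ge0 c : 0 <= prefix_prob c.
Proof. by apply: avg_ge0 => //; exact: fwt_ge0. Qed.

Lemma prefix_prob_le1 c : prefix_prob c <= 1.
Proof. by apply: avg_prob_le1; exact: fwt_ge0. Qed.

Definition occ (s : seq nat) (k : nat) : R := (count_mem k s)%:R / n%:R.

Lemma occ_ge0 s k : 0 <= occ s k.
Proof. by rewrite divr_ge0 ?ler0n. Qed.

Lemma count_mem_fseq k (f : {ffun 'I_n -> 'I_n}) :
  ((count_mem k (fseq f))%:R : R) = \sum_(i < n) (f i == k :> nat)%:R.
Proof.
rewrite -sum1_count big_map big_enum_cond /= natr_sum big_mkcond /=.
by apply: eq_bigr => i _; case: eqP.
Qed.

Lemma prod_count_fseq (c : seq nat) (f : {ffun 'I_n -> 'I_n}) :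
  \prod_(k <- c) (count_mem k (fseq f))%:R =
  \sum_(g : {ffun 'I_(size c) -> 'I_n}) [forall i, f (g i) == nth 0 c i :> nat]%:R :> R.
Proof.
rewrite (big_nth 0%N) big_mkord.
under eq_bigr do rewrite count_mem_fseq.
rewrite (bigA_distr_bigA (fun (i : 'I_(size c)) (j : 'I_n) => (f j == nth 0 c i :> nat)%:R : R)).
apply: eq_bigr => g _; rewrite -natr_prod; congr (_%:R).
case: (boolP [forall i, _]) => [/forallP H|].
  by rewrite big1 // => i _; rewrite H.
rewrite negb_forall => /existsP[i Hi].
by rewrite (bigD1 i) //= (negbTE Hi) mul0n.
Qed.

Definition inj_ratio (l : nat) : R := (n ^_ l)%:R / (n ^ l)%:R.

(** The product of frequencies is the chance of seeing [c] at positions drawn with replacement.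
    Injective draws contribute [prefix_prob c] by exchangeability, and [inj_ratio] is their
    proportion among all draws. *)
Lemma avg_prod_occ (c : seq nat) : (size c <= n)%N -> (0 < n)%N ->
  `|avgB_ w n (fun s => \prod_(k <- c) occ s k) - prefix_prob c| <= 1 - inj_ratio (size c).
Proof.
move=> cn n0; set l := size c.
have nl : 0 < (n ^ l)%:R :> R by rewrite ltr0n expn_gt0 n0.
pose pat (g : {ffun 'I_l -> 'I_n}) : R :=
  avg (bridges n) (fwt w) (fun f => [forall i, f (g i) == nth 0 c i :> nat]%:R).
have -> : avgB_ w n (fun s => \prod_(k <- c) occ s k) =
    (\sum_(g : {ffun 'I_l -> 'I_n}) pat g) / (n ^ l)%:R.
  rewrite /pat -avg_sum /avgB_ -avgZr; apply: eq_avg => f _.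
  rewrite -prod_count_fseq /occ big_split /=; congr (_ * _).
  by rewrite big_const_seq count_predT iter_mulr_1 exprVn natrX.
rewrite (bigID (fun g : {ffun 'I_l -> 'I_n} => injectiveb g)) /=.
have -> : \sum_(g : {ffun 'I_l -> 'I_n} | injectiveb g) pat g =
          (n ^_ l)%:R * prefix_prob c.
  rewrite -[X in (X ^_ _)%N](card_ord n) -[X in (_ ^_ X)%N](card_ord l).
  rewrite -card_inj_ffuns cardsE mulr_natl -sumr_const.
  by apply: eq_bigr => g /injectiveP Hg; rewrite /pat avg_pattern.
set B := \sum_(_ | _) _.
have B0 : 0 <= B.
  by apply: sumr_ge0 => g _; apply: avg_prob_ge0; exact: fwt_ge0.
have B1 : B <= (n ^ l)%:R - (n ^_ l)%:R.
  have -> : (n ^ l)%:R - (n ^_ l)%:R =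
     \sum_(g : {ffun 'I_l -> 'I_n} | ~~ injectiveb g) 1 :> R.
    rewrite sumr_const; apply/eqP; rewrite subr_eq -natrD eqr_nat; apply/eqP.
    rewrite -[X in (X ^_ _)%N](card_ord n) -[X in (_ ^_ X)%N](card_ord l).
    rewrite -card_inj_ffuns cardsE addnC cardC.
    by rewrite card_ffun !card_ord.
  by apply: ler_sum => g _; apply: avg_prob_le1; exact: fwt_ge0.
have P0 := prefix_prob_ge0 c; have P1 := prefix_prob_le1 c.
have le : (n ^_ l)%:R / (n ^ l)%:R <= 1 :> R.
  by rewrite ler_pdivrMr // mul1r -subr_ge0 (le_trans B0).
have E2 : B / (n ^ l)%:R <= 1 - inj_ratio l.
  rewrite ler_pdivrMr // mulrBl mul1r /inj_ratio divfK ?gt_eqF //.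
have E3 : 0 <= B / (n ^ l)%:R by rewrite divr_ge0 // ltW.
rewrite mulrDl mulrAC -/(inj_ratio l) in E2 *.
rewrite -/(inj_ratio l) in le.
have H1 : inj_ratio l * prefix_prob c <= prefix_prob c.
  by rewrite -[leRHS]mul1r ler_wpM2r.
have H2 : prefix_prob c - inj_ratio l * prefix_prob c <= 1 - inj_ratio l.
  rewrite -{1}[prefix_prob c]mul1r -mulrBl -[leRHS]mulr1 ler_wpM2l // subr_ge0 //.
rewrite ler_norml; apply/andP; split; lra.
Qed.

(** Replacing the initial [c] by [c'] maps bridges to bridges and changes only these factors of the
    weight. The identity is cross-multiplied because weights may vanish. *)
Lemma prefix_prob_swap (c c' : seq nat) : size c = size c' -> sumn c = sumn c' ->
  (\prod_(k <- c') w k) * prefix_prob c = (\prod_(k <- c) w k) * prefix_prob c'.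
Proof.
move=> Es En.
wlog cn : / (size c <= n)%N.
  move=> H; case: (leqP (size c) n) => [/H//|cn].
  have N (b : seq nat) : (n < size b)%N -> prefix_prob b = 0.
    move=> bn; rewrite /prefix_prob /avgB_ /avg big1 ?mul0r // => f _.
    case: (boolP (prefix _ _)) => [|_]; last by rewrite mulr0.
    by move/prefix_size_leq; rewrite size_fseq leqNgt bn.
  by rewrite !N ?mulr0 // -Es.
rewrite /prefix_prob /avgB_ /avg !mulrA !big_distrr /=; congr (_ / _).
have rem (b : seq nat) (f : {ffun 'I_n -> 'I_n}) : prefix b (fseq f) ->
   fwt w f = (\prod_(k <- b) w k) * \prod_(k <- drop (size b) (fseq f)) w k.
  by case/prefixP => r; rewrite /fwt => ->; rewrite big_cat drop_size_cat.
have E (b b' : seq nat) :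
  \sum_(f in bridges n) (\prod_(k <- b') w k) * (fwt w f * (prefix b (fseq f))%:R) =
  \sum_(f in bridges n | prefix b (fseq f)) (\prod_(k <- b') w k) * fwt w f.
  rewrite [RHS]big_mkcondr /=; apply: eq_bigr => f _.
  by case: ifP; rewrite ?mulr1 ?mulr0.
rewrite !E.
pose h (b : seq nat) (f : {ffun 'I_n -> 'I_n}) := ffun_of_seq n (b ++ drop (size b) (fseq f)).
have hE (b b' : seq nat) f : size b = size b' -> sumn b = sumn b' -> (size b <= n)%N ->
   f \in bridges n -> prefix b (fseq f) -> fseq (h b' f) = b' ++ drop (size b) (fseq f).
  move=> Eb Sb bn Hf /prefixP[r Er]; rewrite /h -Eb ffun_of_seqK //.
    by rewrite size_cat size_drop -Eb size_fseq subnKC.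
  move: Hf; rewrite inE Er drop_size_cat // !sumn_cat -Sb => /eqP //.
have hK (b b' : seq nat) f : size b = size b' -> sumn b = sumn b' -> (size b <= n)%N ->
   f \in bridges n -> prefix b (fseq f) ->
   [/\ h b' f \in bridges n, prefix b' (fseq (h b' f)) & h b (h b' f) = f].
  move=> Eb Sb bn Hf Hp; have Eh := hE _ _ _ Eb Sb bn Hf Hp.
  split; rewrite ?Eh ?prefix_prefix //.
    rewrite inE Eh sumn_cat -Sb -sumn_cat.
    by case/prefixP: Hp (Hf) => r Er; rewrite inE Er drop_size_cat.
  apply: fseq_inj; rewrite {1}/h Eh drop_size_cat // ffun_of_seqK.
  - by case/prefixP: Hp => r Er; rewrite Er drop_size_cat.
  - by rewrite size_cat size_drop size_fseq subnKC.
  - case/prefixP: Hp (Hf) => r Er; rewrite inE Er drop_size_cat // => /eqP //.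
have cn' : (size c' <= n)%N by rewrite -Es.
rewrite (reindex_onto (h c) (h c')) /=; last first.
  by move=> f /andP[Hf Hp]; case: (hK c c' f).
apply: eq_big => f.
  apply/andP/andP => [[/andP[H1 H2] /eqP H3]|[H1 H2]].
    have [A B _] := hK c c' (h c f) Es En cn H1 H2.
    by rewrite H3 in A B.
  have [A B C] := hK c' c f (esym Es) (esym En) cn' H1 H2.
  by rewrite A B C.
move=> /andP[/andP[H1 H2] /eqP H3].
have [A B _] := hK c c' (h c f) Es En cn H1 H2; rewrite H3 in A B.
rewrite (rem c' f) // (rem c (h c f)) // (hE c' c) // drop_size_cat //.
by rewrite mulrCA.
Qed.

End Exchangeable.

Local Open Scope classical_set_scope.
Local Open Scope ring_scope.

Lemma invn_cvg (R : realType) : (fun n : nat => n%:R^-1 : R) @ \oo --> (0 : R).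
Proof.
by rewrite -cvg_shiftS; exact: cvg_harmonic.
Qed.

Lemma inj_ratio_cvg (R : realType) (l : nat) :
  (fun n => inj_ratio R n l) @ \oo --> (1 : R).
Proof.
elim: l => [|l IH].
  apply: cvg_near_cst; near=> n.
  by rewrite /inj_ratio ffactn0 expn0 divr1.
have E : (fun n => inj_ratio R n l * (1 - l%:R * n%:R^-1)) @ \oo --> (1 : R).
  rewrite -[X in _ --> X]mulr1; apply: cvgM => //.
  rewrite -[X in _ --> X]subr0; apply: cvgB; first exact: cvg_cst.
  rewrite -[X in _ --> X](mulr0 l%:R); apply: cvgMl_tmp.
  exact: invn_cvg.
apply: cvg_trans E; apply: near_eq_cvg; near=> n.
have ln : (l < n)%N by near: n; exists l.+1.
rewrite /inj_ratio ffactnSr expnSr !natrM natrB ?(ltnW ln) //.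
have nn : n%:R != 0 :> R by rewrite pnatr_eq0 -lt0n (leq_ltn_trans _ ln).
have nln : (n ^ l)%:R != 0 :> R by rewrite natrX expf_eq0 (negbTE nn) andbF.
by field; rewrite nn.
Unshelve. all: by end_near. Qed.

(** * The offspring law *)

Lemma cvg_sumr (R : realType) (T I : Type) (F : set_system T) (FF : Filter F)
    (r : seq I) (f : I -> T -> R) (l : I -> R) :
  (forall i, f i @ F --> l i) ->
  (fun x => \sum_(i <- r) f i x) @ F --> \sum_(i <- r) l i.
Proof.
by move=> H; apply: cvg_big => [|i _]; [exact: add_continuous | exact: H].
Qed.

Lemma bernoulli_pow (R : realType) (x y : R) n : 0 < x -> x <= y ->
  n%:R * x ^+ n.-1 * (y - x) <= y ^+ n - x ^+ n.
Proof.
move=> x0 xy; have y0 := lt_le_trans x0 xy.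
elim: n => [|n IH]; first by rewrite !mul0r !expr0 subrr.
have E : n%:R * x ^+ n * (y - x) <= x * (y ^+ n - x ^+ n).
  case: n IH => [|n] IH; first by rewrite !mul0r !expr0 subrr mulr0.
  apply: le_trans (ler_wpM2l (ltW x0) IH); rewrite /= exprS le_eqVlt; apply/orP; left.
  by apply/eqP; ring.
have F : x ^+ n <= y ^+ n by rewrite lerXn2r // nnegrE ltW.
rewrite /= -natr1 !exprS.
have G : (y - x) * x ^+ n <= (y - x) * y ^+ n by rewrite ler_wpM2l // subr_ge0.
nra.
Qed.

Section WeightAnalysis.
Variables (R : realType) (w : nat -> R) (tau nu : R).
Hypothesis Hw : weight_seq w.

Let w0 : forall k, 0 <= w k. Proof. by case: Hw. Qed.
Let w00 : 0 < w 0%N. Proof. by case: Hw => _ []. Qed.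

Let S (t : R) := series (fun k => w k * t ^+ k).
Let D (t : R) := series (fun k => k%:R * (w k * t ^+ k)).

Lemma weight_series_nondecreasing t : 0 <= t -> nondecreasing_seq (S t).
Proof.
by move=> t0; apply: nondecreasing_series => k _ _; rewrite mulr_ge0 // exprn_ge0.
Qed.

Lemma weight_dseries_nondecreasing t : 0 <= t -> nondecreasing_seq (D t).
Proof.
by move=> t0; apply: nondecreasing_series => k _ _; rewrite !mulr_ge0 ?ler0n // exprn_ge0.
Qed.

Lemma weight_series_cvg t M : 0 <= t -> (forall n, S t n <= M) -> cvgn (S t).
Proof.
move=> t0 H; apply: nondecreasing_is_cvgn; first exact: weight_series_nondecreasing.
by exists M => _ [n _ <-].
Qed.

Lemma weight_series_le_phi t n : 0 <= t -> cvgn (S t) -> S t n <= phi w t.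
Proof.
by move=> t0 Ct; apply: nondecreasing_cvgn_le => //; exact: weight_series_nondecreasing.
Qed.

Lemma phi_gt0 t : 0 <= t -> cvgn (S t) -> 0 < phi w t.
Proof.
move=> t0 Ct; apply: lt_le_trans (weight_series_le_phi 1 t0 Ct).
by rewrite /S seriesEnat /= big_nat1 expr0 mulr1.
Qed.

Lemma le_radius t M : Defs.radius w = tau%:E -> 0 <= t -> (forall n, S t n <= M) -> t <= tau.
Proof.
move=> Hr t0 H; rewrite -lee_fin -Hr; apply: ereal_sup_ubound.
by exists t => //; split => //; exact: weight_series_cvg H.
Qed.

Lemma cvg_lt_radius t : Defs.radius w = tau%:E -> 0 <= t -> t < tau -> cvgn (S t).
Proof.
move=> Hr t0 tt; have : (t%:E < Defs.radius w)%E by rewrite Hr lte_fin.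
move=> /ereal_sup_gt[_ [t' [t'0 Ct'] <-]]; rewrite lte_fin => tt'.
by apply: (is_cvg_pseries_inside Ct'); rewrite !ger0_norm.
Qed.

(** By convexity of powers, (K0 - K) times a term of the differentiated series at K is at most the
    corresponding term at K0. Differentiating thus costs an arbitrarily small part of the radius. *)
Lemma pseries_diffs_cvg (c : nat -> R) (K0 K : R) : (forall k, 0 <= c k) ->
  0 < K -> K < K0 -> cvgn (pseries c K0) -> cvgn (pseries (pseries_diffs c) K).
Proof.
move=> c0 Kp KK C0; have K0p := lt_trans Kp KK.
apply: nondecreasing_is_cvgn.
  by apply: nondecreasing_series => k _ _; rewrite !mulr_ge0 ?ler0n // exprn_ge0 // ltW.
have nd : nondecreasing_seq (pseries c K0).
  by apply: nondecreasing_series => k _ _; rewrite mulr_ge0 // exprn_ge0 // ltW.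
exists (limn (pseries c K0) / (K0 - K)) => _ [n _ <-].
rewrite ler_pdivlMr ?subr_gt0 //; apply: le_trans (nondecreasing_cvgn_le nd C0 n.+1).
rewrite /pseries /= !seriesEnat /= big_distrl /= big_nat_recl //=.
rewrite -[leLHS]add0r lerD //; first by rewrite mulr_ge0.
apply: ler_sum => i _; rewrite /pseries_diffs.
have := bernoulli_pow i.+1 Kp (ltW KK); rewrite /= => H.
have H' : i.+1%:R * K ^+ i * (K0 - K) <= K0 ^+ i.+1.
  by apply: le_trans H _; rewrite gerBl exprn_ge0 // ltW.
rewrite [leLHS](_ : _ = c i.+1 * (i.+1%:R * K ^+ i * (K0 - K))); last by ring.
by apply: ler_wpM2l.
Qed.

Lemma psi_phi t : Defs.radius w = tau%:E -> 0 < t -> t < tau ->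
  (D t @ \oo --> psi w t * phi w t).
Proof.
move=> Hr t0 tt.
(* Termwise differentiation requires convergence of the twice differentiated series; each
   differentiation moves to a smaller radius, hence t < a < b < c < tau. *)
pose a := (t + tau) / 2; pose b := (a + tau) / 2; pose c := (b + tau) / 2.
have ta : t < a by rewrite /a; lra.
have ab : a < b by rewrite /b /a; lra.
have bc : b < c by rewrite /c /b /a; lra.
have ct : c < tau by rewrite /c /b /a; lra.
have Cc : cvgn (pseries w c) by apply: cvg_lt_radius => //; lra.
have Cb : cvgn (pseries (pseries_diffs w) b) by apply: pseries_diffs_cvg Cc => //; lra.
have dw0 k : 0 <= pseries_diffs w k by rewrite mulr_ge0.
have Ca : cvgn (pseries (pseries_diffs (pseries_diffs w)) a).
  by apply: pseries_diffs_cvg Cb => //; lra.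
have Cba : cvgn (pseries (pseries_diffs w) a).
  by apply: (is_cvg_pseries_inside Cb); rewrite !gtr0_norm //; lra.
have Cca : cvgn (pseries w a).
  by apply: (is_cvg_pseries_inside Cc); rewrite !gtr0_norm //; lra.
have Ctt : cvgn (pseries (pseries_diffs w) t).
  by apply: (is_cvg_pseries_inside Cb); rewrite !gtr0_norm //; lra.
have Hd := @pseries_snd_diffs R w a t Cca Cba Ca.
have /Hd {}Hd : `|t| < `|a| by rewrite !gtr0_norm //; lra.
have Ed : derive1 (phi w) t = limn (pseries (pseries_diffs w) t).
  by rewrite derive1E; apply: (@derive_val _ _ _ _ _ _ _ Hd).
have p0 : 0 < phi w t by apply: phi_gt0; [lra | apply: cvg_lt_radius => //; lra].
rewrite /psi divfK ?gt_eqF // Ed.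
rewrite -(cvg_shiftS (D t)).
have -> : (fun n => D t n.+1) = (fun n => t * pseries (pseries_diffs w) t n).
  apply/funext => n; rewrite /D /pseries /= !seriesEnat /= big_nat_recl //= mul0r add0r.
  rewrite big_distrr /=; apply: eq_bigr => i _; rewrite /pseries_diffs exprS; ring.
by apply: cvgMl_tmp.
Qed.

(** What both types have in common: a genuine offspring law of mean mu < 1. The later argument uses
    the type only through [offspring_mean]. *)
Definition fin_mean := [/\ exists2 c, 0 < c & forall k, xi_law w tau k = tau ^+ k * w k / c,
  series (xi_law w tau) @ \oo --> (1 : R),
  series (fun k => k%:R * xi_law w tau k) @ \oo --> mu nu,
  0 <= mu nu & mu nu < 1].

Lemma weight_poly_cvg (F : nat -> R) n :
  (series (fun k => F k * t ^+ k) n) @[t --> tau^'-] --> series (fun k => F k * tau ^+ k) n.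
Proof.
apply: cvg_at_left_filter.
rewrite seriesEnat /=.
have -> : (fun t => series (fun k => F k * t ^+ k) n) =
   (fun t : R => \sum_(0 <= k < n) (F k * t ^+ k)).
  by apply/funext => t; rewrite seriesEnat.
apply: cvg_sumr => k; apply: cvgMl_tmp; exact: exprn_continuous.
Qed.

Lemma type_II_mean : 0 < tau -> Defs.radius w = tau%:E -> psi w t @[t --> tau^'-] --> nu ->
  0 < nu -> nu < 1 -> fin_mean.
Proof.
move=> tau0 Hr Hpsi nu0 nu1.
have Hnear : \forall t \near tau^'-, 0 < t /\ t < tau.
  near=> t; split; near: t; [exact: nbhs_left_gt | exact: nbhs_left_lt].
have H1 : \forall t \near tau^'-, psi w t <= 1.
  near=> t; apply: ltW; near: t; exact: (cvgr_lt nu Hpsi).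
have DE t n : D t n = series (fun k => (k%:R * w k) * t ^+ k) n.
  by rewrite /D !seriesEnat /=; apply: eq_bigr => k _; rewrite mulrA.
(* Finiteness of phi at tau. As psi <= 1 near tau, the sum of (k - 1) w_k t^k is at most 0; hence
   its part with k >= 2, which dominates the sum of w_k t^k over k >= 2, is at most w_0. Adding w_0
   + w_1 t gives a bound uniform in t. *)
have Bt : \forall t \near tau^'-, forall n, S t n <= 2 * w 0%N + w 1%N * tau.
  near=> t => n.
  have [t0 tt] : 0 < t /\ t < tau by near: t.
  have p1 : psi w t <= 1 by near: t.
  have CS := cvg_lt_radius Hr (ltW t0) tt.
  have CD := psi_phi Hr t0 tt.
  have p0 := phi_gt0 (ltW t0) CS.
  have HD m : D t m <= phi w t.
    have : D t m <= psi w t * phi w t.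
      rewrite -(cvg_lim _ CD) //; apply: nondecreasing_cvgn_le.
        by apply: weight_dseries_nondecreasing; exact: ltW.
      by apply/cvg_ex; eexists; exact: CD.
    move/le_trans; apply; rewrite -[leRHS]mul1r ler_wpM2r // ltW //.
  pose E m := D t m - S t m.
  have Eser m : E m = series (fun k => (k%:R - 1) * (w k * t ^+ k)) m.
    rewrite /E /D /S !seriesEnat /= -sumrB; apply: eq_bigr => k _; ring.
  have E0 m : E m.+1 <= 0.
    have HE k : (m.+1 <= k)%N -> E m.+1 <= E k.
      move=> mk; rewrite !Eser !seriesEnat /= (big_cat_nat _ mk) //= lerDl.
      rewrite big_nat; apply: sumr_ge0 => i /andP[mi _].
      rewrite mulr_ge0 ?mulr_ge0 ?exprn_ge0 ?(ltW t0) // subr_ge0 ler1n.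
      exact: leq_trans mi.
    have : (fun k => phi w t - S t k) @ \oo --> (0 : R).
      by rewrite -[X in _ --> X](subrr (phi w t)); apply: cvgB; [exact: cvg_cst | exact: CS].
    move=> Hl; rewrite -(cvg_lim _ Hl) //; apply: limr_ge; first by apply/cvg_ex; eexists; exact: Hl.
    near=> k; apply: le_trans (HE k _) _; first by near: k; exists m.+1.
    by rewrite /E lerD2r.
  apply: (@le_trans _ _ (S t n.+2)); first by apply: weight_series_nondecreasing; [exact: ltW | exact: leq_addl 2 n].
  have : S t n.+2 <= E n.+2 + (2 * w 0%N + w 1%N * t).
    rewrite Eser /S !seriesEnat /= !big_nat_recl //= !expr0 !expr1 !sub0r subrr !mul0r.
    rewrite !mulr1 !mulN1r.
    suff : \sum_(0 <= i < n) (w i.+2 * t ^+ i.+2) <= \sum_(0 <= i < n) ((i.+2%:R - 1) * (w i.+2 * t ^+ i.+2)) by lra.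
    apply: ler_sum => i _; rewrite -[leLHS]mul1r ler_wpM2r //.
      by rewrite mulr_ge0 ?exprn_ge0 // ltW.
    by rewrite lerBrDr -(natrD _ 1 1) ler_nat.
  move/le_trans; apply.
  have := E0 n.+1; have : w 1%N * t <= w 1%N * tau by rewrite ler_wpM2l // ltW.
  lra.
have Btau n : S tau n <= 2 * w 0%N + w 1%N * tau.
  apply: (ler_cvg_to (@weight_poly_cvg w n) (cvg_cst _)).
  by near=> t; move: n; near: t.
have CS := weight_series_cvg (ltW tau0) Btau.
have p0 := phi_gt0 (ltW tau0) CS.
have phile t : 0 < t -> t < tau -> phi w t <= phi w tau.
  move=> t0 tt; apply: ler_lim; [exact: (cvg_lt_radius Hr (ltW t0)) | exact: CS |].
  near=> n; rewrite !seriesEnat /=; apply: ler_sum => k _.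
  by rewrite ler_wpM2l // lerXn2r ?nnegrE ?ltW.
have Dtau n : D tau n <= nu * phi w tau.
  have E1 : D t n @[t --> tau^'-] --> D tau n.
    rewrite DE; under eq_fun do rewrite DE.
    exact: weight_poly_cvg.
  have E2 : psi w t * phi w tau @[t --> tau^'-] --> nu * phi w tau by apply: cvgMr_tmp.
  apply: (ler_cvg_to E1 E2); near=> t.
  have [t0 tt] : 0 < t /\ t < tau by near: t.
  have CD := psi_phi Hr t0 tt.
  have pp : 0 < phi w t by apply: phi_gt0 (ltW t0) (cvg_lt_radius Hr (ltW t0) tt).
  have HD m : D t m <= psi w t * phi w t.
    rewrite -(cvg_lim _ CD) //; apply: nondecreasing_cvgn_le.
      by apply: weight_dseries_nondecreasing; exact: ltW.
    by apply/cvg_ex; eexists; exact: CD.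
  have ps0 : 0 <= psi w t.
    have := HD 0%N; rewrite /D seriesEnat /= big_geq // pmulr_lge0 //.
  apply: le_trans (HD n) _; rewrite ler_wpM2l // phile //.
have CD : cvgn (D tau).
  apply: nondecreasing_is_cvgn; first by apply: weight_dseries_nondecreasing; exact: ltW.
  by exists (nu * phi w tau) => _ [n _ <-].
(* Abel-type limit by positivity: truncate to polynomials, let t increase to tau, and only then
   remove the truncation, once for each inequality. *)
have LD : limn (D tau) = nu * phi w tau.
  apply/eqP; rewrite eq_le; apply/andP; split.
    by apply: limr_le => //; near=> n; exact: Dtau.
  have HN n : nu * S tau n <= limn (D tau).
    have E1 : psi w t * S t n @[t --> tau^'-] --> nu * S tau n.
      by apply: cvgM => //; exact: weight_poly_cvg.
    apply: (ler_cvg_to E1 (cvg_cst _)); near=> t.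
    have [t0 tt] : 0 < t /\ t < tau by near: t.
    have CDt := psi_phi Hr t0 tt.
    have Ct := cvg_lt_radius Hr (ltW t0) tt.
    have pp : 0 < phi w t by apply: phi_gt0 (ltW t0) Ct.
    have L1 : psi w t * phi w t <= limn (D tau).
      rewrite -(cvg_lim _ CDt) //; apply: ler_lim => //; first by apply/cvg_ex; eexists; exact: CDt.
      near=> m; rewrite /D !seriesEnat /=; apply: ler_sum => k _.
      by rewrite !ler_wpM2l // lerXn2r ?nnegrE ?ltW.
    have ps0 : 0 <= psi w t.
      rewrite -(pmulr_lge0 _ pp) -(cvg_lim _ CDt) //; apply: limr_ge; first by apply/cvg_ex; eexists; exact: CDt.
      near=> m; rewrite /D seriesEnat /=; apply: sumr_ge0 => k _.
      by rewrite !mulr_ge0 // exprn_ge0 // ltW.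
    apply: le_trans L1; rewrite ler_wpM2l //.
    by apply: weight_series_le_phi => //; exact: ltW.
  have E3 : (fun n => nu * S tau n) @ \oo --> nu * phi w tau by apply: cvgMl_tmp; exact: CS.
  rewrite -(cvg_lim _ E3) //; apply: limr_le; first by apply/cvg_ex; eexists; exact: E3.
  by near=> n; exact: HN.
have mE : mu nu = nu by rewrite /mu min_l // ltW.
split; rewrite ?mE ?ltW //.
- by exists (phi w tau).
- have -> : series (xi_law w tau) = (fun n => S tau n / phi w tau).
    apply/funext => n; rewrite /S !seriesEnat /= big_distrl /=; apply: eq_bigr => k _.
    by rewrite /xi_law (mulrC (w k)).
  rewrite -[X in _ --> X](divff (lt0r_neq0 p0)); apply: cvgMr_tmp; exact: CS.
- have -> : series (fun k => k%:R * xi_law w tau k) = (fun n => D tau n / phi w tau).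
    apply/funext => n; rewrite /D !seriesEnat /= big_distrl /=; apply: eq_bigr => k _.
    by rewrite /xi_law (mulrC (w k)) !mulrA.
  rewrite -[X in _ --> X](mulfK (lt0r_neq0 p0)); apply: cvgMr_tmp; rewrite -LD; exact: CD.
Unshelve. all: by end_near. Qed.

Lemma type_III_mean : tau = 0 -> nu = 0 -> fin_mean.
Proof.
rewrite /fin_mean => -> ->.
have Sn n : S 0 n.+1 = w 0%N.
  rewrite /S seriesEnat /= big_nat_recl //= expr0 mulr1 big1 ?addr0 // => k _.
  by rewrite expr0n mulr0.
have pE : phi w 0 = w 0%N.
  apply: cvg_lim => //; rewrite -(cvg_shiftS (S 0)).
  by under eq_fun do rewrite Sn; exact: cvg_cst.
have mE : mu (0 : R) = 0 by rewrite /mu min_l.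
have x0 : xi_law w 0 0 = 1 by rewrite /xi_law pE expr0 mul1r divff // gt_eqF.
have xS k : xi_law w 0 k.+1 = 0 by rewrite /xi_law expr0n !mul0r.
split; rewrite ?mE //.
- by exists (w 0%N) => // k; rewrite -pE.
- rewrite -(cvg_shiftS (series (xi_law w 0))); apply: cvg_near_cst; near=> n.
  by rewrite seriesEnat /= big_nat_recl //= x0 big1 ?addr0.
- apply: cvg_near_cst; near=> n; rewrite seriesEnat /= big1 // => -[|k] _.
    by rewrite mul0r.
  by rewrite xS mulr0.
Unshelve. all: by end_near. Qed.

Lemma offspring_mean : type_II_or_III w tau nu -> fin_mean /\ 0 <= tau /\ Defs.radius w = tau%:E.
Proof.
case=> [[Hr [t0 n0]]|[t0 [Hr [Hp [n0 n1]]]]].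
  by split; [exact: type_III_mean | rewrite t0].
by split; [exact: type_II_mean | rewrite ltW].
Qed.

End WeightAnalysis.

(** * Empirical degree distributions of bridges *)

Section Positivity.
Variables (R : realType) (w : nat -> R) (d : nat).
Hypotheses (Hw : weight_seq w) (Hd : is_span w d).

Let w0 : forall k, 0 <= w k. Proof. by case: Hw. Qed.

Definition supp_sum (x : nat) : Prop :=
  exists s : seq nat, all (fun k => 0 < w k) s /\ sumn s = x.

Lemma supp_sumD x y : supp_sum x -> supp_sum y -> supp_sum (x + y)%N.
Proof.
by case=> s [Hs <-] [t [Ht <-]]; exists (s ++ t); rewrite all_cat Hs Ht sumn_cat.
Qed.

Lemma supp_sum0 : supp_sum 0.
Proof. by exists [::]. Qed.

Lemma supp_sumM x k : supp_sum x -> supp_sum (k * x)%N.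
Proof.
move=> Hx; elim: k => [|k IH]; first exact: supp_sum0.
by rewrite mulSn; apply: supp_sumD.
Qed.

Lemma supp_sum1 k : 0 < w k -> supp_sum k.
Proof. by move=> wk; exists [:: k]; rewrite /= wk addn0. Qed.

Lemma span_dvd x : supp_sum x -> (d %| x)%N.
Proof.
case=> s [Hs <-]; elim: s Hs => //= k s IH /andP[wk Hs].
by rewrite dvdn_add ?IH //; apply: Hd.1.
Qed.

Lemma span_gt0 : (0 < d)%N.
Proof.
have [k [k2 wk]] := Hw.2.2.
by have := span_dvd (supp_sum1 wk); case: (d) => //; rewrite dvd0n; case: k k2 {wk}.
Qed.

(** Take the least positive difference e of two attainable sums. A remainder of some i in the
    support modulo e would be a smaller difference, so e divides the support and equals the span. *)
Lemma span_difference : exists x, supp_sum x /\ supp_sum (x + d).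
Proof.
pose Q e := (0 < e)%N /\ exists x, supp_sum x /\ supp_sum (x + e)%N.
have [k [k2 wk]] := Hw.2.2.
have exQ : exists e, `[< Q e >].
  exists k; apply/asboolP; split; first by case: k k2 {wk}.
  by exists 0%N; split; [exact: supp_sum0 | exact: supp_sum1].
case: (ex_minnP exQ) => e /asboolP[e0 [x [Hx Hxe]]] Hmin.
have He i : 0 < w i -> (e %| i)%N.
  move=> wi; rewrite /dvdn -leqn0 leqNgt; apply/negP => r0.
  have : (e <= i %% e)%N.
    apply/Hmin/asboolP; split => //; exists ((i %/ e) * (x + e))%N; split.
      exact: supp_sumM.
    have -> : ((i %/ e) * (x + e) + i %% e = (i %/ e) * x + i)%N.
      by rewrite mulnDr -addnA -divn_eq.
    by apply: supp_sumD; [exact: supp_sumM | exact: supp_sum1].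
  by rewrite leqNgt ltn_mod e0.
have ed : (e %| d)%N by apply: Hd.2.
have de : (d %| e)%N.
  by rewrite -(dvdn_addr _ (span_dvd Hx)); apply: span_dvd.
have <- : e = d by apply/eqP; rewrite eqn_dvd ed de.
by exists x.
Qed.

Lemma supp_sum_large : exists M, forall m, (M <= m)%N -> supp_sum (d * m).
Proof.
have [x [Hx Hxd]] := span_difference.
have /dvdnP[b Eb] := span_dvd Hx.
(* With x = b d, write m = q b + r; the sum d m is made of q - r copies of x and r copies of x + d.
   From (b + 1)^2 on, q >= b > r when b is positive. *)
exists (b.+1 * b.+1)%N => m Hm.
have [b0|b0] := posnP b.
  rewrite mulnC; apply: supp_sumM; move: Hxd; rewrite Eb b0 //.
have E : (m = m %/ b * b + m %% b)%N := divn_eq m b.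
have r : (m %% b < b)%N by rewrite ltn_mod.
have q : (m %% b <= m %/ b)%N.
  by rewrite (leq_trans (ltnW r)) // leq_divRL // (leq_trans _ Hm) // leq_mul.
have -> : (d * m = (m %/ b - m %% b) * x + m %% b * (x + d))%N.
  rewrite {1}E mulnDr mulnBl mulnDr addnA subnK; last by rewrite leq_mul.
  by rewrite Eb; lia.
by apply: supp_sumD; apply: supp_sumM.
Qed.

Lemma total_bridges_gt0 : exists M, forall m, (M <= m)%N ->
  0 < \sum_(f in bridges (d * m + 1)) fwt w f.
Proof.
have [M HM] := supp_sum_large.
exists M => m /HM[s [Hs Es]]; set n := (d * m + 1)%N.
(* Without its zeros the word is no longer than its sum n - 1, which leaves room to pad it with
   leaves up to length n. *)
pose s1 := [seq k <- s | (0 < k)%N].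
have Es1 : sumn s1 = sumn s.
  by rewrite /s1; elim: (s) => //= -[|k] l IH //=; rewrite IH.
have sz : (size s1 <= sumn s1)%N.
  have : all (fun k => 0 < k)%N s1 by rewrite filter_all.
  by elim: (s1) => //= k l IH /andP[k0 /IH]; lia.
pose u := s1 ++ nseq (n - size s1) 0%N.
have su : size u = n by rewrite size_cat size_nseq subnKC // (leq_trans sz) // Es1 Es /n; lia.
have Eu : (sumn u).+1 = n.
  have -> : sumn u = sumn s1 by rewrite sumn_cat sumn_nseq mul0n addn0.
  by rewrite Es1 Es /n addn1.
have Hf : ffun_of_seq n u \in bridges n by rewrite inE ffun_of_seqK // Eu.
apply: lt_le_trans (_ : fwt w (ffun_of_seq n u) <= _); last first.
  by rewrite (bigD1 _ Hf) /= lerDl; apply: sumr_ge0 => f _; apply: prodr_ge0.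
rewrite /fwt ffun_of_seqK // big_cat /=; apply: mulr_gt0.
  rewrite big_seq; apply: prodr_gt0 => k; rewrite mem_filter => /andP[_ ks].
  exact: (allP Hs).
rewrite big_seq; apply: prodr_gt0 => k; rewrite mem_nseq => /andP[_ /eqP->].
exact: Hw.2.1.
Qed.

End Positivity.

(** * Second moments of the balance relations *)

Section Relations.
Variables (R : realType) (w : nat -> R).
Hypothesis w0 : forall k, 0 <= w k.

Let W (c : seq nat) : R := \prod_(k <- c) w k.

Definition balance (c c' : seq nat) (p : nat -> R) : R :=
  W c' * (\prod_(k <- c) p k) - W c * (\prod_(k <- c') p k).

(** Expanding the square gives means of products over the words cc, cc' and c'c'. With exact prefix
    probabilities in their place the combination vanishes by [prefix_prob_swap]; the error of
    sampling with replacement is multiplied by the sum of the absolute coefficients, (W c + W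
    c')^2. *)
Lemma avg_balance_sq n c c' : size c = size c' -> sumn c = sumn c' ->
  (size c + size c <= n)%N -> (0 < n)%N ->
  avgB_ w n (fun s => (balance c c' (occ R n s)) ^+ 2) <=
  (W c + W c') ^+ 2 * (1 - inj_ratio R n (size c + size c)).
Proof.
move=> Es En sn n0.
have a0 : 0 <= W c by apply: prodr_ge0.
have b0 : 0 <= W c' by apply: prodr_ge0.
pose M e := avgB_ w n (fun s => \prod_(k <- e) occ R n s k).
pose P e := prefix_prob w n e.
have -> : avgB_ w n (fun s => (balance c c' (occ R n s)) ^+ 2) =
   W c' ^+ 2 * M (c ++ c) - 2 * W c * W c' * M (c ++ c') + W c ^+ 2 * M (c' ++ c').
  rewrite /M /avgB_ -!avgZ -avgB -avgD; apply: eq_avg => f _.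
  by rewrite /balance !big_cat /=; ring.
have H e : size e = (size c + size c)%N ->
    `|M e - P e| <= 1 - inj_ratio R n (size c + size c).
  by move=> Ee; rewrite -Ee; apply: avg_prod_occ => //; rewrite Ee.
have H1 := H (c ++ c) (size_cat _ _).
have H2 : `|M (c ++ c') - P (c ++ c')| <= 1 - inj_ratio R n (size c + size c).
  by apply: H; rewrite size_cat -Es.
have H3 : `|M (c' ++ c') - P (c' ++ c')| <= 1 - inj_ratio R n (size c + size c).
  by apply: H; rewrite size_cat -Es.
have sw e e' : size e = size e' -> sumn e = sumn e' -> W e' * P e = W e * P e'.
  by move=> *; apply: prefix_prob_swap.
have WE u v : W (u ++ v) = W u * W v by rewrite /W big_cat.
have S13 : W c' * W c' * P (c ++ c) = W c * W c * P (c' ++ c').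
  by rewrite -!WE; apply: sw; rewrite ?size_cat ?sumn_cat ?Es ?En.
have S12 : W c * W c' * P (c ++ c) = W c * W c * P (c ++ c').
  by rewrite -!WE; apply: sw; rewrite ?size_cat ?sumn_cat ?Es ?En.
have E0 : W c' ^+ 2 * P (c ++ c) - 2 * W c * W c' * P (c ++ c') + W c ^+ 2 * P (c' ++ c') = 0.
  (* The mixed relation carries a factor W c that must be cancelled; when it is zero, the relation
     between cc and c'c' alone suffices. *)
  have [a1|a1] := eqVneq (W c) 0.
    by move: S13; rewrite a1 => S13; rewrite !expr2 S13; ring.
  have E : W c' * P (c ++ c) = W c * P (c ++ c').
    by apply: (mulfI a1); rewrite [LHS]mulrA [RHS]mulrA; exact: S12.
  rewrite !expr2 -S13. rewrite -!mulrA E. ring.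
have nn := le_trans (normr_ge0 _) H1.
move: H1 H2 H3 E0; rewrite !ler_norml => /andP[_ H1] /andP[H2 _] /andP[_ H3] E0.
set u := 1 - inj_ratio _ _ _ in H1 H2 H3 nn *.
have K1 : W c' ^+ 2 * (M (c ++ c) - P (c ++ c)) <= W c' ^+ 2 * u by rewrite ler_wpM2l // exprn_ge0.
have K3 : W c ^+ 2 * (M (c' ++ c') - P (c' ++ c')) <= W c ^+ 2 * u by rewrite ler_wpM2l // exprn_ge0.
have K2 : (2 * W c * W c') * (- u) <= (2 * W c * W c') * (M (c ++ c') - P (c ++ c')).
  by rewrite ler_wpM2l // !mulr_ge0.
nra.
Qed.

Lemma balance_cvg (c c' : seq nat) (nn : nat -> nat) (e : R) : size c = size c' ->
  sumn c = sumn c' -> 0 < e -> nn @ \oo --> \oo ->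
  (fun m => avgB_ w (nn m) (fun s => (e < `|balance c c' (occ R (nn m) s)|)%R%:R)) @ \oo --> (0 : R).
Proof.
move=> Es En e0 Hnn.
set l := (size c + size c)%N.
have L : (fun m => (W c + W c') ^+ 2 * (1 - inj_ratio R (nn m) l) / e ^+ 2) @ \oo --> (0 : R).
  rewrite -[X in _ --> X](mul0r (e ^+ 2)^-1); apply: cvgMr_tmp.
  rewrite -[X in _ --> X](mulr0 ((W c + W c') ^+ 2)); apply: cvgMl_tmp.
  rewrite -[X in _ --> X](subrr 1); apply: cvgB; first exact: cvg_cst.
  exact: (cvg_comp _ _ Hnn (@inj_ratio_cvg R l)).
apply: (squeeze_cvgr _ (cvg_cst 0) L); near=> m; apply/andP; split.
  by apply: avg_prob_ge0; exact: fwt_ge0.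
have nl : (l <= nn m)%N by near: m; exact: (Hnn _ (nbhs_infty_ge l)).
have n1 : (0 < nn m)%N by near: m; exact: (Hnn _ (nbhs_infty_ge 1%N)).
rewrite ler_pdivlMr ?exprn_gt0 //.
apply: le_trans (avg_balance_sq Es En nl n1).
rewrite /avgB_ -avgZr; apply: ler_avg; first exact: fwt_ge0.
move=> f _ _; case: ltP => /= H; last by rewrite mul0r sqr_ge0.
by rewrite mul1r -[leRHS]real_normK ?num_real // lerXn2r ?nnegrE ?normr_ge0 // ltW.
Unshelve. all: by end_near. Qed.

End Relations.

(* The two words with k1 + k letters and sum k * k1 whose balance forces an
   empirical measure to be of the form p_k = C w_k t^k. *)
Definition word_l (k1 k : nat) : seq nat := nseq k1 k ++ nseq k 0%N.
Definition word_r (k1 k : nat) : seq nat := nseq k k1 ++ nseq k1 0%N.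

Lemma size_word k1 k : size (word_l k1 k) = size (word_r k1 k).
Proof. by rewrite !size_cat !size_nseq addnC. Qed.

Lemma sumn_word k1 k : sumn (word_l k1 k) = sumn (word_r k1 k).
Proof. by rewrite !sumn_cat !sumn_nseq !mul0n !addn0 mulnC. Qed.

Lemma prod_nseq (R : realType) (p : nat -> R) n k : \prod_(i <- nseq n k) p i = p k ^+ n.
Proof. by rewrite big_nseq iter_mulr_1. Qed.

Lemma balance_word (R : realType) (w p : nat -> R) k1 k :
  balance w (word_l k1 k) (word_r k1 k) p =
  w k1 ^+ k * w 0%N ^+ k1 * (p k ^+ k1 * p 0%N ^+ k) -
  w k ^+ k1 * w 0%N ^+ k * (p k1 ^+ k * p 0%N ^+ k1).
Proof. by rewrite /balance !big_cat /= !prod_nseq. Qed.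

Lemma nth_root_exists (R : realType) (x : R) k : (0 < k)%N -> 0 <= x ->
  exists2 t, 0 <= t & t ^+ k = x.
Proof.
move=> k0 x0; exists (x `^ (k%:R^-1)); first exact: powR_ge0.
rewrite -powR_mulrn ?powR_ge0 // -powRrM mulVf ?powRr1 //.
by rewrite pnatr_eq0 -lt0n.
Qed.

Lemma lt_invSn (R : realType) (e : R) : 0 < e -> exists N, forall i, (N <= i)%N -> i.+1%:R^-1 < e.
Proof.
move=> e0; have := @cvg_harmonic R; move/cvgr_lt/(_ e e0) => [N _ HN].
by exists N => i Ni; apply: HN.
Qed.

Lemma cvg_of_bounds (R : realType) (u : nat -> R) (l : R) (L : nat -> nat) :
  nondecreasing_seq u -> (forall n, u n <= l) ->
  (forall i, l - i.+1%:R^-1 <= u (L i)) -> u @ \oo --> l.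
Proof.
move=> nd ub lb; apply/cvgrPdist_lt => e e0.
have [N HN] := lt_invSn e0; near=> n.
have Ln : (L N <= n)%N by near: n; exact: nbhs_infty_ge.
rewrite ger0_norm ?subr_ge0 //.
apply: le_lt_trans (HN N (leqnn N)).
by have := le_trans (lb N) (nd _ _ Ln); rewrite lerBlDr -lerBlDl addrC.
Unshelve. all: by end_near. Qed.

(** * Identification of a limit law from balance, mass and mean *)

Section IdentifyLimit.
Variables (R : realType) (w : nat -> R) (tau nu : R) (k1 : nat).
Hypotheses (Hw : weight_seq w) (Ht : type_II_or_III w tau nu).
Hypotheses (k1_gt1 : (1 < k1)%N) (wk1 : 0 < w k1).
Variables (L : nat -> nat) (q : nat -> R).
Hypotheses (Lge : forall i, (i <= L i)%N) (q0 : forall k, 0 <= q k).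
Hypothesis qle1 : forall K, series q K <= 1.
Hypothesis qge1 : forall i, 1 - i.+1%:R^-1 <= series q i.+1.
Hypothesis qmean : forall i,
  `|series (fun k => k%:R * q k) (L i).+1 - mu nu| <= i.+1%:R^-1.
Hypothesis qbal : forall k, balance w (word_l k1 k) (word_r k1 k) q = 0.

Let w0 : forall k, 0 <= w k. Proof. by case: Hw. Qed.
Let w00 : 0 < w 0%N. Proof. by case: Hw => _ []. Qed.
Let m := series (fun k => k%:R * q k).
Let pi := xi_law w tau.

Lemma qmass_cvg : series q @ \oo --> (1 : R).
Proof.
apply: (@cvg_of_bounds _ _ _ succn) => //.
by apply: nondecreasing_series => k _ _.
Qed.

Lemma qmean_nd : nondecreasing_seq m.
Proof. by apply: nondecreasing_series => k _ _; rewrite mulr_ge0. Qed.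

Lemma qmean_le n : m n <= mu nu.
Proof.
apply/ler_addgt0Pr => e e0; have [N HN] := lt_invSn e0.
pose i := maxn N n.
have H1 : m n <= m (L i).+1.
  by apply: qmean_nd; apply: leqW; apply: leq_trans (Lge i); rewrite leq_maxr.
have := qmean i; rewrite ler_norml => /andP[_ H2].
move: H1 H2 (HN i (leq_maxl _ _)); rewrite -/m.
by move: (m n) (m (L i).+1) (i.+1%:R^-1) => a b c; lra.
Qed.

Lemma qmean_cvg : m @ \oo --> mu nu.
Proof.
apply: (@cvg_of_bounds _ _ _ (fun i => (L i).+1)); [exact: qmean_nd | exact: qmean_le |].
by move=> i; have := qmean i; rewrite ler_norml => /andP[H _]; move: H; rewrite -/m; move: (m _) (_^-1) => a b; lra.
Qed.

(** The mass off 0 is at most the mean, which is below one. *)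
Lemma q0_gt0 : 0 < q 0%N.
Proof.
have [[_ _ _ _ mu1] _] := offspring_mean Hw Ht.
have [N HN] : exists N, forall i, (N <= i)%N -> i.+1%:R^-1 < 1 - mu nu.
  by apply: lt_invSn; rewrite subr_gt0.
have H := HN N (leqnn N); have H1 := qge1 N; have H2 := qmean_le N.+1.
suff : series q N.+1 <= q 0%N + m N.+1 by move: H H1 H2; move: (series q N.+1) (m N.+1) (N.+1%:R^-1) => a b c; lra.
rewrite /m !seriesEnat /= !big_nat_recl //= mul0r add0r lerD2l.
by apply: ler_sum => i _; rewrite -[leLHS]mul1r ler_wpM2r // ler1n.
Qed.

(** [t] is chosen to make the formula true at k1. The balance relation between k and k1 is then the
    k1-th power of the formula at k, and nonnegative roots are unique. *)
Lemma q_boltzmann : exists2 t, 0 <= t & forall k, q k = q 0%N / w 0%N * (w k * t ^+ k).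
Proof.
have q00 := q0_gt0; have k10 : (0 < k1)%N by apply: ltnW.
pose x := q k1 * w 0%N / (w k1 * q 0%N).
have x0 : 0 <= x by rewrite divr_ge0 // mulr_ge0 // ltW.
have [t t0 tx] := nth_root_exists k10 x0.
exists t => // k.
have H : 0 <= q 0%N / w 0%N * (w k * t ^+ k).
  by rewrite !mulr_ge0 ?invr_ge0 ?exprn_ge0.
apply/eqP; rewrite -(@eqrXn2 _ k1) //; apply/eqP.
have := qbal k; rewrite balance_word => /eqP; rewrite subr_eq0 => /eqP B.
rewrite !exprMn exprVn exprAC tx /x !exprMn exprVn exprMn.
have a1 : w k1 ^+ k != 0 by rewrite expf_neq0 // gt_eqF.
have a2 : w 0%N ^+ k1 != 0 by rewrite expf_neq0 // gt_eqF.
have a3 : q 0%N ^+ k != 0 by rewrite expf_neq0 // gt_eqF.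
apply: (mulfI (mulf_neq0 (mulf_neq0 a1 a2) a3)).
rewrite (_ : _ * q k ^+ k1 = w k1 ^+ k * w 0%N ^+ k1 * (q k ^+ k1 * q 0%N ^+ k)); last by ring.
by rewrite B; field; rewrite a1 a2 a3.
Qed.

Lemma identify_limit j : q j = pi j.
Proof.
have q00 := q0_gt0; have [t t0 qE] := q_boltzmann.
have [[[c c0 piE] pi1 pim mu0 mu1] [tau0 Hr]] := offspring_mean Hw Ht.
have piE' k : pi k = w k * tau ^+ k / c by rewrite /pi piE (mulrC (tau ^+ k)).
have ttau : t <= tau.
  apply: (@le_radius _ w tau Hw t (w 0%N / q 0%N)) => // n.
  have -> : series (fun k => w k * t ^+ k) n = w 0%N / q 0%N * series q n.
    rewrite !seriesEnat /= big_distrr /=; apply: eq_bigr => k _.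
    by rewrite [q k]qE; field; rewrite !gt_eqF.
  rewrite -[leRHS]mulr1 ler_wpM2l //.
  by rewrite divr_ge0 // ltW.
pose A := q 0%N * c / w 0%N.
have A0 : 0 < A by rewrite !mulr_gt0 ?invr_gt0.
move: ttau; rewrite le_eqVlt => /orP[/eqP Et|ttau].
  have qA k : q k = A * pi k.
    by rewrite qE piE' -Et /A; field; rewrite !gt_eqF.
  have E1 : series q @ \oo --> A * 1.
    have -> : series q = (fun n => A * series pi n).
      by apply/funext => n; rewrite !seriesEnat /= big_distrr /=; apply: eq_bigr => k _.
    exact: cvgMl_tmp.
  have EA : 1 = A * 1 by rewrite -(cvg_lim _ E1) // (cvg_lim _ qmass_cvg).
  by rewrite qA -[A]mulr1 -EA mul1r.
have taup : 0 < tau by apply: le_lt_trans ttau.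
pose r := t / tau.
have r0 : 0 <= r by rewrite divr_ge0.
have r1 : r < 1 by rewrite ltr_pdivrMr // mul1r.
have pi0 k : 0 <= pi k by rewrite piE' !mulr_ge0 ?invr_ge0 ?exprn_ge0 // ltW.
have qA k : q k = A * pi k * r ^+ k.
  rewrite qE piE' /A /r expr_div_n; field.
  by rewrite expf_neq0 ?gt_eqF //= !gt_eqF.
have rk k : r ^+ k <= 1 by rewrite exprn_ile1 // ltW.
(* Otherwise q <= pi termwise, with a loss of at least e at k1 where w is positive, and q would have
   total mass below one. *)
have A1 : 1 < A.
  rewrite ltNge; apply/negP => A1.
  have pk1 : 0 < pi k1 by rewrite piE' !mulr_gt0 ?invr_gt0 ?exprn_gt0.
  pose e := pi k1 * (1 - r ^+ k1).
  have e0 : 0 < e.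
    by rewrite mulr_gt0 // subr_gt0 exprn_ilt1 // -lt0n (ltnW k1_gt1).
  have H n : (k1 < n)%N -> series q n <= series pi n - e.
    move=> kn; rewrite !seriesEnat /= !big_mkord (bigD1 (Ordinal kn)) //=.
    rewrite [in leRHS](bigD1 (Ordinal kn)) //=.
    have le k : q k <= pi k * r ^+ k.
      by rewrite qA -mulrA -[leRHS]mul1r ler_wpM2r // mulr_ge0 // exprn_ge0.
    have : \sum_(i < n | i != Ordinal kn) q i <= \sum_(i < n | i != Ordinal kn) pi i.
      apply: ler_sum => i _; apply: le_trans (le i) _.
      by rewrite -[leRHS]mulr1 ler_wpM2l.
    have := le k1; rewrite /e; lra.
  have pe : (fun n => series pi n - e) @ \oo --> 1 - e.
    by apply: cvgB => //; exact: cvg_cst.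
  have : 1 <= 1 - e.
    apply: (ler_cvg_to qmass_cvg pe).
    by exists k1.+1 => // n /= kn; exact: H.
  by move: e0; lra.
(* The ratio q/pi = A r^k starts above 1 and tends to 0. The least N with A r^N < 1 is where it
   crosses 1. *)
have [N AN] : exists N, A * r ^+ N < 1.
  have : (fun n => A * r ^+ n) @ \oo --> A * 0.
    apply: cvgMl_tmp; apply: cvg_expr; rewrite ger0_norm //.
  rewrite mulr0 => /cvgr_lt/(_ 1 ltr01)[N _ HN].
  by exists N; apply: HN => /=.
have exN : exists N, (A * r ^+ N < 1)%R by exists N.
case: (ex_minnP exN) => {AN}N AN Nmin.
have N0 : (0 < N)%N.
  by case: N AN Nmin => // ; rewrite expr0 mulr1; lra.
pose e := N%:R * pi 0%N * (A - 1).
have p00 : 0 < pi 0%N by rewrite piE' expr0 mulr1 divr_gt0.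
have e0 : 0 < e.
  by apply: mulr_gt0; [apply: mulr_gt0; rewrite ?ltr0n | rewrite subr_gt0].
(* Centred at the crossing, all summands (k - N)(q_k - pi_k) are nonpositive, and the one at 0 is
   -e. The limit of [T] is 0 since masses and means agree, a contradiction: a strict tilt lowers the
   mean. *)
pose T := fun n => (series (fun k => k%:R * q k) n - series (fun k => k%:R * pi k) n)
   - N%:R * (series q n - series pi n).
have TE n : T n = \sum_(0 <= k < n) ((k%:R - N%:R) * (q k - pi k)).
  rewrite /T !seriesEnat /= -!sumrB big_distrr /= -sumrB; apply: eq_bigr => k _; ring.
have Tle n : T n.+1 <= - e.
  rewrite TE big_nat_recl //= -[leRHS]addr0 lerD //.
    by rewrite /e qA expr0 mulr1; rewrite le_eqVlt; apply/orP; left; apply/eqP; ring.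
  apply: sumr_le0 => k _; set i := k.+1.
  case: (leqP N i) => Ni.
    have ri : A * r ^+ i <= 1.
      apply: le_trans (ltW AN); rewrite ler_wpM2l ?(ltW A0) //.
      by apply: ler_wiXn2l => //; exact: ltW.
    rewrite mulr_ge0_le0 // ?subr_ge0 ?ler_nat //.
    rewrite subr_le0 qA -mulrA mulrCA -[leRHS]mulr1 ler_wpM2l //.
  have ri : 1 <= A * r ^+ i.
    by rewrite leNgt; apply/negP => /Nmin; rewrite leqNgt Ni.
  rewrite mulr_le0_ge0 // ?subr_le0 ?ler_nat ?(ltnW Ni) //.
  by rewrite subr_ge0 qA -mulrA mulrCA -[leLHS]mulr1 ler_wpM2l.
have Tcvg : T @ \oo --> (mu nu - mu nu) - N%:R * (1 - 1).
  apply: cvgB; first by apply: cvgB => //; exact: qmean_cvg.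
  by apply: cvgMl_tmp; apply: cvgB => //; exact: qmass_cvg.
have : (mu nu - mu nu) - N%:R * (1 - 1) <= - e.
  apply: (ler_cvg_to Tcvg (cvg_cst _)).
  by exists 1%N => // -[|n] //= _; exact: Tle.
by move: e0; rewrite !subrr mulr0 subr0; lra.
Qed.

End IdentifyLimit.

Lemma fmap_ultra (T U : Type) (f : T -> U) (F : set_system T) :
  UltraFilter F -> UltraFilter (f @ F).
Proof.
move=> FU; split; first exact: fmap_proper_filter.
move=> G GF FG; apply/seteqP; split => // A GA.
have [//|H] := in_ultra_setVsetC (f @^-1` A) FU.
have GC : G (~` A) by apply: FG.
have : G (A `&` ~` A) by apply: filterI.
by rewrite setICr => /filter_not_empty.
Qed.

Lemma near_forall_lt (T : Type) (F : set_system T) (FF : Filter F) (P : nat -> T -> Prop) I :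
  (forall i, \forall x \near F, P i x) -> \forall x \near F, forall i, (i < I)%N -> P i x.
Proof.
move=> H; elim: I => [|I IH]; first by near=> x.
near=> x => i; rewrite ltnS leq_eqVlt => /orP[/eqP->|]; first by near: x.
by move: i; near: x.
Unshelve. all: by end_near. Qed.

Lemma sum_count_mem K (s : seq nat) :
  (\sum_(0 <= k < K) count_mem k s)%N = count (fun x => x < K)%N s.
Proof.
elim: s => [|x s IH] /=; first by rewrite big1.
rewrite big_split /= IH; congr (_ + _)%N.
rewrite big_mkord; case: ltnP => xK.
  rewrite (bigD1 (Ordinal xK)) //= eqxx big1 // => i.
  by rewrite -val_eqE /= eq_sym => /negbTE->.
by rewrite big1 // => i _; case: eqP => // E; move: xK; rewrite E leqNgt ltn_ord.
Qed.

Lemma count_geq_sumn K (s : seq nat) : (count (fun x => K <= x) s * K <= sumn s)%N.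
Proof. by elim: s => //= x s IH; rewrite mulnDl; case: leqP => /= H; lia. Qed.

Section OccBasics.
Variables (R : realType) (n : nat).
Implicit Type s : seq nat.

Lemma series_occ s K : series (occ R n s) K = (count (fun x => x < K)%N s)%:R / n%:R.
Proof. by rewrite seriesEnat /= -mulr_suml -natr_sum sum_count_mem. Qed.

Lemma series_occ_le1 s K : size s = n -> series (occ R n s) K <= 1.
Proof.
move=> Hs; rewrite series_occ -Hs; case: s {Hs} => [|x s].
  by rewrite invr0 mulr0.
by rewrite ler_pdivrMr ?ltr0n // mul1r ler_nat count_size.
Qed.

Lemma series_occ_ge s i : size s = n -> (sumn s < n)%N ->
  1 - i.+1%:R^-1 <= series (occ R n s) i.+1.
Proof.
move=> Hs Hn; have n0 : (0 < n)%N by apply: leq_ltn_trans Hn.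
rewrite series_occ ler_pdivlMr ?ltr0n // mulrBl mul1r lerBlDr -lerBlDl.
rewrite -[X in X%:R - _]Hs -(count_predC (fun x => x < i.+1)%N) natrD addrC addKr.
rewrite mulrC ler_pdivlMr ?ltr0n // -natrM ler_nat.
apply: leq_trans (_ : sumn s <= _)%N; last exact: ltnW.
rewrite (eq_count (a2 := fun x => i.+1 <= x)%N); first exact: count_geq_sumn.
by move=> x /=; rewrite -leqNgt.
Qed.

Lemma occ_le1 s k : size s = n -> occ R n s k <= 1.
Proof.
move=> Hs; rewrite /occ -Hs; case: s {Hs} => [|x s]; first by rewrite invr0 mulr0.
by rewrite ler_pdivrMr ?ltr0n // mul1r ler_nat count_size.
Qed.

Lemma mean_occ s L : (0 < n)%N -> (L < n)%N ->
  n%:R * series (fun k => k%:R * occ R n s k) L.+1 =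
  \sum_(k < n | k%:R <= L%:R :> R) (k * count_mem (k : nat) s)%N%:R.
Proof.
move=> n0 Ln; have nn : n%:R != 0 :> R by rewrite pnatr_eq0 -lt0n.
rewrite seriesEnat /= big_distrr /= big_mkord (big_ord_widen n (fun k => n%:R * (k%:R * occ R n s k))) //.
apply: eq_big => [i|i _]; first by rewrite ler_nat ltnS.
by rewrite /occ natrM; field.
Qed.

End OccBasics.

(** * From diverging cutoffs to a fixed cutoff of the mean *)

Section Concentration.
Variables (R : realType) (w : nat -> R) (tau nu : R) (d : nat) (Om : nat -> R).
Hypotheses (Hw : weight_seq w) (Ht : type_II_or_III w tau nu).
Hypotheses (Hd : is_span w d) (HOm : Omega_ok w d (mu nu) Om).

Let w0 : forall k, 0 <= w k. Proof. by case: Hw. Qed.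
Let nn (m : nat) := (d * m + 1)%N.
Let d0 : (0 < d)%N. Proof. exact: span_gt0 Hw Hd. Qed.

Lemma span_cvg : nn @ \oo --> \oo.
Proof.
move=> A [N _ HN]; exists N => // m /= Nm; apply: HN => /=.
by rewrite /nn; move: d0 Nm; nia.
Qed.

Lemma span_ge k : \forall m \near \oo, (k <= nn m)%N.
Proof. exact: (span_cvg (nbhs_infty_ge k)). Qed.

Lemma Om_cvg : (fun m => Om (nn m)) @ \oo --> +oo.
Proof. case: HOm => H _; exact: (cvg_comp _ _ span_cvg H). Qed.

Lemma PrTn_count (n : nat) (Q : (nat -> nat) -> bool) : (0 < n)%N ->
  (forall f g, f =1 g -> Q f = Q g) ->
  PrTn w (fun S : {set word n} => Q (Nk S)) =
  avgB_ w n (fun s => (Q (fun k => count_mem k s))%:R).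
Proof.
move=> n0 Qext; rewrite PrTn_avgT //.
rewrite -(avgT_rotcode w n (fun s => (Q (fun k => count_mem k s))%:R)).
apply: eq_avg => -[S x]; rewrite inE /= => /andP[HS _].
by congr (nat_of_bool _)%:R; apply: Qext => k; exact: Nk_rotcode.
Qed.

(** Diagonal argument: if every fixed cutoff L >= L0 failed for arbitrarily large trees, failures
    with growing L could be assembled into one admissible sequence of cutoffs, contradicting the
    hypothesis on Omega. *)
Lemma mean_tail (e : R) (L0 : nat) : 0 < e -> exists2 L, (L0 <= L)%N &
  \forall m \near \oo, avgB_ w (nn m)
    (fun s => (e < `|series (fun k => k%:R * occ R (nn m) s k) L.+1 - mu nu|)%R%:R) <= e.
Proof.
move=> e0; pose bad L m := e < avgB_ w (nn m)
    (fun s => (e < `|series (fun k => k%:R * occ R (nn m) s k) L.+1 - mu nu|)%R%:R).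
apply: contrapT => Hno.
have Hbad L M : exists m, (L0 <= L)%N ->
    [/\ (M <= m)%N, bad L m, L%:R <= Om (nn m) & (L < nn m)%N].
  have [LL|] := leqP L0 L; last by exists 0%N.
  have Hev : \forall m \near \oo, [/\ (M <= m)%N, L%:R <= Om (nn m) & (L < nn m)%N].
    near=> m; split; near: m; [exact: nbhs_infty_ge | | exact: span_ge].
    by have /cvgryPge := Om_cvg; apply.
  case: Hev => N _ HN.
  apply: contrapT => Hn; apply: Hno; exists L => //.
  exists N => // m /= Nm; rewrite leNgt; apply/negP => Hb.
  by apply: Hn; exists m => _; case: (HN m Nm).
have {Hbad}/choice[f Hf] : forall p : nat * nat, exists m, (L0 <= p.1)%N ->
    [/\ (p.2 <= m)%N, bad p.1 m, p.1%:R <= Om (nn m) & (p.1 < nn m)%N].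
  by case=> L M; exact: Hbad.
pose ms := fix ms (j : nat) : nat :=
  if j is j'.+1 then f ((L0 + j)%N, (ms j').+1) else f (L0, 0%N).
have Hms j : [/\ bad (L0 + j)%N (ms j), (L0 + j)%N%:R <= Om (nn (ms j)) & (L0 + j < nn (ms j))%N].
  case: j => [|j].
    by have [] := Hf (L0, 0%N) (leqnn _); rewrite addn0.
  by have [] := Hf ((L0 + j.+1)%N, (ms j).+1) (leq_addr _ _).
have msS j : (ms j < ms j.+1)%N.
  by have [] := Hf ((L0 + j.+1)%N, (ms j).+1) (leq_addr _ _).
have msmono i j : (i < j)%N -> (ms i < ms j)%N.
  by apply: (homo_ltn (r := fun a b => a < b)%N) => // a b c; exact: ltn_trans.
have ms_inj i j : nn (ms i) = nn (ms j) -> i = j.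
  move=> /eqP; rewrite /nn eqn_add2r eqn_pmul2l // => /eqP E.
  by case: (ltngtP i j) => // /msmono; rewrite E ltnn.
have ms_ge j : (j <= ms j)%N.
  by elim: j => // j IH; exact: leq_ltn_trans IH (msS j).
(* The cutoff is L0 + j at the j-th bad size and [Om] elsewhere; bad sizes were picked so large that
   L0 + j <= [Om] there. *)
pose K n : R := if pselect (exists j, n = nn (ms j)) is left ex then (L0 + projT1 (cid ex))%N%:R
                else Om n.
have KE j : K (nn (ms j)) = (L0 + j)%N%:R.
  rewrite /K; case: pselect => [ex|]; last by case; exists j.
  by case: cid => i /= /ms_inj ->.
have Kle n : K n <= Om n.
  have [[j ->]|H] := pselect (exists j, n = nn (ms j)).
    by rewrite KE; case: (Hms j).
  by rewrite /K; case: pselect.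
have Kcvg : K n @[n --> \oo] --> +oo.
  apply/cvgryPge => A.
  have [J HJ] : exists J : nat, A <= J%:R.
    by exists (Num.bound `|A|); exact: ltW (le_lt_trans (ler_norm A) (archi_boundP (normr_ge0 A))).
  have [HO _] := HOm.
  near=> n.
  have [[j En]|H] := pselect (exists j, n = nn (ms j)).
    rewrite En KE; apply: le_trans HJ _; rewrite ler_nat.
    have : (nn (ms J) <= n)%N by near: n; exact: nbhs_infty_ge.
    rewrite En /nn leq_add2r leq_pmul2l // => H.
    apply: leq_trans (leq_addl _ _); rewrite leqNgt; apply/negP => /msmono.
    by rewrite ltnNge H.
  rewrite /K; case: pselect => // _; near: n.
  by have /cvgryPge := HO; apply.
have [_ [_ /(_ K Kcvg Kle e e0)[H _]]] := HOm.
have [M _ HM] := cvgr_lt 0 H _ e0.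
have [Hb _ Hn] := Hms M.
have := HM (ms M) (ms_ge M) => /=; rewrite -/(nn (ms M)).
rewrite (PrTn_count (Q := fun f => e * (nn (ms M))%:R < `|\sum_(k < nn (ms M) | k%:R <= K (nn (ms M)))
  (k * f k)%N%:R - mu nu * (nn (ms M))%:R|)); last 2 first.
- by rewrite /nn addn1.
- by move=> f1 g1 E; congr (_ < `|_ - _|); apply: eq_bigr => k _; rewrite E.
rewrite ltNge => /negP; apply; rewrite KE; apply: le_trans (ltW Hb) _.
apply: ler_avg; first exact: fwt_ge0.
have n0 : 0 < (nn (ms M))%:R :> R by rewrite ltr0n /nn addn1.
move=> g _ _; rewrite -mean_occ //; last by rewrite /nn addn1.
by rewrite (mulrC (mu nu)) -mulrBr normrM (gtr0_norm n0) mulrC ltr_pM2l.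
Unshelve. all: by end_near. Qed.

End Concentration.

(** * Compactness of empirical measures *)

Section Compactness.
Variables (R : realType) (w : nat -> R) (tau nu : R) (k1 : nat).
Hypotheses (Hw : weight_seq w) (Ht : type_II_or_III w tau nu).
Hypotheses (k1_gt1 : (1 < k1)%N) (wk1 : 0 < w k1).
Variables (L : nat -> nat).
Hypothesis Lge : forall i, (i <= L i)%N.

(** The last clause is Markov's inequality for a mean below one. It is uniform in the tree, so no
    mass escapes in a limit. *)
Definition empirical (p : nat -> R) : Prop := [/\ forall k, 0 <= p k <= 1,
  forall K, series p K <= 1 & forall i, 1 - i.+1%:R^-1 <= series p i.+1].

Definition mean_close (i : nat) (p : nat -> R) : bool :=
  `|series (fun k => k%:R * p k) (L i).+1 - mu nu| <= i.+1%:R^-1.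

Definition balance_close (i k : nat) (p : nat -> R) : bool :=
  `|balance w (word_l k1 k) (word_r k1 k) p| <= i.+1%:R^-1.

(** Counterexamples for all I would have a coordinatewise limit along an ultrafilter. It satisfies
    every condition exactly, so [identify_limit] gives pi and contradicts the distance e at j.
    Finitely many conditions can then be treated by a union bound. *)
Lemma finitely_many_conditions j (e : R) : 0 < e -> exists I, forall p, empirical p ->
  (forall i, (i < I)%N -> mean_close i p /\ (forall k, (k <= i)%N -> balance_close i k p)) ->
  `|p j - xi_law w tau j| <= e.
Proof.
move=> e0; apply: contrapT => Hno.
have {Hno}/choice[p Hp] : forall I : nat, exists p : nat -> R, [/\ empirical p,
   (forall i, (i < I)%N -> mean_close i p /\ (forall k, (k <= i)%N -> balance_close i k p)) &
   e < `|p j - xi_law w tau j|].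
  move=> I; apply: contrapT => HI; apply: Hno; exists I => p Hp1 Hp2.
  by rewrite leNgt; apply/negP => Hp3; apply: HI; exists p.
have [U [UU FU]] := ultraFilterLemma (eventually_filter).
have PU := @ultra_proper _ _ UU.
have UA (P : nat -> Prop) : (\forall m \near \oo, P m) -> \forall m \near U, P m by apply: FU.
have Hlim k : exists x : R, (fun I => p I k) @ U --> x.
  have := @segment_compact R 0 1; rewrite compact_ultra => /(_ _ (fmap_ultra (fun I => p I k) UU)).
  case; last by move=> x [_ Hx]; exists x.
  have HU : \forall I \near U, [set` `[0, 1]] (p I k).
    apply: nearW => I; have [[/(_ k)/andP[h1 h2] _ _] _ _] := Hp I.
    by rewrite /= in_itv /= h1 h2.
  exact: HU.
have [q Hq] := choice Hlim.
have Hs (c : nat -> R) n : (fun I => series (fun k => c k * p I k) n) @ U --> series (fun k => c k * q k) n.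
  by rewrite /series /=; apply: cvg_sumr => k; apply: cvgMl_tmp.
have Hs1 n : (fun I => series (p I) n) @ U --> series q n.
  by rewrite /series /=; apply: cvg_sumr.
have prodq (c : seq nat) : (fun I => \prod_(k <- c) p I k) @ U --> \prod_(k <- c) q k.
  by apply: cvg_big => [|i _]; [exact: mul_continuous | exact: Hq].
have le_lim (f : nat -> R) (a b : R) : f @ U --> a -> (\forall m \near U, f m <= b) -> a <= b.
  by move=> fa fb; apply: (ler_cvg_to fa (cvg_cst b)).
have ge_lim (f : nat -> R) (a b : R) : f @ U --> a -> (\forall m \near U, b <= f m) -> b <= a.
  by move=> fa fb; apply: (ler_cvg_to (cvg_cst b) fa).
have qj : q j = xi_law w tau j.
  apply: (@identify_limit _ w tau nu k1 Hw Ht k1_gt1 wk1 L q Lge).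
  - move=> k; apply: (ge_lim _ _ _ (Hq k)); apply: nearW => I.
    by have [[/(_ k)/andP[]]] := Hp I.
  - move=> K; apply: (le_lim _ _ _ (Hs1 K)); apply: nearW => I.
    by have [[_ + _] _ _] := Hp I.
  - move=> i; apply: (ge_lim _ _ _ (Hs1 _)); apply: nearW => I.
    by have [[_ _ +] _ _] := Hp I.
  - move=> i.
    have C : (fun I => `|series (fun k => k%:R * p I k) (L i).+1 - mu nu|) @ U -->
        `|series (fun k => k%:R * q k) (L i).+1 - mu nu|.
      by apply: cvg_norm; apply: cvgB; [exact: Hs | exact: cvg_cst].
    apply: (le_lim _ _ _ C); apply: UA; near=> I.
    have [_ /(_ i) H _] := Hp I; have [|H1 _] := H; last exact: H1.
    by near: I; exact: nbhs_infty_gt.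
  - move=> k.
    have C : (fun I => `|balance w (word_l k1 k) (word_r k1 k) (p I)|) @ U -->
       `|balance w (word_l k1 k) (word_r k1 k) q|.
      by apply: cvg_norm; apply: cvgB; apply: cvgMl_tmp.
    apply/eqP; rewrite -normr_eq0 eq_le normr_ge0 andbT.
    apply/ler_addgt0Pr => x x0; rewrite add0r; have [N HN] := lt_invSn x0.
    apply: (le_lim _ _ _ C); apply: UA; near=> I.
    have [_ /(_ (maxn N k)) H _] := Hp I.
    apply: le_trans (ltW (HN (maxn N k) (leq_maxl _ _))).
    have [|_ H'] := H; last by apply: H'; rewrite leq_maxr.
    by near: I; exact: nbhs_infty_gt.
have C : (fun I => `|p I j - xi_law w tau j|) @ U --> `|q j - xi_law w tau j|.
  by apply: cvg_norm; apply: cvgB; [exact: Hq | exact: cvg_cst].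
have : e <= `|q j - xi_law w tau j|.
  apply: (ge_lim _ _ _ C); apply: nearW => I.
  by have [_ _ /ltW] := Hp I.
by rewrite qj subrr normr0 leNgt e0.
Unshelve. all: by end_near. Qed.

End Compactness.

(** * Convergence of prefix probabilities *)

Section PrefixLimit.
Variables (R : realType) (w : nat -> R) (tau nu : R) (d : nat) (Om : nat -> R).
Hypotheses (Hw : weight_seq w) (Ht : type_II_or_III w tau nu).
Hypotheses (Hd : is_span w d) (HOm : Omega_ok w d (mu nu) Om).

Let w0 : forall k, 0 <= w k. Proof. by case: Hw. Qed.
Let nn (m : nat) := (d * m + 1)%N.
Let pi := xi_law w tau.

Lemma fseq_empirical n (f : {ffun 'I_n -> 'I_n}) : f \in bridges n ->
  empirical (occ R n (fseq f)).
Proof.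
rewrite inE => /eqP Hf; have Hs := size_fseq f; split.
- by move=> k; rewrite occ_ge0 occ_le1.
- by move=> K; exact: series_occ_le1.
- by move=> i; apply: series_occ_ge => //; rewrite -{2}Hf.
Qed.

Lemma occ_prob j (e eta : R) : 0 < e -> 0 < eta ->
  \forall m \near \oo,
    avgB_ w (nn m) (fun s => (e < `|occ R (nn m) s j - pi j|)%R%:R) <= eta.
Proof.
move=> e0 eta0.
have [k1 [k1_gt1 wk1]] := Hw.2.2.
(* The first bound implies [mean_close]; the second makes the failure probabilities of the mean
   conditions sum to at most eta / 2. The other half is spent on the balance conditions. *)
pose ep i : R := Num.min i.+1%:R^-1 (eta / 2 * (2^-1) ^+ i.+1).
have ep0 i : 0 < ep i.
  by rewrite lt_min invr_gt0 ltr0n /= !mulr_gt0 ?exprn_gt0 ?invr_gt0.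
have {}/choice[L HL] : forall i, exists L, (i <= L)%N /\ \forall m \near \oo, avgB_ w (nn m)
    (fun s => (ep i < `|series (fun k => k%:R * occ R (nn m) s k) L.+1 - mu nu|)%R%:R) <= ep i.
  by move=> i; have [L ? ?] := mean_tail Hw Hd HOm i (ep0 i); exists L.
have Lge i : (i <= L i)%N by case: (HL i).
have [I HI] := finitely_many_conditions Hw Ht k1_gt1 wk1 Lge j e0.
pose B m := \sum_(i < I) \sum_(k < i.+1) avgB_ w (nn m)
   (fun s => (i.+1%:R^-1 < `|balance w (word_l k1 k) (word_r k1 k) (occ R (nn m) s)|)%R%:R).
have Bcvg : B @ \oo --> (0 : R).
  have -> : (0 : R) = \sum_(i < I) \sum_(k < i.+1) 0 by rewrite big1 // => i _; rewrite big1.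
  apply: cvg_sumr => i; apply: cvg_sumr => k; apply: balance_cvg => //.
  - exact: size_word.
  - exact: sumn_word.
  - exact: (span_cvg Hw Hd).
have eta20 : 0 < eta / 2 by rewrite divr_gt0.
near=> m.
have Bm : B m <= eta / 2 by apply: ltW; near: m; exact: (cvgr_lt 0 Bcvg).
have Mm : forall i, (i < I)%N -> avgB_ w (nn m)
    (fun s => (ep i < `|series (fun k => k%:R * occ R (nn m) s k) (L i).+1 - mu nu|)%R%:R) <= ep i.
  by near: m; apply: near_forall_lt => i; case: (HL i).
have -> : eta = eta / 2 + eta / 2 by lra.
have S2 : \sum_(i < I) ep i <= eta / 2.
  apply: le_trans (_ : \sum_(i < I) eta / 2 * (2^-1) ^+ i.+1 <= _).
    by apply: ler_sum => i _; rewrite ge_min lexx orbT.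
  rewrite -big_distrr /= -[leRHS]mulr1 ler_wpM2l ?(ltW eta20) //.
  suff -> : \sum_(i < I) (2^-1) ^+ i.+1 = 1 - (2^-1) ^+ I :> R.
    by rewrite gerBl exprn_ge0.
  elim: (I) => [|i IH]; first by rewrite big_ord0 expr0 subrr.
  by rewrite big_ord_recr /= IH !exprS; field.
apply: le_trans (lerD S2 Bm).
apply: le_trans (_ : \sum_(i < I) avgB_ w (nn m)
    (fun s => (ep i < `|series (fun k => k%:R * occ R (nn m) s k) (L i).+1 - mu nu|)%R%:R) + B m <= _).
  rewrite /B /avgB_ -avg_sum; under [X in _ + X]eq_bigr do rewrite -avg_sum.
  rewrite -avg_sum -avgD; apply: ler_avg; first exact: fwt_ge0.
  move=> f fB _; set A1 := \sum_(i < I) _; set A2 := \sum_(i < I) _.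
  have A10 : 0 <= A1 by apply: sumr_ge0.
  have A20 : 0 <= A2 by apply: sumr_ge0 => i _; apply: sumr_ge0.
  case: ltP => //= He; last by rewrite addr_ge0.
  rewrite leNgt; apply/negP => Hlt.
  have A1z : A1 < 1 by move: Hlt; lra.
  have A2z : A2 < 1 by move: Hlt; lra.
  move: He; rewrite ltNge => /negP; apply; apply: HI; first exact: fseq_empirical.
  move=> i iI; split.
    rewrite /mean_close; apply: le_trans (_ : ep i <= _); last by rewrite ge_min lexx.
    rewrite leNgt; apply/negP => Hb; move: A1z; rewrite ltNge => /negP; apply.
    rewrite /A1 (bigD1 (Ordinal iI)) //= Hb lerDl.
    by apply: sumr_ge0.
  move=> k ki; rewrite /balance_close leNgt; apply/negP => Hb.
  move: A2z; rewrite ltNge => /negP; apply.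
  have ki' : (k < i.+1)%N by [].
  rewrite /A2 (bigD1 (Ordinal iI)) //= (bigD1 (Ordinal ki')) //= Hb -addrA lerDl.
  by rewrite addr_ge0 //; apply: sumr_ge0 => ? _; rewrite ?sumr_ge0.
by rewrite lerD2r; apply: ler_sum => i _; apply: Mm.
Unshelve. all: by end_near. Qed.

Lemma prod_diff_le (p q : nat -> R) (c : seq nat) :
  (forall k, 0 <= p k <= 1) -> (forall k, 0 <= q k <= 1) ->
  `|\prod_(k <- c) p k - \prod_(k <- c) q k| <= \sum_(k <- c) `|p k - q k|.
Proof.
move=> Hp Hq; elim: c => [|k c IH]; first by rewrite !big_nil subrr normr0.
rewrite !big_cons.
have -> : p k * \prod_(j <- c) p j - q k * \prod_(j <- c) q j =
  (p k - q k) * \prod_(j <- c) p j + q k * (\prod_(j <- c) p j - \prod_(j <- c) q j) by ring.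
apply: le_trans (ler_normD _ _) _; rewrite !normrM.
have P1 : `|\prod_(j <- c) p j| <= 1.
  rewrite ger0_norm; last by apply: prodr_ge0 => j _; case/andP: (Hp j).
  elim: (c) => [|j c' IHc]; first by rewrite big_nil.
  rewrite big_cons; case/andP: (Hp j) => p0 p1.
  by apply: mulr_ile1 => //; apply: prodr_ge0 => i _; case/andP: (Hp i).
apply: lerD; first by rewrite -[leRHS]mulr1 ler_wpM2l.
apply: le_trans IH; rewrite -[leRHS]mul1r ler_wpM2r //.
by case/andP: (Hq k) => q0 q1; rewrite ger0_norm.
Qed.

Lemma xi_law_ge0 k : 0 <= pi k.
Proof.
have [[[c c0 piE] _ _ _ _] [tau0 _]] := offspring_mean Hw Ht.
by rewrite /pi piE divr_ge0 ?mulr_ge0 ?exprn_ge0 // ltW.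
Qed.

Lemma xi_law_sum_le1 n : series pi n <= 1.
Proof.
have [[_ pi1 _ _ _] _] := offspring_mean Hw Ht.
rewrite -(cvg_lim _ pi1) //; apply: nondecreasing_cvgn_le.
  by apply: nondecreasing_series => k _ _; exact: xi_law_ge0.
by apply/cvg_ex; eexists; exact: pi1.
Qed.

Lemma xi_law_le1 k : pi k <= 1.
Proof.
apply: le_trans (xi_law_sum_le1 k.+1); rewrite seriesEnat /= big_nat_recr //= lerDr.
by apply: sumr_ge0 => i _; exact: xi_law_ge0.
Qed.

Lemma avgB_cst (a : R) : \forall m \near \oo, avgB_ w (nn m) (fun=> a) = a.
Proof.
have [M HM] := total_bridges_gt0 Hw Hd.
by exists M => // m /= /HM H; rewrite /avgB_ avg_cst.
Qed.

Lemma occ_L1 k : (fun m => avgB_ w (nn m) (fun s => `|occ R (nn m) s k - pi k|)) @ \oo --> (0 : R).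
Proof.
apply/cvgrPdist_le => e e0; have e20 : 0 < e / 2 by rewrite divr_gt0.
near=> m; rewrite sub0r normrN ger0_norm; last by apply: avg_ge0 => //; exact: fwt_ge0.
have H1 : avgB_ w (nn m) (fun s => (e / 2 < `|occ R (nn m) s k - pi k|)%R%:R) <= e / 2.
  by near: m; exact: occ_prob.
have -> : e = e / 2 + e / 2 by lra.
have H2 : avgB_ w (nn m) (fun=> e / 2) <= e / 2.
  by apply: avg_cst_le; [exact: fwt_ge0 | exact: ltW].
apply: le_trans (lerD H2 H1); rewrite /avgB_ -avgD; apply: ler_avg; first exact: fwt_ge0.
move=> f fB _; case: ltP => /= H; last by rewrite addr0.
have [ok _ _] := fseq_empirical fB; have /andP[a0 a1] := ok k.
have := xi_law_ge0 k; have := xi_law_le1 k => p1 p0.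
have : `|occ R (nn m) (fseq f) k - pi k| <= 1 by rewrite ler_norml; apply/andP; split; lra.
have := e20; set x := `|_|; lra.
Unshelve. all: by end_near. Qed.

Definition word_law (c : seq nat) : R := \prod_(k <- c) pi k.

Theorem prefix_prob_cvg (c : seq nat) :
  (fun m => prefix_prob w (nn m) c) @ \oo --> word_law c.
Proof.
have C1 : (fun m => \sum_(k <- c) avgB_ w (nn m) (fun s => `|occ R (nn m) s k - pi k|)
   + (1 - inj_ratio R (nn m) (size c))) @ \oo --> (0 : R).
  rewrite -[X in _ --> X]addr0; apply: cvgD.
    have C0 := cvg_sumr (r := c) _ occ_L1.
    by rewrite big1 // in C0; exact: C0.
  rewrite -[X in _ --> X](subrr 1); apply: cvgB; first exact: cvg_cst.
  exact: (cvg_comp _ _ (span_cvg Hw Hd) (@inj_ratio_cvg R (size c))).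
apply/cvgrPdist_le => e e0; near=> m.
have Hm : \sum_(k <- c) avgB_ w (nn m) (fun s => `|occ R (nn m) s k - pi k|)
   + (1 - inj_ratio R (nn m) (size c)) <= e.
  by apply: ltW; near: m; exact: (cvgr_lt 0 C1).
apply: le_trans Hm.
have cn : (size c <= nn m)%N by near: m; exact: (span_ge Hw Hd).
have n0 : (0 < nn m)%N by rewrite /nn addn1.
have H1 := avg_prod_occ w0 cn n0.
have cst : avgB_ w (nn m) (fun=> word_law c) = word_law c by near: m; exact: avgB_cst.
rewrite distrC -{1}cst.
have -> : prefix_prob w (nn m) c - avgB_ w (nn m) (fun=> word_law c) =
  (avgB_ w (nn m) (fun s => \prod_(k <- c) occ R (nn m) s k) - avgB_ w (nn m) (fun=> word_law c))
  - (avgB_ w (nn m) (fun s => \prod_(k <- c) occ R (nn m) s k) - prefix_prob w (nn m) c) by ring.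
apply: le_trans (ler_normB _ _) _; apply: lerD H1.
rewrite /avgB_ -avgB -avg_sum; apply: le_trans (ler_norm_avg _ _ _) _; first exact: fwt_ge0.
apply: ler_avg; first exact: fwt_ge0.
move=> f fB _; apply: prod_diff_le; first by case: (fseq_empirical fB).
by move=> k; rewrite xi_law_ge0 xi_law_le1.
Unshelve. all: by end_near. Qed.

End PrefixLimit.

Lemma sum_word_dfs (V : nmodType) n (S : {set word n}) (F : seq nat -> V) : is_ptree S ->
  \sum_(x in S) F (wval x) = \sum_(v <- dfs S) F v.
Proof. by move=> HS; rewrite (perm_big _ (perm_dfs HS)) big_map big_enum. Qed.

Lemma sum_nonroot (V : nmodType) n (S : {set word n}) (F : seq nat -> V) : is_ptree S ->
  \sum_(x in S | wval x != [::]) F (wval x) =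
  \sum_(v <- dfs S) \sum_(i < outdeg S v) F (rcons v i).
Proof.
move=> HS; rewrite big_mkcondr /=.
rewrite (sum_word_dfs (fun v => if v != [::] then F v else 0) HS) -big_mkcond /=.
rewrite -big_filter (perm_big _ (perm_children_dfs HS)) big_allpairs_dep /=.
apply: eq_bigr => v _.
have -> : iota 0 (outdeg S v) = index_iota 0 (outdeg S v) by rewrite /index_iota subn0.
by rewrite big_mkord.
Qed.

Lemma cvg_exprn (R : realType) (T : Type) (F : set_system T) (FF : Filter F)
  (f : T -> R) (a : R) k : f @ F --> a -> (fun x => f x ^+ k) @ F --> a ^+ k.
Proof.
move=> fa; have c : {for a, continuous (fun x : R => x ^+ k)} by exact: exprn_continuous.
exact: (continuous_cvg _ c fa).
Qed.

(** * Total mass and mean size of the Galton-Watson tree *)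

Section Masses.
Variables (R : realType) (w : nat -> R) (tau nu : R).
Hypotheses (Hw : weight_seq w) (Ht : type_II_or_III w tau nu).

Let pi := xi_law w tau.
Let law := word_law w tau.
Let pi0 : forall k, 0 <= pi k. Proof. exact: xi_law_ge0 Hw Ht. Qed.

Lemma word_law_cat c c' : law (c ++ c') = law c * law c'.
Proof. exact: big_cat. Qed.

Lemma word_law_cons k c : law (k :: c) = pi k * law c.
Proof. exact: big_cons. Qed.

Lemma word_law_ge0 c : 0 <= law c.
Proof. exact: prodr_ge0. Qed.

Definition family_mass (T : seq (seq nat)) : R := \sum_(t <- T) law t.
Definition family_size (T : seq (seq nat)) : R := \sum_(t <- T) law t * (size t)%:R.

Lemma forests_mass T k : family_mass (forests T k) = family_mass T ^+ k.
Proof.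
elim: k => [|k IH]; first by rewrite /family_mass big_seq1 /law /word_law big_nil expr0.
rewrite exprS -IH /family_mass /= big_allpairs_dep /= big_distrl /=.
apply: eq_bigr => t _; rewrite big_distrr /=; apply: eq_bigr => f _.
exact: word_law_cat.
Qed.

Lemma forests_size T k :
  family_size (forests T k) = k%:R * family_mass T ^+ k.-1 * family_size T.
Proof.
elim: k => [|k IH]; first by rewrite /family_size big_seq1 /= mulr0 !mul0r.
have -> : family_size (forests T k.+1) =
    family_size T * family_mass (forests T k) + family_mass T * family_size (forests T k).
  rewrite {1}/family_size /= big_allpairs_dep /= /family_size /family_mass.
  rewrite !big_distrl /= -big_split /=; apply: eq_bigr => t _.
  rewrite !big_distrr /= -big_split /=; apply: eq_bigr => f _.
  by rewrite word_law_cat size_cat natrD; ring.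
rewrite IH forests_mass -natr1 /=; case: k {IH} => [|k]; first by rewrite !mul0r mulr0 add0r addr0; ring.
by rewrite /= exprS; ring.
Qed.

Let q h := family_mass (trees h).
Let e h := family_size (trees h).

Lemma trees_massS h : q h.+1 = \sum_(0 <= k < h.+1) pi k * q h ^+ k.
Proof.
rewrite /q {1}/family_mass treesS big_allpairs_dep; apply: eq_bigr => k _.
rewrite -forests_mass /family_mass big_distrr /=; apply: eq_bigr => f _.
exact: word_law_cons.
Qed.

Lemma trees_sizeS h : e h.+1 = \sum_(0 <= k < h.+1)
  pi k * (q h ^+ k + k%:R * q h ^+ k.-1 * e h).
Proof.
rewrite /e {1}/family_size treesS big_allpairs_dep; apply: eq_bigr => k _.
rewrite -forests_size -forests_mass /family_mass /family_size -big_split big_distrr /=.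
apply: eq_bigr => f _; rewrite word_law_cons -natr1; ring.
Qed.

Lemma trees_mass_ge0 h : 0 <= q h.
Proof. by apply: sumr_ge0 => t _; exact: word_law_ge0. Qed.

Lemma trees_size_ge0 h : 0 <= e h.
Proof. by apply: sumr_ge0 => t _; rewrite mulr_ge0 // word_law_ge0. Qed.

Lemma trees_mass_le1 h : q h <= 1.
Proof.
elim: h => [|h IH]; first by rewrite /q /family_mass big_nil.
rewrite trees_massS; apply: le_trans (xi_law_sum_le1 Hw Ht h.+1).
rewrite seriesEnat /=; apply: ler_sum => k _.
by rewrite -[leRHS]mulr1 ler_wpM2l ?pi0 // exprn_ile1 // trees_mass_ge0.
Qed.

Lemma trees_mass_nd : nondecreasing_seq q.
Proof.
apply/nondecreasing_seqP; elim => [|h IH].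
  by rewrite {1}/q /family_mass big_nil trees_mass_ge0.
rewrite !trees_massS [leRHS]big_nat_recr //= -[leLHS]addr0; apply: lerD.
  apply: ler_sum => k _; rewrite ler_wpM2l ?pi0 //.
  by rewrite -trees_massS lerXn2r ?nnegrE ?trees_mass_ge0.
by rewrite mulr_ge0 ?pi0 // exprn_ge0 // -trees_massS trees_mass_ge0.
Qed.

Lemma trees_size_nd : nondecreasing_seq e.
Proof.
apply/nondecreasing_seqP; elim => [|h IH].
  by rewrite {1}/e /family_size big_nil trees_size_ge0.
rewrite [leLHS]trees_sizeS trees_sizeS [leRHS]big_nat_recr //= -[leLHS]addr0; apply: lerD.
  apply: ler_sum => k _; rewrite ler_wpM2l ?pi0 //.
  have qq : q h <= q h.+1 by apply: trees_mass_nd.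
  apply: lerD; first by rewrite lerXn2r ?nnegrE ?trees_mass_ge0.
  apply: ler_pM; rewrite ?mulr_ge0 ?exprn_ge0 ?trees_mass_ge0 ?trees_size_ge0 //.
  by rewrite ler_wpM2l // lerXn2r ?nnegrE ?trees_mass_ge0.
rewrite mulr_ge0 ?pi0 // addr_ge0 ?mulr_ge0 ?exprn_ge0 ?trees_mass_ge0 ?trees_size_ge0 //.
Qed.

Lemma one_sub_pow (x : R) k : 0 <= x <= 1 -> 1 - k%:R * (1 - x) <= x ^+ k.
Proof.
move=> /andP[x0 x1]; elim: k => [|k IH]; first by rewrite mul0r subr0 expr0.
have H : x ^+ k <= 1 by rewrite exprn_ile1.
have K : (x ^+ k) * (1 - x) <= 1 - x by rewrite -[leRHS]mul1r ler_wpM2r // subr_ge0.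
rewrite exprS -natr1; nra.
Qed.

(** Almost sure extinction. In the limit of the recursion, x^k >= 1 - k(1 - x) gives 1 - mu (1 - q)
    <= q, and mu < 1 forces q = 1. *)
Lemma trees_mass_cvg : q @ \oo --> (1 : R).
Proof.
have [[_ pi1 pim mu0 mu1] _] := offspring_mean Hw Ht.
have Cq : cvgn q.
  apply: nondecreasing_is_cvgn; first exact: trees_mass_nd.
  by exists 1 => _ [n _ <-]; exact: trees_mass_le1.
set qs := limn q in Cq *.
have qs1 : qs <= 1 by apply: limr_le => //; apply: nearW; exact: trees_mass_le1.
have qs0 : 0 <= qs by apply: limr_ge => //; apply: nearW; exact: trees_mass_ge0.
have H K : series pi K - series (fun k => k%:R * pi k) K * (1 - qs) <= qs.
  apply: le_trans (_ : \sum_(0 <= k < K) pi k * qs ^+ k <= _).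
    rewrite !seriesEnat /= big_distrl /= -sumrB; apply: ler_sum => k _.
    have := @one_sub_pow qs k; rewrite qs0 qs1 => /(_ isT) H.
    have := ler_wpM2l (pi0 k) H; nra.
  have C1 : (fun h => \sum_(0 <= k < K) pi k * q h ^+ k) @ \oo --> \sum_(0 <= k < K) pi k * qs ^+ k.
    apply: cvg_sumr => k; apply: cvgMl_tmp.
    exact: cvg_exprn.
  have C2 : (fun h => q h.+1) @ \oo --> qs by rewrite cvg_shiftS.
  apply: (ler_cvg_to C1 C2); near=> h.
  have hK : (K <= h.+1)%N by apply: leqW; near: h; exact: nbhs_infty_ge.
  rewrite trees_massS (big_cat_nat _ hK) //=.
  rewrite lerDl; apply: sumr_ge0 => k _.
  by rewrite mulr_ge0 ?pi0 // exprn_ge0 // trees_mass_ge0.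
have : 1 - mu nu * (1 - qs) <= qs.
  have C : (fun K => series pi K - series (fun k => k%:R * pi k) K * (1 - qs)) @ \oo -->
    1 - mu nu * (1 - qs).
    by apply: cvgB => //; apply: cvgMr_tmp.
  by apply: (ler_cvg_to C (cvg_cst _)); apply: nearW.
move=> HH; have E : qs = 1 by nra.
by rewrite -E.
Unshelve. all: by end_near. Qed.

(** If the truncated mean sizes stayed below B, their limit e would satisfy 1 + mu e <= e, that is e
    >= 1 / (1 - mu). *)
Lemma trees_size_unbounded B : B < (1 - mu nu)^-1 -> exists h, B < e h.
Proof.
have [[_ pi1 pim mu0 mu1] _] := offspring_mean Hw Ht.
move=> HB; apply: contrapT => Hno.
have eB h : e h <= B by rewrite leNgt; apply/negP => Hh; apply: Hno; exists h.
have Ce : cvgn e.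
  apply: nondecreasing_is_cvgn; first exact: trees_size_nd.
  by exists B => _ [n _ <-].
set es := limn e in Ce *.
have esB : es <= B by apply: limr_le => //; apply: nearW.
have H K : series pi K + series (fun k => k%:R * pi k) K * es <= es.
  have C1 : (fun h => \sum_(0 <= k < K) pi k * (q h ^+ k + k%:R * q h ^+ k.-1 * e h)) @ \oo -->
     \sum_(0 <= k < K) pi k * (1 ^+ k + k%:R * 1 ^+ k.-1 * es).
    apply: cvg_sumr => k; apply: cvgMl_tmp; apply: cvgD.
      exact: cvg_exprn trees_mass_cvg.
    apply: cvgM => //; apply: cvgMl_tmp.
    exact: cvg_exprn trees_mass_cvg.
  have C2 : (fun h => e h.+1) @ \oo --> es by rewrite cvg_shiftS.
  rewrite [leLHS](_ : _ = \sum_(0 <= k < K) pi k * (1 ^+ k + k%:R * 1 ^+ k.-1 * es)); last first.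
    rewrite !seriesEnat /= big_distrl -big_split /=; apply: eq_bigr => k _.
    by rewrite !expr1n; ring.
  apply: (ler_cvg_to C1 C2); near=> h.
  have hK : (K <= h.+1)%N by apply: leqW; near: h; exact: nbhs_infty_ge.
  rewrite trees_sizeS (big_cat_nat _ hK) //=.
  rewrite lerDl; apply: sumr_ge0 => k _.
  by rewrite mulr_ge0 ?pi0 // addr_ge0 ?mulr_ge0 ?exprn_ge0 ?trees_mass_ge0 ?trees_size_ge0.
have : 1 + mu nu * es <= es.
  have C : (fun K => series pi K + series (fun k => k%:R * pi k) K * es) @ \oo --> 1 + mu nu * es.
    by apply: cvgD => //; apply: cvgMr_tmp.
  by apply: (ler_cvg_to C (cvg_cst _)); apply: nearW.
move=> HH.
have : (1 - mu nu)^-1 <= es.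
  by rewrite -[leLHS]mul1r ler_pdivrMr ?subr_gt0 //; nra.
by move/(lt_le_trans HB)/lt_le_trans/(_ esB); rewrite ltxx.
Unshelve. all: by end_near. Qed.

(** For a parent with k children there are k possible numbers a of elder siblings, each of
    probability nearly pi_k; the total approaches the sum of k pi_k, which is mu. *)
Lemma parent_words_mass (eta : R) : 0 < eta -> exists K G,
  [/\ uniq G, all (parent_word K) G & mu nu - eta <= \sum_(u <- G) law u].
Proof.
have [[_ pi1 pim mu0 mu1] _] := offspring_mean Hw Ht.
move=> eta0; have e2 : 0 < eta / 2 by rewrite divr_gt0.
have [K HK] : exists K, mu nu - eta / 2 < series (fun k => k%:R * pi k) K.+1.
  have Hlt : mu nu - eta / 2 < mu nu by rewrite ltrBlDr ltrDl.
  have [K _ HK] := cvgr_gt _ pim _ Hlt.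
  by exists K; apply: HK => /=; exact: leqnSn.
have C : (fun h => \sum_(0 <= k < K.+1) pi k * \sum_(0 <= a < k) q h ^+ a) @ \oo -->
   \sum_(0 <= k < K.+1) pi k * \sum_(0 <= a < k) 1 ^+ a.
  apply: cvg_sumr => k; apply: cvgMl_tmp; apply: cvg_sumr => a.
  exact: cvg_exprn trees_mass_cvg.
have EK : \sum_(0 <= k < K.+1) pi k * \sum_(0 <= a < k) 1 ^+ a = series (fun k => k%:R * pi k) K.+1.
  rewrite seriesEnat /=; apply: eq_bigr => k _.
  rewrite (eq_bigr (fun=> 1)); last by move=> a _; rewrite expr1n.
  by rewrite big_const_nat subn0 iter_addr_0 mulrC mulr_natl.
rewrite EK in C.
have [h _ /(_ h (leqnn _)) /= Hh] := cvgr_gt _ C _ HK.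
exists K, (parent_words (trees h) K); split.
- by apply: parent_words_uniq; [exact: trees_uniq | exact: trees_code].
- exact/parent_words_ok/trees_code.
apply: le_trans (_ : mu nu - eta / 2 <= _); first by lra.
apply: le_trans (ltW Hh) _; rewrite le_eqVlt; apply/orP; left; apply/eqP.
rewrite /parent_words -[iota 0 K.+1]/(index_iota 0 K.+1) big_allpairs_dep.
apply: eq_bigr => k _.
rewrite big_allpairs_dep /= big_distrr /=.
have -> : iota 0 k = index_iota 0 k by rewrite /index_iota subn0.
apply: eq_bigr => a _; rewrite -forests_mass /family_mass big_distrr /=.
by apply: eq_bigr => f _; rewrite word_law_cons.
Qed.

End Masses.

(** * Neighbours below a vertex of large outdegree *)

Definition parent (v : seq nat) : seq nat := take (size v).-1 v.

Lemma parent_rcons v i : parent (rcons v i) = v.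
Proof. exact: take_rcons_belast. Qed.

Section BigParent.
Variables (R : realType).

Definition big_parent (Om : R) n (S : {set word n}) (v : seq nat) : bool :=
  (v != [::]) && (Om < (outdeg S (parent v))%:R).

Definition big_middle (Om : R) (M : nat) n (S : {set word n}) (v : seq nat) : bool :=
  [&& big_parent Om S v, (M <= last 0 v)%N & (last 0 v + M < outdeg S (parent v))%N].

Variables (w : nat -> R) (n : nat).
Hypothesis w0 : forall k, 0 <= w k.

Lemma tree_wt_ge0 (S : {set word n}) : 0 <= tree_wt w S.
Proof. exact: prodr_ge0. Qed.

Lemma ler_avgT (F G : {set word n} -> word n -> R) :
  (forall S, is_ptree S -> \sum_(x in S) F S x <= \sum_(x in S) G S x) ->
  avgT w F <= avgT w G.
Proof.
move=> H; rewrite /avgT /avg !sum_pointed_trees; apply: ler_wpM2r.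
  by rewrite invr_ge0; apply: sumr_ge0 => q _; exact: tree_wt_ge0.
by apply: ler_sum => S HS; rewrite -!mulr_sumr ler_wpM2l ?tree_wt_ge0 // H.
Qed.

Lemma avgT_cst_le (a : R) : 0 <= a -> avgT w (fun (S : {set word n}) _ => a) <= a.
Proof. by move=> a0; apply: avg_cst_le => // q; exact: tree_wt_ge0. Qed.

(** An occurrence of u ++ c at y is sent to the child of y whose index is the number of trees in u.
    That child gives back y and the index, and codes of forests with that many trees are
    prefix-free, so u is recovered too. *)
Lemma count_parent_words (Om : R) (K : nat) (c : seq nat) (G : seq (seq nat)) (S : {set word n}) :
  is_ptree S -> uniq G -> all (parent_word K) G -> K%:R <= Om ->
  \sum_(u <- G) \sum_(y in S) (prefix (u ++ c) (rotcode S y))%:R <=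
  \sum_(x in S) (prefix c (rotcode S x) && ~~ big_parent Om S (wval x))%:R :> R.
Proof.
move=> HS uG /allP aG KOm.
have sz (Q : pred (seq nat)) : \sum_(v <- dfs S) (Q v)%:R = (size [seq v <- dfs S | Q v])%:R :> R.
  by rewrite size_filter -sum1_count natr_sum [RHS]big_mkcond /=; apply: eq_bigr => v _; case: (Q v).
rewrite (sum_word_dfs (fun v => (prefix c (rotcode_at S v) && ~~ big_parent Om S v)%:R) HS) sz.
under eq_bigr do rewrite (sum_word_dfs (fun v => (prefix (_ ++ c) (rotcode_at S v))%:R) HS) sz.
rewrite -natr_sum ler_nat.
pose fa (u : seq nat) := forest_size (behead u).
have -> : (\sum_(u <- G) size [seq v <- dfs S | prefix (u ++ c) (rotcode_at S v)])%N =
   size [seq rcons y (fa u) | u <- G, y <- [seq v <- dfs S | prefix (u ++ c) (rotcode_at S v)]].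
  by rewrite size_allpairs_dep sumnE big_map.
apply: uniq_leq_size.
  apply: allpairs_uniq_key => //; first by move=> u _; rewrite filter_uniq // dfs_uniq.
  move=> a b a' b' Ha Hb Ha' Hb' /eqP; rewrite eqseq_rcons => /andP[/eqP E1 /eqP E2]; subst b'.
  suff Ea : a = a' by rewrite Ea.
  rewrite !mem_filter in Hb Hb'; case/andP: Hb => Hp _; case/andP: Hb' => Hp' _.
  have Ga := aG _ Ha; have Ga' := aG _ Ha'.
  case: a Ha Hp E2 Ga => // k g _ Hp E2 Ga; case: a' Ha' Hp' E2 Ga' => // k' g' _ Hp' E2 Ga'.
  move: Hp Hp' E2 Ga Ga'.
  rewrite /fa /= => /prefixP[r ->] /prefixP[r' [-> E]] E2 /and3P[_ _ H1] /and3P[_ _ H2].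
  rewrite E2 in H1; rewrite -!catA in E.
  by have [-> _] := forest_code_inj H1 H2 E.
move=> _ /allpairsPdep[u [y [Hu + ->]]]; rewrite mem_filter => /andP[Hp Hy].
have := aG _ Hu; case: u Hp {Hu} => // k g Hp /and3P[kK ak Hg].
have Hi : (index y (dfs S) < n)%N by rewrite -[X in (_ < X)%N](size_dfs HS) index_mem.
have [] := read_parent HS Hi Hp Hg ak; rewrite nth_index // => H1 H2 H3.
rewrite mem_filter H3 mem_dfs // H2 /= andbT negb_and parent_rcons H1 -leNgt.
by apply/orP; right; apply: le_trans KOm; rewrite ler_nat.
Qed.

Lemma sum_ord_filter (D : nat) (Q : pred nat) :
  (\sum_(i < D) Q i)%N = size [seq i <- iota 0 D | Q i].
Proof.
rewrite size_filter -sum1_count [RHS]big_mkcond /=.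
have -> : iota 0 D = index_iota 0 D by rewrite /index_iota subn0.
by rewrite big_mkord; apply: eq_bigr => i _; case: (Q i).
Qed.

Lemma count_edge (D M : nat) :
  (\sum_(i < D) ((i < M) || (D <= i + M)) <= 2 * M)%N.
Proof.
apply: (@leq_trans (\sum_(i < D) ((i < M)%N + (D <= i + M)%N))).
  by apply: leq_sum => i _; case: (i < M)%N; case: (D <= i + M)%N.
rewrite big_split /= mul2n -addnn (sum_ord_filter D (fun i => i < M)%N).
rewrite (sum_ord_filter D (fun i => D <= i + M)%N); apply: leq_add.
  rewrite -[X in (_ <= X)%N](size_iota 0 M).
  apply: uniq_leq_size; first by rewrite filter_uniq // iota_uniq.
  by move=> i; rewrite mem_filter !mem_iota /= => /andP[].
rewrite -[X in (_ <= X)%N](size_iota (D - M) M).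
apply: uniq_leq_size; first by rewrite filter_uniq // iota_uniq.
by move=> i; rewrite mem_filter !mem_iota /= => /andP[]; lia.
Qed.

Lemma sum_outdeg (S : {set word n}) : is_ptree S ->
  (\sum_(v <- dfs S) outdeg S v < n)%N.
Proof.
move=> HS; have := sumn_tree_code HS; rewrite /tree_code sumnE big_map.
by move=> E; rewrite -[X in (_ < X)%N]E.
Qed.

(** A vertex of outdegree D > Om has at most 2M children near an end of its sibling list, which is
    at most 2M / Om times D; the outdegrees sum to less than n. *)
Lemma avg_big_edge (Om : R) (M : nat) : 0 < Om ->
  avgT w (fun (S : {set word n}) x => (big_parent Om S (wval x) && ~~ big_middle Om M S (wval x))%:R)
  <= (2 * M)%N%:R / Om.
Proof.
move=> Om0; apply: le_trans (avgT_cst_le _); last by rewrite divr_ge0 ?ler0n // ltW.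
apply: ler_avgT => S HS; rewrite sumr_const (ptree_card HS).
pose F v : R := (big_parent Om S v && ~~ big_middle Om M S v)%:R.
have -> : \sum_(x in S) F (wval x) = \sum_(x in S | wval x != [::]) F (wval x).
  rewrite big_mkcondr /=; apply: eq_bigr => x _.
  by case: ifPn => //; rewrite negbK /F /big_parent => ->.
rewrite (sum_nonroot F HS).
apply: le_trans (_ : \sum_(v <- dfs S) (2 * M)%N%:R / Om * (outdeg S v)%:R <= _); last first.
  rewrite -mulr_sumr -natr_sum -[leRHS]mulr_natr ler_wpM2l //.
    by rewrite divr_ge0 ?ler0n // ltW.
  by rewrite ler_nat ltnW // sum_outdeg.
apply: ler_sum => v _.
have [vOm|vOm] := leP (outdeg S v)%:R Om.
  rewrite big1 ?mulr_ge0 ?invr_ge0 ?ler0n ?(ltW Om0) // => i _.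
  by rewrite /F /big_parent parent_rcons ltNge vOm andbF.
apply: le_trans (_ : (2 * M)%N%:R <= _); last first.
  by rewrite mulrAC ler_pdivlMr // ler_wpM2l ?ler0n // ltW.
apply: le_trans (_ : (\sum_(i < outdeg S v) ((i < M) || (outdeg S v <= i + M)))%N%:R <= _); last first.
  by rewrite ler_nat count_edge.
rewrite natr_sum; apply: ler_sum => i _; rewrite ler_nat.
rewrite /big_middle parent_rcons last_rcons; case: (big_parent _ _ _) => //=.
by rewrite negb_and -ltnNge -leqNgt.
Qed.

End BigParent.

(** * Words read below a vertex of large outdegree *)

Section MainLower.
Variables (R : realType) (w : nat -> R) (tau nu : R) (d : nat) (Om : nat -> R).
Hypotheses (Hw : weight_seq w) (Ht : type_II_or_III w tau nu).
Hypotheses (Hd : is_span w d) (HOm : Omega_ok w d (mu nu) Om).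

Let w0 : forall k, 0 <= w k. Proof. by case: Hw. Qed.
Let nn (m : nat) := (d * m + 1)%N.
Let law := word_law w tau.

Lemma sum_big_parent n (S : {set word n}) (b : R) : is_ptree S ->
  \sum_(x in S) (big_parent b S (wval x))%:R =
  (\sum_(k < n | b < k%:R) (k * Nk S k)%N%:R) :> R.
Proof.
move=> HS; pose F v : R := (big_parent b S v)%:R.
have -> : \sum_(x in S) F (wval x) = \sum_(x in S | wval x != [::]) F (wval x).
  rewrite big_mkcondr /=; apply: eq_bigr => x _.
  by case: ifPn => //; rewrite negbK /F /big_parent => ->.
rewrite (sum_nonroot F HS).
have E v : \sum_(i < outdeg S v) F (rcons v i) =
   if b < (outdeg S v)%:R then (outdeg S v)%:R else 0.
  rewrite (eq_bigr (fun=> (b < (outdeg S v)%:R)%R%:R)); last first.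
    move=> i _; rewrite /F /big_parent parent_rcons.
    by rewrite -size_eq0 size_rcons.
  by rewrite sumr_const card_ord; case: ifP => _; rewrite ?mul0rn.
under eq_bigr do rewrite E.
have dn v : v \in dfs S -> (outdeg S v < n)%N.
  move=> Hv; apply: leq_ltn_trans (sum_outdeg HS).
  by rewrite (big_rem v) //= leq_addr.
rewrite -(sum_word_dfs (fun v => if b < (outdeg S v)%:R then (outdeg S v)%:R else 0) HS).
have H x : x \in S -> (outdeg S (wval x) < n)%N.
  by move=> Hx; apply: dn; rewrite mem_dfs // mem_inT.
have n0 : (0 < n)%N by apply: leq_ltn_trans (sum_outdeg HS).
pose h (x : word n) : 'I_n := odflt (Ordinal n0) (insub (outdeg S (wval x))).
have hE x : x \in S -> h x = outdeg S (wval x) :> nat.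
  by move=> /H Hx; rewrite /h insubT.
rewrite (partition_big h xpredT) //= [RHS]big_mkcond /=; apply: eq_bigr => k _.
rewrite (eq_bigr (fun=> if b < k%:R then k%:R else 0)); last first.
  by move=> x /andP[Hx /eqP Ek]; have := hE x Hx; rewrite Ek => <-.
case: ifP => _; last by rewrite big1.
rewrite sumr_const /Nk natrM mulr_natr -(cardsE (fun x => _ && _)).
congr (_ *+ _); apply: eq_card => x; rewrite !inE unfold_in.
by case Hx: (x \in S) => //=; rewrite -hE // -val_eqE /=.
Qed.

Lemma avg_big_parent (eta : R) : 0 < eta -> \forall m \near \oo, 1 - mu nu - eta <=
  avgT w (fun (S : {set word (nn m)}) x => (big_parent (Om (nn m)) S (wval x))%:R).
Proof.
move=> eta0; have e2 : 0 < eta / 2 by rewrite divr_gt0.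
have [HO _] := HOm.
have [_ [_ /(_ Om HO (fun n => lexx _) _ e2)[_ H]]] := HOm.
have [M0 HM0] := total_bridges_gt0 Hw Hd.
have [[_ _ _ mu0 mu1] _] := offspring_mean Hw Ht.
have HP : \forall m \near \oo, PrTn w (fun S : {set word (nn m)} => eta / 2 * (nn m)%:R <
  `|(\sum_(k < nn m | Om (nn m) < k%:R) (k * Nk S k)%N%:R) - (1 - mu nu) * (nn m)%:R|) < eta / 2.
  exact: (cvgr_lt 0 H _ e2).
near=> m.
have HPm : PrTn w (fun S : {set word (nn m)} => eta / 2 * (nn m)%:R <
  `|(\sum_(k < nn m | Om (nn m) < k%:R) (k * Nk S k)%N%:R) - (1 - mu nu) * (nn m)%:R|) < eta / 2.
  by near: m; exact: HP.
set n := nn m in HPm *.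
have tot : 0 < \sum_(f in bridges n) fwt w f by apply: HM0; near: m; exact: nbhs_infty_ge.
have n0 : (0 < n)%N by rewrite /n /nn addn1.
have n0' : 0 < n%:R :> R by rewrite ltr0n.
pose Q (S : {set word n}) : bool := eta / 2 * n%:R < 
  `|(\sum_(k < n | Om n < k%:R) (k * Nk S k)%N%:R) - (1 - mu nu) * n%:R|.
have HQ : avgT w (fun S _ => (Q S)%:R) <= eta / 2.
  by rewrite -PrTn_avgT //; exact: ltW.
have cst : avgT w (fun (S : {set word n}) _ => 1 - mu nu - eta / 2) = 1 - mu nu - eta / 2.
  by rewrite /avgT avg_cst // -total_bridges.
apply: le_trans (_ : 1 - mu nu - eta / 2 - avgT w (fun S _ => (Q S)%:R) <= _).
  by move: HQ; set x := avgT _ _; lra.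
have -> : 1 - mu nu - eta / 2 - avgT w (fun S _ => (Q S)%:R) =
    avgT w (fun S _ => 1 - mu nu - eta / 2 - (Q S)%:R).
  by rewrite -[in LHS]cst /avgT -avgB.
apply: ler_avgT => // S HS; rewrite sum_big_parent // sumr_const ptree_card //.
have [|HN] := boolP (Q S) => /=.
  move=> _; apply: le_trans (_ : 0 <= _); last by apply: sumr_ge0.
  by rewrite mulrn_wle0 //; lra.
move: HN; rewrite /Q -leNgt ler_norml => /andP[HN _].
rewrite subr0 -mulr_natr; move: HN; set s := \sum_(_ < _ | _) _; nra.
Unshelve. all: by end_near. Qed.

Let bigp m c := avgT w (fun (S : {set word (nn m)}) x =>
   (prefix c (rotcode S x) && big_parent (Om (nn m)) S (wval x))%:R).

(** Subtract from all occurrences of [c] those preceded by a parent word of a finite family of mass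
    nearly mu. Finiteness allows the limit to be taken term by term, and these parents eventually
    have outdegree at most Omega. *)
Lemma prefix_big_upper (c : seq nat) (eta : R) : 0 < eta ->
  \forall m \near \oo, bigp m c <= law c * (1 - mu nu) + eta.
Proof.
move=> eta0.
have e2 : 0 < eta / 2 by rewrite divr_gt0.
have [K [G [uG aG HG]]] := parent_words_mass Hw Ht e2.
have lc0 : 0 <= law c by exact: word_law_ge0 Hw Ht c.
have lc1 : law c <= 1.
  rewrite /law /word_law; elim: (c) => [|k c' IH]; first by rewrite big_nil.
  rewrite big_cons; apply: mulr_ile1 => //; first exact: xi_law_ge0 Hw Ht k.
    exact: word_law_ge0 Hw Ht c'.
  exact: xi_law_le1 Hw Ht k.
have C : (fun m => prefix_prob w (nn m) c - \sum_(u <- G) prefix_prob w (nn m) (u ++ c)) @ \oo -->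
   law c - \sum_(u <- G) law (u ++ c).
  apply: cvgB; first exact: prefix_prob_cvg Hw Ht Hd HOm c.
  apply: (@cvg_sumr R nat (seq nat) \oo _ G) => u.
  exact: prefix_prob_cvg Hw Ht Hd HOm (u ++ c).
have L : law c - \sum_(u <- G) law (u ++ c) < law c * (1 - mu nu) + eta.
  have -> : \sum_(u <- G) law (u ++ c) = (\sum_(u <- G) law u) * law c.
    by rewrite mulr_suml; apply: eq_bigr => u _; exact: word_law_cat.
  move: HG; rewrite -/law; set s := \sum_(_ <- _) _; nra.
have HC := cvgr_lt _ C _ L.
near=> m.
apply: (@le_trans _ _ (prefix_prob w (nn m) c - \sum_(u <- G) prefix_prob w (nn m) (u ++ c))); last first.
  by apply: ltW; near: m; exact: HC.
rewrite lerBrDr.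
have -> : prefix_prob w (nn m) c =
   avgT w (fun (S : {set word (nn m)}) x => (prefix c (rotcode S x))%:R).
  exact/esym/(avgT_rotcode w (nn m) (fun s => (prefix c s)%:R)).
have -> : \sum_(u <- G) prefix_prob w (nn m) (u ++ c) =
   avgT w (fun (S : {set word (nn m)}) x => \sum_(u <- G) (prefix (u ++ c) (rotcode S x))%:R).
  rewrite /avgT avg_sum; apply: eq_bigr => u _.
  exact/esym/(avgT_rotcode w (nn m) (fun s => (prefix (u ++ c) s)%:R)).
have -> : bigp m c + avgT w (fun (S : {set word (nn m)}) x =>
       \sum_(u <- G) (prefix (u ++ c) (rotcode S x))%:R) =
    avgT w (fun (S : {set word (nn m)}) x => (prefix c (rotcode S x) && big_parent (Om (nn m)) S (wval x))%:R +
       \sum_(u <- G) (prefix (u ++ c) (rotcode S x))%:R).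
  by rewrite /bigp /avgT -avgD.
apply: ler_avgT => // S HS.
have KOm : K%:R <= Om (nn m).
  by near: m; have /cvgryPge := Om_cvg Hw Hd HOm; apply.
have := count_parent_words c HS uG aG KOm; rewrite exchange_big /= => Hc.
rewrite big_split /=; apply: le_trans (lerD (lexx _) Hc) _.
rewrite -big_split /=; apply: ler_sum => x _.
by case: (prefix _ _); case: (big_parent _ _ _); rewrite /= ?addr0 ?add0r.
Unshelve. all: by end_near. Qed.

Lemma word_law_le1 c : law c <= 1.
Proof.
rewrite /law /word_law; elim: c => [|k c' IH]; first by rewrite big_nil.
rewrite big_cons; apply: mulr_ile1 => //; first exact: xi_law_ge0 Hw Ht k.
  exact: word_law_ge0 Hw Ht c'.
exact: xi_law_le1 Hw Ht k.
Qed.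

Definition words K l : seq (seq nat) := forests [seq [:: k] | k <- iota 0 K] l.

Lemma words_mass K l : \sum_(c <- words K l) law c = series (xi_law w tau) K ^+ l.
Proof.
rewrite -[LHS]/(family_mass w tau (words K l)) forests_mass; congr (_ ^+ _).
rewrite /family_mass big_map seriesEnat /=.
have -> : iota 0 K = index_iota 0 K by rewrite /index_iota subn0.
by apply: eq_bigr => k _; rewrite /word_law big_seq1.
Qed.

Lemma mem_words K l c : (c \in words K l) = (size c == l) && all (fun k => k < K)%N c.
Proof.
rewrite /words; elim: l c => [|l IH] c /=; first by rewrite inE size_eq0; case: eqP => // ->.
apply/allpairsP/andP => [[[t f] /= [/mapP[k Hk ->] Hf ->]]|].
  by move: Hk Hf; rewrite IH mem_iota /= => -> /andP[/eqP <- ->].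
case: c => [|k c] /= [] //; rewrite eqSS => sc /andP[kK cK].
exists ([:: k], c) => /=; split => //; last by rewrite IH sc cK.
by apply/mapP; exists k => //; rewrite mem_iota.
Qed.

Lemma words_uniq K l : uniq (words K l).
Proof.
rewrite /words; elim: l => //= l IH; apply: allpairs_uniq => //.
  by rewrite map_inj_uniq ?iota_uniq // => a b [].
move=> [t f] [t' f'] /allpairsP[[a b] /= [/mapP[k _ ->] _ [-> ->]]].
by move=> /allpairsP[[a' b'] /= [/mapP[k' _ ->] _ [-> ->]]] /= [-> ->].
Qed.

Lemma prefix_words n (f : {ffun 'I_n -> 'I_n}) l (V : seq (seq nat)) : uniq V ->
  (forall c, c \in V -> size c = l) ->
  \sum_(c <- V) (prefix c (fseq f))%:R = (take l (fseq f) \in V)%:R :> R.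
Proof.
move=> uV sV; rewrite (eq_big_seq (fun c => (c == take l (fseq f))%:R)); last first.
  by move=> c /sV sc; rewrite prefixE sc eq_sym.
have [H|H] := boolP (_ \in V).
  rewrite (bigD1_seq _ H uV) /= eqxx big1 ?addr0 // => c /negbTE->//.
by rewrite big_seq big1 // => c cV; case: eqP => // E; rewrite -E cV in H.
Qed.

(** Nearly all vertices with a large parent start one of the words of [V], all of the length of [c].
    Bounding the other words from above leaves the required share for [c]. *)
Lemma prefix_big_lower (c : seq nat) (eta : R) : 0 < eta ->
  \forall m \near \oo, law c * (1 - mu nu) - eta <= bigp m c.
Proof.
move=> eta0; pose l := size c.
have [[_ pi1 _ mu0 mu1] _] := offspring_mean Hw Ht.
pose ep := eta / 4; have ep0 : 0 < ep by rewrite divr_gt0.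
have Cw : (fun K => series (xi_law w tau) K ^+ l) @ \oo --> (1 : R).
  by rewrite -[X in _ --> X](expr1n _ l); exact: cvg_exprn pi1.
have [K0 HK0] : exists K0, forall K, (K0 <= K)%N -> 1 - ep < series (xi_law w tau) K ^+ l.
  have [|K0 _ HK0] := cvgr_gt _ Cw (1 - ep); first by rewrite ltrBlDr ltrDl.
  by exists K0 => K; exact: HK0.
(* The second argument puts all letters of [c] below K, so that [c] belongs to [V]. *)
pose K := maxn K0 (sumn c).+1.
pose V := words K l.
have cV : c \in V.
  rewrite mem_words eqxx /=; apply/allP => k kc.
  by rewrite (leq_ltn_trans (leq_sumn kc)) // leq_maxr.
have HV : 1 - ep < \sum_(c' <- V) law c' by rewrite words_mass HK0 // leq_maxl.
have VV : \sum_(c' <- V) law c' <= 1.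
  rewrite words_mass exprn_ile1 //.
    by rewrite seriesEnat /=; apply: sumr_ge0 => k _; exact: xi_law_ge0 Hw Ht k.
  exact: xi_law_sum_le1 Hw Ht K.
have Vu : uniq V := words_uniq K l.
have Vs c' : c' \in V -> size c' = l by rewrite mem_words => /andP[/eqP].
have CP : (fun m => \sum_(c' <- V) prefix_prob w (nn m) c') @ \oo --> \sum_(c' <- V) law c'.
  apply: (@cvg_sumr R nat (seq nat) \oo _ V) => c'.
  exact: prefix_prob_cvg Hw Ht Hd HOm c'.
have [N HN] : exists N : nat, (size V)%:R * (ep / N.+1%:R) <= ep :> R.
  exists (size V); rewrite mulrCA -[leRHS]mulr1 ler_wpM2l ?(ltW ep0) //.
  by rewrite ler_pdivrMr ?ltr0n // mul1r ler_nat.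
have upN : forall i, \forall m \near \oo,
     bigp m (nth [::] V i) <= law (nth [::] V i) * (1 - mu nu) + ep / N.+1%:R.
  by move=> i; apply: prefix_big_upper; rewrite divr_gt0 ?ltr0n.
near=> m.
have up c' : c' \in V -> bigp m c' <= law c' * (1 - mu nu) + ep / N.+1%:R.
  move=> Hc'; rewrite -(nth_index [::] Hc'); move: (index _ _) (index_mem c' V) => i.
  rewrite Hc'; move: i; near: m; exact: near_forall_lt.
have P1 : 1 - ep < \sum_(c' <- V) prefix_prob w (nn m) c'.
  by near: m; exact: (cvgr_gt _ CP).
have Pb : 1 - mu nu - ep <=
  avgT w (fun (S : {set word (nn m)}) x => (big_parent (Om (nn m)) S (wval x))%:R).
  by near: m; exact: avg_big_parent.
(* The inequality P(A) + P(B) <= P(A and B) + 1, with A a large parent and B an initial word in [V];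
   words of equal length are disjoint events. *)
have Key : avgT w (fun (S : {set word (nn m)}) x => (big_parent (Om (nn m)) S (wval x))%:R) +
   \sum_(c' <- V) prefix_prob w (nn m) c' <= \sum_(c' <- V) bigp m c' + 1.
  have tot : 0 < \sum_(f in bridges (nn m)) fwt w f.
    by near: m; have [M0 HM0] := total_bridges_gt0 Hw Hd; exists M0.
  have E1 : (1 : R) = avgT w (fun (S : {set word (nn m)}) _ => 1).
    by rewrite /avgT avg_cst // -total_bridges.
  have -> : \sum_(c' <- V) prefix_prob w (nn m) c' =
     avgT w (fun (S : {set word (nn m)}) x => \sum_(c' <- V) (prefix c' (rotcode S x))%:R).
    rewrite /avgT avg_sum; apply: eq_bigr => u _.
    exact/esym/(avgT_rotcode w (nn m) (fun s => (prefix u s)%:R)).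
  have -> : \sum_(c' <- V) bigp m c' = avgT w (fun (S : {set word (nn m)}) x => \sum_(c' <- V)
      (prefix c' (rotcode S x) && big_parent (Om (nn m)) S (wval x))%:R).
    by rewrite /avgT avg_sum.
  rewrite [X in _ <= _ + X]E1 /avgT -!avgD; apply: ler_avg; first by move=> q; exact: tree_wt_ge0.
  move=> q Hq _.
  have -> : \sum_(c' <- V) (prefix c' (rotcode q.1 q.2) && big_parent (Om (nn m)) q.1 (wval q.2))%:R
    = (\sum_(c' <- V) (prefix c' (rotcode q.1 q.2))%:R) * (big_parent (Om (nn m)) q.1 (wval q.2))%:R :> R.
    by rewrite mulr_suml; apply: eq_bigr => c' _; rewrite -natrM mulnb.
  rewrite -(fseq_bridge_of Hq) (prefix_words _ Vu Vs).
  case: (_ \in V); case: (big_parent _ _ _); rewrite ?mulr1 ?mulr0 ?mul1r ?mul0r ?addr0 ?add0r //=; lra.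
have Sum : \sum_(c' <- V) bigp m c' <= bigp m c +
   (1 - mu nu) * (\sum_(c' <- V) law c' - law c) + ep.
  rewrite (bigD1_seq _ cV Vu) /= [in leRHS](bigD1_seq _ cV Vu) /= [law c + _]addrC addrK -addrA lerD2l.
  apply: le_trans (_ : \sum_(c' <- V | c' != c) (law c' * (1 - mu nu) + ep / N.+1%:R) <= _).
    rewrite [leLHS]big_seq_cond [leRHS]big_seq_cond /=; apply: ler_sum => c' /andP[Hc' _]; exact: up.
  rewrite big_split /= -mulr_suml mulrC lerD2l; apply: le_trans HN.
  have ee : 0 <= ep / N.+1%:R by rewrite divr_ge0 // ltW.
  rewrite (_ : (size V)%:R * _ = \sum_(c' <- V) ep / N.+1%:R); last first.
    by rewrite big_const_seq count_predT iter_addr_0 mulr_natl.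
  rewrite [leRHS](bigID (fun c' => c' != c)) /= lerDl; exact: sumr_ge0.
have lc := word_law_le1 c; have lc0 : 0 <= law c := word_law_ge0 Hw Ht c.
have -> : eta = 4 * ep by rewrite /ep; field.
have VV' : (1 - mu nu) * \sum_(c' <- V) law c' <= 1 - mu nu.
  by rewrite -[leRHS]mulr1 ler_wpM2l // subr_ge0 ltW.
move: Key Sum P1 Pb VV'; set s1 := \sum_(_ <- _) prefix_prob _ _ _.
set s2 := \sum_(_ <- _) bigp _ _; set s3 := \sum_(_ <- _) law _; set x := avgT _ _.
move=> *; nra.
Unshelve. all: by end_near. Qed.

Theorem prefix_middle_lower (c : seq nat) (M : nat) (eta : R) : 0 < eta ->
  \forall m \near \oo, law c * (1 - mu nu) - eta <=
    avgT w (fun (S : {set word (nn m)}) x =>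
      (prefix c (rotcode S x) && big_middle (Om (nn m)) M S (wval x))%:R).
Proof.
move=> eta0; have e2 : 0 < eta / 2 by rewrite divr_gt0.
have H1 := prefix_big_lower c e2.
near=> m.
have Hm : law c * (1 - mu nu) - eta / 2 <= bigp m c by near: m.
have O1 : 2 * (2 * M)%N%:R / eta + 1 <= Om (nn m).
  by near: m; have /cvgryPge := Om_cvg Hw Hd HOm; apply.
have c0 : 0 <= 2 * (2 * M)%N%:R / eta by rewrite divr_ge0 ?mulr_ge0 ?ler0n // ltW.
have Om0 : 0 < Om (nn m) by lra.
have H2 : (2 * M)%N%:R / Om (nn m) <= eta / 2.
  rewrite ler_pdivrMr // mulrC -ler_pdivrMr //.
  apply: le_trans (_ : 2 * (2 * M)%N%:R / eta <= _); last by lra.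
  by rewrite le_eqVlt; apply/orP; left; apply/eqP; field; rewrite gt_eqF.
have := le_trans (avg_big_edge (nn m) w0 M Om0) H2 => {}H2.
have : bigp m c <= avgT w (fun (S : {set word (nn m)}) x =>
      (prefix c (rotcode S x) && big_middle (Om (nn m)) M S (wval x))%:R) +
   avgT w (fun (S : {set word (nn m)}) x => (big_parent (Om (nn m)) S (wval x) && ~~ big_middle (Om (nn m)) M S (wval x))%:R).
  rewrite /bigp /avgT -avgD; apply: ler_avg; first by move=> q; exact: tree_wt_ge0.
  move=> q _ _; case: (prefix _ _); case: (big_parent _ _ _); case: (big_middle _ _ _ _);
  by rewrite /= ?addr0 ?add0r ?ler01 ?ler0n // lerDl ler01.
move: Hm H2; set x := avgT _ _; set y := avgT _ _; set z := bigp _ _; lra.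
Unshelve. all: by end_near. Qed.

End MainLower.

(** * Uniform continuity on pointed trees *)

Lemma prod_topology_cvg (I : eqType) (K : I -> topologicalType)
    (F : set_system (prod_topology K)) (f : prod_topology K) : Filter F ->
  (forall i, (fun h : prod_topology K => h i) @ F --> f i) -> F --> f.
Proof.
move=> FF H; apply/cvg_sup => i U [V] [[W oW <-] Wfi] VU.
apply: filterS VU _; apply: (H i); exact: open_nbhs_nbhs.
Qed.

Lemma compact_nat_bounded (C : set nat) : compact C -> exists M, forall k, C k -> (k < M)%N.
Proof.
move=> cC; apply: contrapT => Hno.
pose F : set_system nat := filter_from setT (fun M => [set k | C k /\ (M <= k)%N]).
have FP : ProperFilter F.
  apply: filter_from_proper; last first.
    move=> M _; apply: contrapT => H; apply: Hno; exists M => k Ck.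
    by rewrite ltnNge; apply/negP => Mk; apply: H; exists k.
  apply: filter_from_filter; first by exists 0%N.
  move=> i j _ _; exists (maxn i j) => // k [Ck]; rewrite geq_max => /andP[ik jk].
  by split; split.
have [|p [Cp]] := cC F FP; first by exists 0%N => // k [].
have Fp : F [set k | C k /\ (p.+1 <= k)%N] by exists p.+1.
have np : nbhs p [set p] by exact: discrete_set1.
by move=> /(_ _ _ Fp np)[k [[_ pk] /= E]]; rewrite E ltnn in pk.
Qed.

Definition big_nbar (M : nat) (a : nbar) : Prop := if a is Some k then (M <= k)%N else True.

(** Plays the part of an entourage of the compactification: two values beyond M, possibly infinite,
    are not told apart. *)
Definition nbar_close (M : nat) (a b : nbar) : Prop := a = b \/ big_nbar M a /\ big_nbar M b.

Lemma nbar_close_nbhs (v : nbar) (W : set nbar) : nbhs v W ->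
  exists M (W' : set nbar), nbhs v W' /\ forall N a b, (M <= N)%N -> W' a -> nbar_close N a b -> W b.
Proof.
case: v => [k|] Hv.
  exists k.+1, [set (Some k : nbar)]; split.
    have H := @one_point_compactification_some_nbhs nat k [set k] (discrete_set1 k).
    by move: H; congr nbhs; apply/seteqP; split => [z [_ -> <-]//|z ->]; exists k.
  move=> N a b kN -> [<-|[/= Nk _]]; first exact: nbhs_singleton Hv.
  by move: (leq_trans kN Nk); rewrite ltnn.
have [C [cC _] HC] : filter_from (@compact nat `&` closed) (fun U => (Some @` (~` U)) `|` [set None]) W := Hv.
have [M HM] := compact_nat_bounded cC.
exists M, W; split => // N a b MN Wa [<-//|[_]].
case: b => [k /= Nk|_]; last by apply: HC; right.
apply: HC; left; exists k => //= /HM; rewrite ltnNge.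
by rewrite (leq_trans MN Nk).
Qed.

Definition spine_close (M : nat) (a b : SV) : Prop := a = b \/
  exists a1 a2 b1 b2, [/\ a = spair a1 a2, b = spair b1 b2, nbar_close M a1 b1 & nbar_close M a2 b2].

Lemma spine_close_nbhs (s : SV) (W : set SV) : nbhs s W ->
  exists M (W' : set SV), nbhs s W' /\ forall N a b, (M <= N)%N -> W' a -> spine_close N a b -> W b.
Proof.
case: s => -[v|v] Hv.
- have [[W1 W2] /= [H1 H2] H12] : nbhs (v : nbar2) ((existT SVf true) @^-1` W) by exact: Hv.
  have [M1 [W1' [n1 c1]]] := nbar_close_nbhs H1.
  have [M2 [W2' [n2 c2]]] := nbar_close_nbhs H2.
  exists (maxn M1 M2), (W `&` (existT SVf true @` (W1' `*` W2'))); split.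
    apply: filterI => //; apply: (@existT_nbhs _ SVf true v).
    by exists (W1', W2').
  move=> N a b; rewrite geq_max => /andP[N1 N2] [Wa [[u1 u2] /= [u1W u2W] Ea]] [<-//|].
  move=> [a1 [a2 [b1 [b2 [E1 -> c1' c2']]]]].
  have [Eu1 Eu2] : u1 = a1 /\ u2 = a2.
    have := eq_trans Ea E1; rewrite /spair => /(congr1 (fun z : SV =>
       match z with existT true p => p | existT false _ => (None, None) end)).
    by move=> /= [-> ->].
  rewrite Eu1 Eu2 in u1W u2W.
  have Wb : (W1 `*` W2) (b1, b2) by split; [exact: c1 N1 u1W c1' | exact: c2 N2 u2W c2'].
  exact: (H12 _ Wb).
- exists 0%N, (W `&` (existT SVf false @` setT)); split.
    exact: (filterI Hv (@existT_nbhs _ SVf false v setT filterT)).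
  move=> N a b _ [Wa [u _ Ea]] [<-//|[a1 [a2 [b1 [b2 [E1 _ _ _]]]]]].
  by have := eq_trans Ea E1; rewrite /spair => /(congr1 (fun z : SV => projT1 z)).
Qed.

(** Non-spine values are compared exactly, since a configuration fixes them. Only the pair at the
    top of the spine is finite in one tree and infinite in the other. *)
Definition bul_close (N : nat) (x y : Tbul) : Prop :=
  (forall q : nsv, (pickle q < N)%N -> x.1 q = y.1 q) /\
  (forall j, (j < N)%N -> spine_close N (x.2 j) (y.2 j)).

Lemma Tbul_compact : compact [set: Tbul].
Proof.
have c1 : compact [set: nbar] by exact: one_point_compactification_compact.
have c2 : compact [set: SV].
  apply: sigT_compact; first exact: finite_finset.
  case=> /=; first by rewrite -setXTT; apply: compact_setX.
  have -> : [set: unitT] = [set tt] by apply/seteqP; split => // -[].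
  exact: compact_set1.
rewrite -setXTT; apply: compact_setX.
  have := @tychonoff nsv (fun=> nbar) (fun=> setT) (fun=> c1).
  by congr compact; apply/seteqP; split.
have := @tychonoff nat (fun=> SV) (fun=> setT) (fun=> c2).
by congr compact; apply/seteqP; split.
Qed.

(** Heine-Cantor by contradiction: of two ever closer sequences the first has a limit along an
    ultrafilter by compactness, and closeness gives the second the same limit. *)
Lemma bul_uniform (R : realType) (g : Tbul -> R) (e : R) : continuous g -> 0 < e ->
  exists N, forall x y, bul_close N x y -> `|g x - g y| <= e.
Proof.
move=> cg e0; apply: contrapT => Hno.
have {Hno}/choice[xy Hxy] : forall N, exists xy : Tbul * Tbul,
    bul_close N xy.1 xy.2 /\ e < `|g xy.1 - g xy.2|.
  move=> N; apply: contrapT => H; apply: Hno; exists N => x y c.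
  by rewrite leNgt; apply/negP => lt; apply: H; exists (x, y).
pose x N := (xy N).1; pose y N := (xy N).2.
have [U [UU FU]] := ultraFilterLemma (eventually_filter).
have PU := @ultra_proper _ _ UU.
have [a [_ Ha]] : [set: Tbul] `&` [set p | x @ U --> p] !=set0.
  have := Tbul_compact; rewrite compact_ultra => /(_ _ (fmap_ultra x UU)); apply.
  exact: filterT.
have Hx1 : (fun N => (x N).1) @ U --> a.1 by apply: cvg_comp Ha _; exact: cvg_fst.
have Hx2 : (fun N => (x N).2) @ U --> a.2 by apply: cvg_comp Ha _; exact: cvg_snd.
have Hb1 : (fun N => (y N).1) @ U --> a.1.
  apply: (@prod_topology_cvg nsv (fun=> nbar)) => q W HW.
  have Hx : (fun N => (x N).1 q) @ U --> a.1 q.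
    exact: (cvg_comp _ _ Hx1 (@proj_continuous _ (fun _ : nsv => nbar) q a.1)).
  have H : U [set N | W ((x N).1 q) /\ (pickle q < N)%N].
    by apply: filterI; [exact: Hx | exact: (FU _ (nbhs_infty_gt _))].
  change (U [set N | W ((y N).1 q)]).
  by apply: filterS H => N [Wx qN] /=; have [[/(_ q qN) <-]] := Hxy N.
have Hb2 : (fun N => (y N).2) @ U --> a.2.
  apply: (@prod_topology_cvg nat (fun=> SV)) => j W HW.
  have Hx : (fun N => (x N).2 j) @ U --> a.2 j.
    exact: (cvg_comp _ _ Hx2 (@proj_continuous _ (fun _ : nat => SV) j a.2)).
  have [M [W' [nW' HW']]] := spine_close_nbhs HW.
  have H : U [set N | W' ((x N).2 j) /\ (maxn M j < N)%N].
    by apply: filterI; [exact: Hx | exact: (FU _ (nbhs_infty_gt _))].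
  change (U [set N | W ((y N).2 j)]).
  apply: filterS H => N [Wx]; rewrite gtn_max => /andP[MN jN] /=.
  have [[_ /(_ j jN) c] _] := Hxy N.
  exact: HW' (ltnW MN) Wx c.
have Hb : y @ U --> a.
  move=> W [[W1 W2] /= [H1 H2] H12].
  have H : U [set N | W1 ((y N).1) /\ W2 ((y N).2)].
    by apply: filterI; [exact: Hb1 | exact: Hb2].
  change (U [set N | W (y N)]).
  by apply: filterS H => N [w1 w2]; exact: (H12 (y N)).
have C : (fun N => `|g (x N) - g (y N)|) @ U --> `|g a - g a|.
  apply: cvg_norm; apply: cvgB; [exact: (cvg_comp _ _ Ha (cg a)) | exact: (cvg_comp _ _ Hb (cg a))].
have : e <= `|g a - g a|.
  apply: (ler_cvg_to (cvg_cst _) C); apply: nearW => N.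
  by have [_ /ltW] := Hxy N.
by rewrite subrr normr0 leNgt e0.
Qed.

(** * Configurations in the finite tree *)

Section TreeSide.
Variables (n : nat) (S : {set word n}).
Hypothesis HS : is_ptree S.

(** Embeds the configuration tree into the finite tree: the artificial root goes to [y] and its i-th
    child to child a + i of [y]. *)
Definition shift_child (y : seq nat) (a : nat) (w : seq nat) : seq nat :=
  if w is i :: v then rcons y (a + i)%N ++ v else y.

Lemma walk_shift y a st s : all (fun w => w != [::]) st ->
  walk (map (shift_child y a) st) s = map (shift_child y a) (walk st s).
Proof.
elim: s st => [|k s IH] [|w st] //= /andP[w0 Hst]; congr (_ :: _).
rewrite -IH; last first.
  by rewrite all_cat Hst andbT; apply/allP => _ /mapP[i _ ->]; rewrite -size_eq0 size_rcons.
rewrite map_cat; congr (walk (_ ++ _) _); rewrite /children -map_comp.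
by apply: eq_map => i /=; case: w w0 => //= b w _; rewrite rcons_cat.
Qed.

Lemma tree_deg_behead m c : forest_code m c ->
  map (tree_deg (m :: c)) (behead (verts (m :: c))) = c.
Proof.
move=> Hc; have E := @tree_deg_verts (m :: c) Hc; by case: E.
Qed.

Lemma tree_deg_nonroot m c w : forest_code m c -> w \in verts (m :: c) -> w != [::] ->
  tree_deg (m :: c) w \in c.
Proof.
move=> Hc Hw w0; rewrite -[X in _ \in X](tree_deg_behead Hc); apply: map_f.
by rewrite mem_behead_verts w0.
Qed.

(** When child a of [y] is visited, the stack starts with the m siblings from a on, so reading [c]
    explores exactly the shifted configuration tree. *)
Lemma read_children y a m c : inT S y -> (0 < m)%N -> (a + m <= outdeg S y)%N ->
  forest_code m c -> prefix c (rotcode_at S (rcons y a)) ->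
  forall i v, (i < m)%N -> outdeg S (rcons y (a + i) ++ v) = tree_deg (m :: c) (i :: v).
Proof.
move=> Hy m0 Hm Hc Hp.
have HT : forest_code 1 (m :: c) by [].
have Hx : rcons y a \in dfs S by rewrite mem_dfs // ptree_outdeg //; lia.
have Hi : (index (rcons y a) (dfs S) < n)%N by rewrite -[X in (_ < X)%N](size_dfs HS) index_mem.
set i0 := index _ _ in Hi.
have [st1 Es] := stack_at_cons HS Hi; rewrite nth_index // in Es.
have Hm1 : (a + m.-1.+1 <= outdeg S y)%N by rewrite prednK.
have [st2 E2] := sibling_chain_iota HS Es (stack_at_sibling HS (ltnW Hi)) Hm1.
rewrite prednK // in E2.
have Et : take m (stack_at S i0) = [seq rcons y b | b <- iota a m].
  by rewrite E2 take_size_cat // size_map size_iota.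
have Hp' : prefix (c ++ [::]) (rot i0 (tree_code S)) by rewrite cats0.
have [|_ _ H3 H4 _] := read_forest HS (ltnW Hi) Hc _ Hp'.
  by rewrite E2 size_cat size_map size_iota leq_addr.
have E1 : [seq rcons y b | b <- iota a m] = map (shift_child y a) (children [::] m).
  rewrite -[X in iota X]addn0 iotaDl -!map_comp; apply: eq_map => i /=.
  by rewrite cats0.
have Ew : walk [seq rcons y b | b <- iota a m] c =
   map (shift_child y a) (behead (verts (m :: c))).
  rewrite E1 walk_shift; last by apply/allP => _ /mapP[i _ ->]; rewrite -size_eq0 size_rcons.
  by congr map; rewrite /verts /= cats0.
have Ed : map (outdeg S \o shift_child y a) (behead (verts (m :: c))) =
          map (tree_deg (m :: c)) (behead (verts (m :: c))).
  by rewrite tree_deg_behead // map_comp -Ew -Et -H4 map_take -drop_code.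
move=> i v im.
have iV : [:: i] \in verts (m :: c).
  by rewrite -[[:: i]]/(rcons [::] i) rcons_verts // root_verts.
have HD v' : [:: i] ++ v' \in verts (m :: c) ->
   outdeg S (rcons y (a + i)%N ++ v') = tree_deg (m :: c) ([:: i] ++ v').
  move=> Hv'; have /eq_in_map H := Ed; apply: (H (i :: v')).
  by rewrite mem_behead_verts.
have yi : inT S (rcons y (a + i)%N) by rewrite ptree_outdeg //; lia.
by rewrite -(gw_present_outdeg HS _ yi) (gw_present_subtree HT iV HD).
Qed.

Lemma children_inT y a m c i v : inT S y -> (i < m)%N -> (a + m <= outdeg S y)%N ->
  forest_code m c -> prefix c (rotcode_at S (rcons y a)) ->
  i :: v \in verts (m :: c) -> inT S (rcons y (a + i) ++ v).
Proof.
move=> Hy im Hm Hc Hp; elim/last_ind: v => [|v b IH] Hv.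
  by rewrite cats0 ptree_outdeg //; lia.
rewrite -rcons_cons in Hv; have Hv' := verts_parent Hv.
rewrite -rcons_cat ptree_outdeg // (read_children Hy _ Hm Hc Hp) //; last by lia.
by rewrite -rcons_verts.
Qed.

End TreeSide.

Lemma H_enc_split (R : realType) (deg : seq nat -> nat) (y u : seq nat) (b : nat) (Om : R) :
  Om < (deg y)%:R -> (forall k, (deg (y ++ b :: take k u))%:R <= Om) ->
  (\max_(h < size (y ++ b :: u) | (Om < (deg (take h (y ++ b :: u)))%:R)%R) h)%N = size y /\
  H_enc deg (y ++ b :: u) Om = Some (fringe_enc deg (y ++ b :: u) (size y)).
Proof.
move=> Hy Hu; set v := y ++ b :: u.
have yv : (size y < size v)%N by rewrite size_cat /= addnS ltnS leq_addr.
have Hyv : Om < (deg (take (Ordinal yv) v))%:R by rewrite /= take_size_cat.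
have E : (\max_(h < size v | (Om < (deg (take h v))%:R)%R) h)%N = size y.
  apply/eqP; rewrite eqn_leq; apply/andP; split.
    apply/bigmax_leqP => h Hh; rewrite leqNgt; apply/negP => yh.
    move: Hh; rewrite ltNge => /negP; apply.
    have -> : take h v = y ++ b :: take (h - (size y).+1) u.
      rewrite /v take_cat ltnNge (ltnW yh) /=.
      by have -> : (h - size y = (h - (size y).+1).+1)%N by lia.
    exact: Hu.
  exact: (@leq_bigmax_cond _ (fun h : 'I_(size v) => Om < (deg (take h v))%:R) (fun h => h : nat) (Ordinal yv)).
split; first exact: E.
rewrite /H_enc; case: existsP => [_|[]]; first by rewrite E.
by exists (Ordinal yv).
Qed.

Section ConfigTree.
Variables (R : realType) (n : nat) (S : {set word n}) (Om : R) (L m : nat).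
Hypotheses (HS : is_ptree S) (Hm : m = (2 * L).+1).

(* The configuration (c, u) is anchored at a vertex x when x and its next 2L
   siblings root the forest coded by c, in the middle of the children of a vertex
   of outdegree > Om; the pointed vertex is then the descendant u of the L-th
   sibling after x. *)
Definition config_anchor (M : nat) (c : seq nat) (x : seq nat) : bool :=
  prefix c (rotcode_at S x) && big_middle Om M S x.

Definition config_pointed (u x : seq nat) : seq nat := rcons (parent x) (last 0 x + L)%N ++ u.

Definition config_hit (M : nat) (k : seq nat * seq nat) (v : seq nat) : bool :=
  has (fun x => config_anchor M k.1 x && (v == config_pointed k.2 x)) (dfs S).

Definition config_ok (k : seq nat * seq nat) : Prop :=
  [/\ forest_code m k.1, L :: k.2 \in verts (m :: k.1) & forall i, i \in k.1 -> i%:R <= Om].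

Lemma config_hitP M c u v : (m <= M)%N -> config_ok (c, u) -> config_hit M (c, u) v ->
  exists y a, [/\ v = y ++ (a + L)%N :: u, Om < (outdeg S y)%:R /\ inT S y,
    (M <= a)%N /\ (a + M < outdeg S y)%N, prefix c (rotcode_at S (rcons y a)) &
    (forall k, (outdeg S (y ++ (a + L)%N :: take k u))%:R <= Om) /\
    (forall i w, (i < m)%N -> outdeg S (rcons y (a + i) ++ w) = tree_deg (m :: c) (i :: w))].
Proof.
move=> mM [/= Hc Hu HOm] /hasP[x Hx /andP[/andP[Hp /and3P[/andP[x0 Hb] H1 H2]] /eqP ->]].
case/lastP: x x0 Hx Hp Hb H1 H2 => // y a _.
rewrite /config_pointed parent_rcons last_rcons mem_dfs // => Hx Hp Hb H1 H2.
have Hy := ptree_parent HS Hx.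
have am : (a + m <= outdeg S y)%N by lia.
have m0 : (0 < m)%N by rewrite Hm.
have RC := read_children HS Hy m0 am Hc Hp.
exists y, a; split => //; first by rewrite cat_rcons.
split => // k; rewrite -cat_rcons RC; last by lia.
apply: HOm; apply: tree_deg_nonroot => //.
by apply: (@verts_prefix _ _ (drop k u)); rewrite /= cat_take_drop.
Qed.

(** Letters of [c] are at most Om, so [y] is recovered as the youngest ancestor of v of outdegree
    above Om; then the rest of v gives a and u, and the code read at child a gives c. *)
Lemma config_hit_unique M k k' v : (m <= M)%N -> config_ok k -> config_ok k' ->
  config_hit M k v -> config_hit M k' v -> k = k'.
Proof.
case: k k' => [c u] [c' u'] mM Hk Hk'.
case/(config_hitP mM Hk) => y [a [Ev [Hb _] _ Hp [Hs _]]].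
case/(config_hitP mM Hk') => y' [a' [Ev' [Hb' _] _ Hp' [Hs' _]]].
have [E1 _] := H_enc_split Hb Hs; have [E2 _] := H_enc_split Hb' Hs'.
rewrite -Ev in E1; rewrite -Ev' in E2.
have Ey : size y = size y' by rewrite -E1 -E2.
move: Ev'; rewrite Ev => /eqP; rewrite eqseq_cat // => /andP[/eqP Eyy /eqP[Ea Eu]].
have Eaa : a = a' by lia.
subst y' a' u'; case: Hk Hk' => /= Hc _ _ [/= Hc' _ _].
move: Hp Hp' => /prefixP[r ->] /prefixP[r' E].
by have [-> _] := forest_code_inj Hc Hc' E.
Qed.

Lemma sum_config_hit M c u : (m <= M)%N -> config_ok (c, u) ->
  \sum_(x in S) (config_anchor M c (wval x))%:R <= \sum_(x in S) (config_hit M (c, u) (wval x))%:R :> R.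
Proof.
move=> mM [/= Hc Hu HOm].
have sz (Q : pred (seq nat)) : \sum_(v <- dfs S) (Q v)%:R = (size [seq v <- dfs S | Q v])%:R :> R.
  by rewrite size_filter -sum1_count natr_sum [RHS]big_mkcond /=; apply: eq_bigr => v _; case: (Q v).
rewrite (sum_word_dfs (fun v => (config_anchor M c v)%:R) HS).
rewrite (sum_word_dfs (fun v => (config_hit M (c, u) v)%:R) HS) !sz ler_nat.
rewrite -(size_map (config_pointed u)); apply: uniq_leq_size.
  rewrite map_inj_in_uniq ?filter_uniq ?dfs_uniq // => x x'.
  rewrite !mem_filter => /andP[/andP[_ /and3P[/andP[x0 _] _ _]] _] /andP[/andP[_ /and3P[/andP[x0' _] _ _]] _].
  case/lastP: x x0 => // y a _; case/lastP: x' x0' => // y' a' _.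
  rewrite /config_pointed !parent_rcons !last_rcons => /eqP.
  have [Es|Es] := eqVneq (size y) (size y').
    by rewrite eqseq_cat ?size_rcons ?Es // eqseq_rcons => /andP[/andP[/eqP-> /eqP E] _]; congr rcons; lia.
  by move/eqP/(congr1 size); rewrite !size_cat !size_rcons; move: Es => /eqP; lia.
move=> v /mapP[x]; rewrite mem_filter => /andP[Ha Hx] ->; rewrite mem_filter.
apply/andP; split; first by apply/hasP; exists x; rewrite // Ha /=.
move: Ha => /andP[Hp /and3P[/andP[x0 Hb] H1 H2]].
case/lastP: x x0 Hx Hp Hb H1 H2 => // y a _.
rewrite /config_pointed parent_rcons last_rcons !mem_dfs // => Hx Hp Hb H1 H2.
apply: (children_inT HS (ptree_parent HS Hx) _ _ Hc Hp Hu); by rewrite ?Hm; lia.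
Qed.

(** The one spine value not fixed by the configuration is the top pair. Its entries are large
    because the anchor lies at least M children away from either end. *)
Lemma config_hit_point M c u v : (m <= M)%N -> config_ok (c, u) -> config_hit M (c, u) v ->
  exists z, [/\ H_enc (outdeg S) v Om = Some z,
    forall q, visible L u q -> z.1 q = (config_point L m c u).1 q,
    forall j, j != size u -> z.2 j = (config_point L m c u).2 j &
    exists a b, [/\ z.2 (size u) = spair (Some a) (Some b), (M <= a)%N & (M <= b + m)%N]].
Proof.
move=> mM Hk /(config_hitP mM Hk)[y [a [Ev [Hb Hy] [Ma Mb] Hp [Hs RC]]]].
have [_ EH] := H_enc_split Hb Hs; rewrite -Ev in EH.
exists (fringe_enc (outdeg S) v (size y)).
have sv : (size v = size y + (size u).+1)%N by rewrite Ev size_cat.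
have sk : (size v - size y = (size u).+1)%N by rewrite sv addKn.
have [Hc Hu _] := Hk; rewrite /= in Hc Hu.
have Lm : (L < m)%N by rewrite Hm; lia.
have Ehead : (size v - (size u).+1 = size y)%N by rewrite sv addnK.
have Etop : take (size v - (size u).+1) v = y /\ nth 0%N v (size v - (size u).+1) = (a + L)%N.
  by rewrite Ehead Ev take_size_cat // nth_cat ltnn subnn.
have Elow j : (j < size u)%N -> exists p r, [/\ L :: u = (L :: p) ++ nth 0%N u (size u - j.+1) :: r,
   size r = j, nth 0%N v (size v - j.+1) = nth 0%N u (size u - j.+1),
   take (size v - j.+1) v = rcons y (a + L) ++ p & p = take (size u - j.+1) u].
  move=> ju; have [p [r [Eu Er Ep]]] := split_at ju.
  set c0 := nth 0%N u (size u - j.+1) in Eu *.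
  have Ev2 : v = (rcons y (a + L) ++ p) ++ c0 :: r by rewrite Ev -cat_rcons -catA -Eu.
  have [H1 H2] := split_atE (rcons y (a + L) ++ p) r c0; rewrite Er -Ev2 in H1 H2.
  by exists p, r; split => //; rewrite /= -/c0 -Eu.
split => //.
- case=> [[[[j s] l]|] w] vis; last first.
    by rewrite /= Ev -cat_rcons -catA RC.
  rewrite /fringe_enc sk /=.
  rewrite /= in vis.
  rewrite ltnS; case: (leqP j (size u)) => // ju.
  move: ju; rewrite leq_eqVlt => /orP[/eqP Ej|ju].
    move: vis; rewrite Ej eqxx /= => lL.
    have [-> ->] := Etop.
    rewrite /config_deg /= subnn /=.
    have Rs i : (i < m)%N -> outdeg S (rcons y (a + i) ++ w) = tree_deg (m :: c) (i :: w) by move=> /RC ->.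
    case: s => /=.
      by rewrite -!addnA Rs //; lia.
    rewrite lL; have -> : (l < a + L)%N by lia.
    have -> : (a + L - 1 - l = a + (L - 1 - l))%N by lia.
    by rewrite Rs //; lia.
  have [p [r [Eu Er En Et Ep]]] := Elow j ju.
  rewrite En Et /config_deg /=.
  have [EnL EtL] : nth 0%N (L :: u) ((size u).+1 - j.+1) = nth 0%N u (size u - j.+1) /\
     take ((size u).+1 - j.+1) (L :: u) = L :: p.
    have := split_atE (L :: p) r (nth 0%N u (size u - j.+1)).
    by rewrite -Eu Er.
  rewrite EnL EtL /letter; case: s => /=; last case: ifP => // _.
    by rewrite rcons_cat -catA RC //= .
  by rewrite rcons_cat -catA RC //=.
- move=> j ju; rewrite /fringe_enc sk /= ltnS.
  case: (ltngtP j (size u)) ju => // jlt _.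
  have [p [r [Eu Er En Et Ep]]] := Elow j jlt.
  rewrite En Et /config_Z /= RC //.
  have -> : (size u - j = (size u - j.+1).+1)%N by lia.
  by rewrite /= -Ep subnAC.
- exists (a + L)%N, (outdeg S y - (a + L) - 1)%N.
  rewrite /fringe_enc sk /= leqnn; have [-> ->] := Etop; split => //; first by lia.
  by rewrite Hm; lia.
Qed.

End ConfigTree.

(** * Scheffe bounds *)

Section Scheffe.
Variables (R : realType) (K : eqType) (ks : seq K).
Hypothesis uks : uniq ks.

Lemma disjoint_values_bound (b : K -> bool) (g : K -> R) (f e M : R) : 0 <= e ->
  (forall k k', k \in ks -> k' \in ks -> b k -> b k' -> k = k') ->
  `|f| <= M -> (forall k, k \in ks -> b k -> `|f - g k| <= e) ->
  `|f - \sum_(k <- ks) g k * (b k)%:R| <= e + M * (1 - \sum_(k <- ks) (b k)%:R).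
Proof.
move=> e0 Hb fM Hg.
have [/hasP[k kks bk]|/hasPn H] := boolP (has b ks).
  have Z k' : k' \in ks -> k' != k -> b k' = false.
    by move=> k'ks /eqP kk; apply/negP => bk'; apply: kk; exact: Hb.
  rewrite (bigD1_seq k) //=.
  have z1 : \sum_(i <- ks | i != k) g i * (b i)%:R = 0.
    by rewrite big_seq_cond big1 // => i /andP[iks ik]; rewrite (Z i) // mulr0.
  have z2 : \sum_(i <- ks | i != k) (b i)%:R = 0 :> R.
    by rewrite big_seq_cond big1 // => i /andP[iks ik]; rewrite (Z i).
  rewrite (bigD1_seq k) //= z1 z2 bk mulr1 !addr0 subrr mulr0 addr0.
  exact: Hg.
rewrite big_seq big1; last by move=> k kks; rewrite (negbTE (H k kks)) mulr0.
rewrite big_seq big1; last by move=> k kks; rewrite (negbTE (H k kks)).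
by rewrite !subr0 mulr1; apply: le_trans fM _; rewrite lerDr.
Qed.

Lemma disjoint_sum_le1 (b : K -> bool) :
  (forall k k', k \in ks -> k' \in ks -> b k -> b k' -> k = k') ->
  \sum_(k <- ks) (b k)%:R <= 1 :> R.
Proof.
move=> Hb; have : `|0 - \sum_(k <- ks) 0 * (b k)%:R| <= 0 + 1 * (1 - \sum_(k <- ks) (b k)%:R) :> R.
  by apply: (@disjoint_values_bound b (fun=> 0)) => // [|k _ _]; rewrite ?subrr normr0 ?ler01.
by rewrite !add0r mul1r => H; rewrite -subr_ge0; exact: le_trans (normr_ge0 _) H.
Qed.

(** One-sided bounds suffice: |P - al| <= P - al + 2 eta sums to at most delta + 2 eta |ks|, and the
    mass missed by [P] is at most delta + eta |ks|. Together they give 2 delta + 3 eta |ks|. *)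
Lemma scheffe_bound (P al g : K -> R) (F e M eta delta : R) : 0 <= M ->
  `|F - \sum_(k <- ks) g k * P k| <= e + M * (1 - \sum_(k <- ks) P k) ->
  (forall k, k \in ks -> al k - eta <= P k) -> (forall k, k \in ks -> `|g k| <= M) ->
  0 <= eta -> \sum_(k <- ks) P k <= 1 -> 1 - delta <= \sum_(k <- ks) al k ->
  `|F - \sum_(k <- ks) g k * al k| <= e + M * (2 * delta + 3 * (eta * (size ks)%:R)).
Proof.
move=> M0 HF HP Hg eta0 P1 al1.
have se : \sum_(k <- ks) eta = eta * (size ks)%:R.
  by rewrite big_const_seq count_predT iter_addr_0 mulr_natr.
have D : `|\sum_(k <- ks) g k * P k - \sum_(k <- ks) g k * al k| <=
    M * (\sum_(k <- ks) P k - \sum_(k <- ks) al k + 2 * (eta * (size ks)%:R)).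
  rewrite -sumrB -se; apply: le_trans (ler_norm_sum _ _ _) _.
  rewrite (_ : M * _ = \sum_(k <- ks) M * (P k - al k + 2 * eta)); last first.
    by rewrite -mulr_sumr big_split /= sumrB -mulr_sumr.
  rewrite big_seq [leRHS]big_seq; apply: ler_sum => k kks.
  rewrite -mulrBr normrM; apply: ler_pM => //; first exact: Hg.
  have := HP k kks; rewrite ler_norml => H; apply/andP; split; lra.
have S : \sum_(k <- ks) al k - eta * (size ks)%:R <= \sum_(k <- ks) P k.
  by rewrite -se -sumrB big_seq [leRHS]big_seq; apply: ler_sum => k; exact: HP.
rewrite -(subrK (\sum_(k <- ks) g k * P k) F) -addrA.
apply: le_trans (ler_normD _ _) _; apply: le_trans (lerD HF D) _.
move: P1 al1 S; set s1 := \sum_(_ <- _) P _; set s2 := \sum_(_ <- _) al _; set z := eta * _.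
move=> P1 al1 S; nra.
Qed.

End Scheffe.

Section ProbIntegral.
Context {d} {T : measurableType d} {R : realType} (P : probability T R).
Variables (K : eqType) (ks : seq K).

Lemma integral_disjoint_bound (E : K -> set T) (g : K -> R) (f : T -> R) (e M : R) :
  uniq ks -> 0 <= e -> 0 <= M -> measurable_fun setT f -> (forall o, `|f o| <= M) ->
  (forall k, k \in ks -> measurable (E k)) ->
  (forall k k' o, k \in ks -> k' \in ks -> E k o -> E k' o -> k = k') ->
  (forall k o, k \in ks -> E k o -> `|f o - g k| <= e) ->
  `|\int[P]_o f o - \sum_(k <- ks) g k * Pr P (E k)| <=
     e + M * (1 - \sum_(k <- ks) Pr P (E k)) /\ \sum_(k <- ks) Pr P (E k) <= 1.
Proof.
move=> uks e0 M0 mf fM mE dE Hg.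
have T1 : Pr P setT = 1 by rewrite /Pr probability_setT.
have bint (h : T -> R) C : measurable_fun setT h -> (forall o, `|h o| <= C) ->
    P.-integrable setT (EFin \o h).
  move=> mh hC; apply: measurable_bounded_integrable => //.
    exact: le_lt_trans (probability_le1 P measurableT) (ltry 1).
  exists C; split; first exact: num_real.
  by move=> x Cx o _ /=; apply: le_trans (hC o) (ltW Cx).
have mI k : k \in ks -> measurable_fun setT (\1_(E k) : T -> R).
  by move=> /mE; exact: measurable_indic.
have iI k : k \in ks -> P.-integrable setT (EFin \o (\1_(E k) : T -> R)).
  move=> kks; apply: (bint _ 1); first exact: mI.
  by move=> o; rewrite indicE; case: (_ \in _); rewrite ?normr1 ?normr0.
have II k : k \in ks -> \int[P]_o (\1_(E k) o) = Pr P (E k).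
  by move=> /mE mEk; rewrite /Rintegral integral_indic // setIT.
have SI (r : seq K) (h : K -> R) : {subset r <= ks} ->
   P.-integrable setT (EFin \o (fun o => \sum_(k <- r) h k * \1_(E k) o)) /\
   \int[P]_o (\sum_(k <- r) h k * \1_(E k) o) = \sum_(k <- r) h k * Pr P (E k).
  elim: r => [|k r IH] sub.
    have E0 : (fun o => \sum_(k <- [::]) h k * \1_(E k) o) = cst 0 :> (T -> R).
      by apply/funext => o; rewrite big_nil.
    rewrite E0 big_nil; split; last by rewrite Rintegral_cst // mul0r.
    by apply: (bint _ 0) => [|o]; [exact: measurable_cst | rewrite normr0].
  have kks : k \in ks by apply: sub; rewrite inE eqxx.
  have [|I1 I2] := IH; first by move=> x xr; apply: sub; rewrite inE xr orbT.
  have E0 : (fun o => \sum_(k <- k :: r) h k * \1_(E k) o) =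
     (fun o => h k * \1_(E k) o + \sum_(k <- r) h k * \1_(E k) o) :> (T -> R).
    by apply/funext => o; rewrite big_cons.
  have Ik : P.-integrable setT (EFin \o (fun o => h k * \1_(E k) o)).
    apply: (bint _ (`|h k|)); first by apply: measurable_funM; [exact: measurable_cst | exact: mI].
    by move=> o; rewrite normrM indicE; case: (_ \in _); rewrite ?normr1 ?normr0 ?mulr1 ?mulr0.
  rewrite E0 big_cons; split; last first.
    rewrite RintegralD // I2; congr (_ + _).
    by rewrite RintegralZl ?II //; exact: iI.
  have -> : EFin \o (fun o => h k * \1_(E k) o + \sum_(k <- r) h k * \1_(E k) o) =
    (EFin \o (fun o => h k * \1_(E k) o)) \+ (EFin \o (fun o => \sum_(k <- r) h k * \1_(E k) o)).
    by apply/funext => o.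
  exact: integrableD.
have If := bint _ _ mf fM.
have [IH1 IH2] := SI ks g (fun=> id).
have [IS1 IS2] := SI ks (fun=> 1) (fun=> id).
have E1 o : \sum_(k <- ks) 1 * \1_(E k) o = \sum_(k <- ks) (o \in E k)%:R :> R.
  by apply: eq_bigr => k _; rewrite mul1r indicE.
have pw o : `|f o - \sum_(k <- ks) g k * \1_(E k) o| <=
   e + M * (1 - \sum_(k <- ks) 1 * \1_(E k) o).
  have -> : \sum_(k <- ks) g k * \1_(E k) o = \sum_(k <- ks) g k * (o \in E k)%:R :> R.
    by apply: eq_bigr => k _; rewrite indicE.
  rewrite E1.
  apply: disjoint_values_bound => //; first by move=> k k' kks k'ks /set_mem h1 /set_mem h2; exact: dE h1 h2.
  by move=> k kks /set_mem; exact: Hg.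
have S01 o : (0 <= (\sum_(k <- ks) 1 * \1_(E k) o : R) <= 1)%R.
  rewrite E1.
  apply/andP; split; first by apply: sumr_ge0.
  by apply: disjoint_sum_le1 => // k k' kks k'ks /set_mem h1 /set_mem h2; exact: dE h1 h2.
have Pr1 : \sum_(k <- ks) Pr P (E k) <= 1.
  have -> : \sum_(k <- ks) Pr P (E k) = \sum_(k <- ks) 1 * Pr P (E k).
    by apply: eq_bigr => k _; rewrite mul1r.
  rewrite -IS2 -[leRHS]mul1r -[X in 1 * X]T1 -Rintegral_cst //.
  apply: le_Rintegral => //; first by apply: (bint _ 1) => [|o]; [exact: measurable_cst | rewrite normr1].
  by move=> o _; have /andP[] := S01 o.
have mS : measurable_fun setT (fun o => \sum_(k <- ks) 1 * \1_(E k) o : R).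
  by apply/measurable_EFinP; exact: measurable_int IS1.
have I1 : P.-integrable setT (EFin \o (fun o => 1 - \sum_(k <- ks) 1 * \1_(E k) o : R)).
  apply: (bint _ 1) => [|o].
    by apply: measurable_funB => //; exact: measurable_cst.
  by have /andP[h1 h2] := S01 o; rewrite ger0_norm ?subr_ge0 // gerBl.
have Ic (C : R) : P.-integrable setT (EFin \o (fun=> C)).
  by apply: (bint _ `|C|) => //; exact: measurable_cst.
have IZ : P.-integrable setT (EFin \o (fun o => M * (1 - \sum_(k <- ks) 1 * \1_(E k) o) : R)).
  apply: (bint _ M) => [|o].
    apply: measurable_funM; first exact: measurable_cst.
    by apply/measurable_EFinP; exact: measurable_int I1.
  have /andP[h1 h2] := S01 o; rewrite normrM ger0_norm // ger0_norm ?subr_ge0 //.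
  by rewrite ler_piMr // gerBl.
have IE : \int[P]_o (e + M * (1 - \sum_(k <- ks) 1 * \1_(E k) o)) =
    e + M * (1 - \sum_(k <- ks) Pr P (E k)).
  rewrite RintegralD // RintegralZl // RintegralB // !Rintegral_cst // IS2 -[fine _]/(Pr P setT) T1 !mulr1.
  by congr (_ + _ * (_ - _)); apply: eq_bigr => k _; rewrite mul1r.
split => //; rewrite -IE -IH2 -RintegralB //; apply: le_trans (le_normr_Rintegral _ _) _ => //.
  exact: (integrableB measurableT If IH1).
apply: le_Rintegral => //.
- apply: (bint _ (e + M)) => [|o].
    apply: measurableT_comp; first exact: normr_measurable.
    by apply: measurable_funB => //; apply/measurable_EFinP; exact: measurable_int IH1.
  rewrite normr_id; apply: le_trans (pw o) _; have /andP[h1 h2] := S01 o.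
  by rewrite lerD2l ler_piMr // gerBl.
- exact: (integrableD measurableT (Ic e) IZ).
Qed.

End ProbIntegral.

(** * Configurations in the limit tree *)

Lemma locate_inr_lt u w j : locate u w = inr j -> (j < size u)%N.
Proof.
elim: u w => [|a u IH] [|b w] //=; first by case=> <-.
by case: ifP => // _ /IH H; rewrite ltnS ltnW.
Qed.

Section ConfigVariables.
Variables (L m : nat) (c u : seq nat).
Hypotheses (Hc : forest_code m c) (Hm : m = (2 * L).+1) (Hu : L :: u \in verts (m :: c)).

Lemma config_locate w : w \in verts (m :: c) -> w != [::] ->
  match locate (L :: u) w with
  | inl q => q \in config_queries L m c u /\ config_deg L m c u q = tree_deg (m :: c) w
  | inr j => (j < size u)%N /\
      exists2 p, (p < tree_deg (m :: c) w)%N & config_Z L m c u j = (Some (tree_deg (m :: c) w), p)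
  end.
Proof.
move=> Hw w0; have Ep := place_locate (L :: u) w.
case El: (locate (L :: u) w) Ep => [q|j] Ep.
  split; last by rewrite /config_deg Ep.
  by apply/(mem_queries L m c u q); exists w.
have js := locate_inr_lt El; case: Ep => Ew; rewrite /= in js.
have jh : (j < size u)%N.
  rewrite ltn_neqAle -ltnS js andbT; apply: contra_neq w0 => Ej.
  by rewrite -Ew Ej /= subnn take0.
split => //; have [p [r [Eu Er Epp]]] := @split_at (L :: u) j js.
rewrite Ew in Epp; subst p.
have [_ aw] := spine_vert Hc Hu Eu.
by exists (nth 0%N (L :: u) (size (L :: u) - j.+1)); rewrite // /config_Z -Ew.
Qed.

Lemma mem_config_spine j : (j \in config_spine L m c u) = (j < size u)%N.
Proof.
rewrite mem_pmap; apply/mapP/idP => [[e /mapP[w Hw ->]]|jh].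
  move: Hw; rewrite mem_behead_verts => /andP[w0 Hw].
  by have := config_locate Hw w0; case: locate => // j' [H _] [->].
have js : (j < size (L :: u))%N by rewrite /= ltnS ltnW.
have [p [r [Eu Er Epp]]] := split_at js.
exists (inr j) => //; apply/mapP; exists p; last by rewrite Eu locate_spine Er.
have [pV _] := spine_vert Hc Hu Eu; rewrite mem_behead_verts pV andbT.
by rewrite -size_eq0 Epp size_takel ?leq_subr //=; lia.
Qed.

Lemma config_located_uniq : uniq [seq locate (L :: u) w | w <- behead (verts (m :: c))].
Proof.
rewrite map_inj_uniq; last exact: locate_inj.
by have := verts_uniq (m :: c); rewrite [verts _]verts_rootE => /andP[].
Qed.

Lemma config_spine_uniq : uniq (config_spine L m c u).
Proof. by apply: (@pmap_uniq _ _ _ inr) config_located_uniq; case. Qed.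

Lemma config_queries_uniq : uniq (config_queries L m c u).
Proof. by apply: (@pmap_uniq _ _ _ inl) config_located_uniq; case. Qed.

(** Each vertex of the configuration except its artificial root is either a query or on the spine.
    On the spine the size bias k cancels the choice 1/k of the position, so every vertex contributes
    pi of its outdegree. *)
Lemma config_product (R : comPzRingType) (pi : nat -> R) (f : nsv -> R) (h : nat -> R) :
  (forall q, f q = pi (config_deg L m c u q)) ->
  (forall j k p, (p < k)%N -> config_Z L m c u j = (Some k, p) -> h j = pi k) ->
  (\prod_(q <- config_queries L m c u) f q) * (\prod_(j <- config_spine L m c u) h j) =
  \prod_(k <- c) pi k.
Proof.
move=> Hf Hh; rewrite -[X in _ = \prod_(k <- X) _](tree_deg_behead Hc) big_map.
rewrite /config_queries /config_spine.
have: {subset behead (verts (m :: c)) <= [pred w | (w != [::]) && (w \in verts (m :: c))]}.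
  by move=> w; rewrite mem_behead_verts inE.
move: config_locate; move: (locate (L :: u)) => loc CL.
elim: (behead _) => [|w s IH] sub; first by rewrite !big_nil mulr1.
have /andP[w0 Hw] := sub w (mem_head _ _).
rewrite big_cons -IH => [|x xs]; last by apply: sub; rewrite inE xs orbT.
rewrite /=; have := CL w Hw w0; case: (loc w) => [q [_ E]|j [_ [p pk E]]] /=.
  by rewrite big_cons Hf E mulrA.
by rewrite big_cons (Hh _ _ _ pk E) mulrCA.
Qed.

End ConfigVariables.

(** The first infinite offspring number gives the length of u, the positions below it give the
    letters of u, and the offspring numbers give the code. *)
Lemma config_event_unique L m c u c' u' X Xh Pos : m = (2 * L).+1 ->
  forest_code m c -> L :: u \in verts (m :: c) -> config_event L m c u X Xh Pos ->
  forest_code m c' -> L :: u' \in verts (m :: c') -> config_event L m c' u' X Xh Pos ->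
  (c, u) = (c', u').
Proof.
move=> Hm Hc Hu [HX HZ Hh] Hc' Hu' [HX' HZ' Hh'].
have Es : size u = size u'.
  case: (ltngtP (size u) (size u')) => // lt; first by have := HZ' _ lt; rewrite /config_Z Hh.
  by have := HZ _ lt; rewrite /config_Z Hh'.
have Eu : u = u'.
  apply: (@eq_from_nth _ 0%N) => // i iu.
  have jh : (size u - i.+1 < size u)%N by lia.
  have [_ E] := HZ _ jh; rewrite Es in jh; have [_] := HZ' _ jh.
  rewrite -Es E; have -> : (size u - (size u - i.+1) = i.+1)%N by lia.
  by [].
subst u'; congr (_, _).
(* An outdegree function built from the variables and u only; it reproduces both trees, which
   therefore coincide. *)
pose deg w := if w == [::] then m else
  match locate (L :: u) w with inl q => X q | inr j => odflt 0%N (Xh j) end.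
have D cc : forest_code m cc -> L :: u \in verts (m :: cc) -> config_event L m cc u X Xh Pos ->
   map deg (verts (m :: cc)) = m :: cc.
  move=> Hcc Huu [EX EZ _]; rewrite -[RHS](@tree_deg_verts (m :: cc) Hcc).
  apply/eq_in_map => w Hw; rewrite /deg; case: (eqVneq w [::]) => [->//|w0].
  have := config_locate Hcc Huu Hw w0; case: locate => [q [Hq <-]|j [jh [p _ E]]]; first exact: EX.
  by have := EZ _ jh; rewrite E => -[->].
by have [] := tree_code_unique (t := m :: c) (t' := m :: c') Hc Hc' (D c Hc Hu (And3 HX HZ Hh)) (D c' Hc' Hu' (And3 HX' HZ' Hh')).
Qed.

Section TstarVars.
Context {dm : measure_display} {Omega : measurableType dm} {R : realType}
  (P : probability Omega R).
Variables (w : nat -> R) (tau nu : R) (X : nsv -> Omega -> nat)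
  (Xh : nat -> Omega -> option nat) (Pos : nat -> Omega -> nat).
Hypothesis HV : Tstar_vars P w tau nu X Xh Pos.

Let Z j o := (Xh j o, Pos j o).

Definition config_set L m c u : set Omega :=
  [set o | config_event L m c u (X^~ o) (Xh^~ o) (Pos^~ o)].

Lemma config_set_prob L m c u : m = (2 * L).+1 -> forest_code m c ->
  L :: u \in verts (m :: c) ->
  measurable (config_set L m c u) /\
  Pr P (config_set L m c u) = word_law w tau c * (1 - mu nu).
Proof.
move=> Hm Hc Hu; have [mX [mZ [pX [pN [pZ ind]]]]] := HV.
set h := size u; set sA := config_queries L m c u; set sB := config_spine L m c u.
(* Independence is stated for full values of the pair (offspring number, position). The event that
   offspring number h is infinite is therefore split according to the unconstrained position l and
   summed again. *)
pose b l j := if j == h then (None, l) else config_Z L m c u j.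
pose D l := (\bigcap_(q in [set` sA]) (X q @^-1` [set config_deg L m c u q])) `&`
            (\bigcap_(j in [set` h :: sB]) (Z j @^-1` [set b l j])).
have mD l : measurable (D l).
  apply: measurableI; first by apply: fin_bigcap_measurable => // q _; exact: mX.
  by apply: fin_bigcap_measurable => // j _; exact: mZ.
have mN l : measurable (Z h @^-1` [set (None, l)]) by exact: mZ.
have hB : h \notin sB by rewrite mem_config_spine // ltnn.
have EN : Xh h @^-1` [set None] = \bigcup_l (Z h @^-1` [set (None, l)]).
  apply/seteqP; split => o /=; first by move=> E; exists (Pos h o) => //=; rewrite /Z E.
  by case=> l _ [].
have ED : config_set L m c u = \bigcup_l D l.
  apply/seteqP; split => o /=.
    case=> HX HZ Hh; exists (Pos h o) => //; split => [q /= /HX//|j /=].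
    rewrite inE /b => /orP[/eqP->|]; first by rewrite eqxx /Z Hh.
    rewrite mem_config_spine // => jh; rewrite (ltn_eqF jh); exact: HZ.
  case=> l _ [HX HZ]; split => [q qA|j jh|]; first exact: HX.
    have := HZ j; rewrite /= inE mem_config_spine // jh orbT => /(_ isT).
    by rewrite /b (ltn_eqF jh).
  by have := HZ h; rewrite /= inE eqxx => /(_ isT); rewrite /b eqxx => -[].
have tN : trivIset setT (fun l => Z h @^-1` [set (None, l)]).
  by move=> l l' _ _ [x []] /= -> [].
have tD : trivIset setT D.
  move=> l l' _ _ [x [[_ H] [_ H']]].
  have := H h; have := H' h; rewrite /= inE eqxx /b eqxx => /(_ isT) -> /(_ isT).
  by case.
pose C := \prod_(k <- c) xi_law w tau k.
have C0 : (\prod_(q <- sA) Pr P (X q @^-1` [set config_deg L m c u q])) *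
   (\prod_(j <- sB) Pr P (Z j @^-1` [set config_Z L m c u j])) = C.
  apply: (config_product Hc Hu) => [q|j k p pk E]; first exact: pX.
  rewrite E pZ pk mulrC mulKf // pnatr_eq0; lia.
have PrE A : measurable A -> P A = (Pr P A)%:E.
  by move=> mA; rewrite /Pr fineK // fin_num_measure.
have PD l : P (D l) = (C%:E * P (Z h @^-1` [set (None, l)]))%E.
  rewrite (PrE _ (mD l)) (PrE _ (mN l)) -EFinM; congr EFin.
  have := ind sA (h :: sB) (config_deg L m c u) (b l); rewrite /= hB.
  rewrite config_queries_uniq config_spine_uniq // => /(_ isT isT); rewrite -/(D l) => ->.
  rewrite big_cons {1}/b eqxx mulrCA mulrC -C0; congr (_ * _ * _).
  apply: eq_big_seq => j jB; rewrite /b; case: eqP => // jh.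
  by move: hB; rewrite -jh jB.
rewrite ED; split; first exact: bigcupT_measurable.
have EP : (P (\bigcup_l D l) = C%:E * P (Xh h @^-1` [set None]))%E.
  rewrite EN !measure_semi_bigcup //; try exact: bigcupT_measurable.
  by rewrite -nneseriesZl //; apply: eq_eseriesr => l _; exact: PD.
rewrite /Pr EP; rewrite PrE; last by rewrite EN; exact: bigcupT_measurable.
by rewrite pN.
Qed.

(** * Measurability of functions of the limit tree *)

Lemma measurable_fun_countable (C : countType) (h : Omega -> C) (F : C -> R) :
  (forall z, measurable (h @^-1` [set z])) -> measurable_fun setT (F \o h).
Proof.
move=> mh _ B mB; rewrite setTI.
have -> : (F \o h) @^-1` B =
   \bigcup_n (if unpickle n is Some z then if `[< B (F z) >] then h @^-1` [set z] else set0 else set0).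
  apply/seteqP; split => o /=.
    by move=> BF; exists (pickle (h o)) => //; rewrite pickleK /= asboolT.
  by case=> n _; case: unpickle => // z; case: asboolP => // Bz /= ->.
apply: bigcupT_measurable => n; case: unpickle => // z; case: ifP => // _; exact: mh.
Qed.

Lemma measurable_map_fiber (I : Type) (A : Type) (V : I -> Omega -> A) (s : seq I) (z : seq A) :
  (forall i a, measurable (V i @^-1` [set a])) ->
  measurable [set o | [seq V i o | i <- s] = z].
Proof.
move=> mV; elim: s z => [|i s IH] [|a z] /=.
- by rewrite [X in measurable X](_ : _ = setT) //; apply/seteqP; split.
- by rewrite [X in measurable X](_ : _ = set0) //; apply/seteqP; split.
- by rewrite [X in measurable X](_ : _ = set0) //; apply/seteqP; split.
have -> : [set o | V i o :: [seq V j o | j <- s] = a :: z] =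
    (V i @^-1` [set a]) `&` [set o | [seq V j o | j <- s] = z].
  by apply/seteqP; split => o /=; [case=> -> -> | case=> -> ->].
by apply: measurableI.
Qed.

Lemma near_Tbar_trunc (x : nsv -> nat) (y : nat -> option nat) (z : nat -> nat)
  (x_ : nat -> nsv -> nat) (y_ : nat -> nat -> option nat) (z_ : nat -> nat -> nat) :
  (forall q, \forall N \near \oo, x_ N q = x q) ->
  (forall j, \forall N \near \oo, y_ N j = y j /\ z_ N j = z j) ->
  forall k, \forall N \near \oo, bul_close k (Tbar_enc (x_ N) (y_ N) (z_ N)) (Tbar_enc x y z).
Proof.
move=> Hx Hyz k.
have Halive j : \forall N \near \oo,
    [forall j' : 'I_j, y_ N j' != None] = [forall j' : 'I_j, y j' != None].
  have H := near_forall_lt _ j Hyz.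
  near=> N; apply: eq_forallb => j'.
  have HN : forall i, (i < j)%N -> y_ N i = y i /\ z_ N i = z i by near: N; exact: H.
  by have [->] := HN j' (ltn_ord j').
have Hgw e v : \forall N \near \oo,
   gw_present (fun u' => x_ N (e, u')) v = gw_present (fun u' => x (e, u')) v.
  have H := near_forall_lt _ (size v) (fun i => Hx (e, take i v)).
  near=> N; apply: eq_forallb => i; congr (_ < _)%N.
  have HN : forall i, (i < size v)%N -> x_ N (e, take i v) = x (e, take i v) by near: N; exact: H.
  exact: HN.
have Hq q : \forall N \near \oo,
    (Tbar_enc (x_ N) (y_ N) (z_ N)).1 q = (Tbar_enc x y z).1 q.
  case: q => [[[[j s] l]|] v] /=.
    near=> N; have -> : x_ N (Some (j, s, l), v) = x (Some (j, s, l), v) by near: N; exact: Hx.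
    have -> : [forall j' : 'I_j, y_ N j' != None] = [forall j' : 'I_j, y j' != None].
      by near: N; exact: Halive.
    have [-> ->] : y_ N j = y j /\ z_ N j = z j by near: N; exact: Hyz.
    have -> // : gw_present (fun u' => x_ N (Some (j, s, l), u')) v =
       gw_present (fun u' => x (Some (j, s, l), u')) v by near: N; exact: Hgw.
  near=> N; have -> : x_ N (None, v) = x (None, v) by near: N; exact: Hx.
  have -> // : gw_present (fun u' => x_ N (None, u')) v =
       gw_present (fun u' => x (None, u')) v by near: N; exact: Hgw.
have Hs j : \forall N \near \oo,
    (Tbar_enc (x_ N) (y_ N) (z_ N)).2 j = (Tbar_enc x y z).2 j.
  near=> N; rewrite /=.
  have -> : [forall j' : 'I_j, y_ N j' != None] = [forall j' : 'I_j, y j' != None].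
    by near: N; exact: Halive.
  by have [-> ->] : y_ N j = y j /\ z_ N j = z j by near: N; exact: Hyz.
have H1 := near_forall_lt _ k Hs.
pose Q i N := if unpickle i is Some q then
   (Tbar_enc (x_ N) (y_ N) (z_ N)).1 q = (Tbar_enc x y z).1 q else True.
have HQ i : \forall N \near \oo, Q i N.
  by rewrite /Q; case: unpickle => [q|]; [exact: Hq | exact: nearW].
have H2 := near_forall_lt _ k HQ.
near=> N; split => [q qk|j jk].
  have HN : forall i, (i < k)%N -> Q i N by near: N; exact: H2.
  by have := HN _ qk; rewrite /Q pickleK.
left; have HN : forall i, (i < k)%N -> (Tbar_enc (x_ N) (y_ N) (z_ N)).2 i = (Tbar_enc x y z).2 i.
  by near: N; exact: H1.
exact: HN.
Unshelve. all: by end_near. Qed.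

(** Replace all but the first N variables by default values. The result depends on a
    countable-valued code, hence is measurable, and converges pointwise since each coordinate of the
    encoding reads finitely many variables. *)
Lemma measurable_Tbar (g : Tbul -> R) : continuous g ->
  measurable_fun setT (fun o => g (Tbar_enc (X^~ o) (Xh^~ o) (Pos^~ o))).
Proof.
move=> cg; have [mX [mZ _]] := HV.
pose qs N : seq nsv := pmap unpickle (iota 0 N).
pose code N o := ([seq X q o | q <- qs N], [seq Z j o | j <- iota 0 N]).
pose F N (a : seq nat * seq (option nat * nat)) :=
  g (Tbar_enc (fun q => nth 0%N a.1 (index q (qs N)))
     (fun j => (nth (None, 0%N) a.2 j).1) (fun j => (nth (None, 0%N) a.2 j).2)).
apply: (@measurable_fun_cvg _ _ _ _ (fun N => F N \o code N)).
  move=> N; apply: measurable_fun_countable => -[a1 a2].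
  have -> : code N @^-1` [set (a1, a2)] =
     [set o | [seq X q o | q <- qs N] = a1] `&` [set o | [seq Z j o | j <- iota 0 N] = a2].
    by apply/seteqP; split => o /=; [case=> -> -> | case=> E1 E2; rewrite /code E1 E2].
  by apply: measurableI; apply: measurable_map_fiber => i a; [exact: mX | exact: mZ].
move=> o _; apply/cvgrPdist_le => e e0.
have [k Hk] := bul_uniform cg e0.
have HX q : \forall N \near \oo, nth 0%N (code N o).1 (index q (qs N)) = X q o.
  near=> N; have qN : q \in qs N.
    rewrite mem_pmap; apply/mapP; exists (pickle q); last by rewrite pickleK.
    by rewrite mem_iota /= add0n; near: N; exact: nbhs_infty_gt.
  by rewrite (nth_map q) ?index_mem // nth_index.
have HZ j : \forall N \near \oo, (nth (None, 0%N) (code N o).2 j).1 = Xh j o /\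
   (nth (None, 0%N) (code N o).2 j).2 = Pos j o.
  near=> N; have jN : (j < N)%N by near: N; exact: nbhs_infty_gt.
  by rewrite (nth_map 0%N) ?size_iota // nth_iota.
have := @near_Tbar_trunc (X^~ o) (Xh^~ o) (Pos^~ o)
  (fun N q => nth 0%N (code N o).1 (index q (qs N)))
  (fun N j => (nth (None, 0%N) (code N o).2 j).1)
  (fun N j => (nth (None, 0%N) (code N o).2 j).2) HX HZ k.
apply: filterS => N Hb.
by rewrite distrC; exact: Hk.
Unshelve. all: by end_near. Qed.

End TstarVars.

(** * Proof of the theorem *)

Lemma avg_disjoint_bound (R : realType) (I : finType) (A : {set I}) (p : I -> R)
  (K : eqType) (ks : seq K) (E : K -> I -> bool) (g : K -> R) (f : I -> R) (e M : R) :
  (forall i, 0 <= p i) -> 0 < \sum_(i in A) p i -> uniq ks -> 0 <= e ->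
  (forall i, i \in A -> `|f i| <= M) ->
  (forall k k' i, i \in A -> k \in ks -> k' \in ks -> E k i -> E k' i -> k = k') ->
  (forall k i, i \in A -> k \in ks -> E k i -> `|f i - g k| <= e) ->
  `|avg A p f - \sum_(k <- ks) g k * avg A p (fun i => (E k i)%:R)| <=
     e + M * (1 - \sum_(k <- ks) avg A p (fun i => (E k i)%:R)) /\
  \sum_(k <- ks) avg A p (fun i => (E k i)%:R) <= 1.
Proof.
move=> p0 tot uks e0 fM dE Hg.
have ES : \sum_(k <- ks) avg A p (fun i => (E k i)%:R) =
    avg A p (fun i => \sum_(k <- ks) (E k i)%:R) by rewrite avg_sum.
have EG : \sum_(k <- ks) g k * avg A p (fun i => (E k i)%:R) =
    avg A p (fun i => \sum_(k <- ks) g k * (E k i)%:R).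
  by rewrite avg_sum; apply: eq_bigr => k _; rewrite avgZ.
split.
  rewrite EG ES -avgB -[X in M * (X - _)](avg_cst 1 tot) -avgB -avgZ -{1}(avg_cst e tot) -avgD.
  apply: le_trans (ler_norm_avg A p0 _) _; apply: ler_avg => // i iA _.
  apply: disjoint_values_bound => //; [| exact: fM |].
    by move=> k k' kks k'ks; exact: dE.
  by move=> k kks; exact: Hg.
rewrite ES -[leRHS](avg_cst 1 tot); apply: ler_avg => // i iA _.
by apply: disjoint_sum_le1 => // k k' kks k'ks; exact: dE.
Qed.

(** * Families of configurations and their total mass *)

Definition marked_trees (h : nat) : seq (seq nat * seq nat) :=
  [seq (t, v) | t <- trees h, v <- verts t].

Definition configs (L h : nat) : seq (seq nat * seq nat) :=
  [seq (a.1 ++ p.1 ++ a.2, p.2) |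
     a <- [seq (f, f') | f <- forests (trees h) L, f' <- forests (trees h) L], p <- marked_trees h].

Lemma mem_marked_trees h p : p \in marked_trees h -> forest_code 1 p.1 /\ p.2 \in verts p.1.
Proof.
by move=> /allpairsPdep[t [v [tT vt ->]]]; split => //=; exact: (allP (trees_code h)).
Qed.

Lemma mem_configs L h m k : m = (2 * L).+1 -> k \in configs L h ->
  forest_code m k.1 /\ L :: k.2 \in verts (m :: k.1).
Proof.
move=> Hm /allpairsP[[a p] /= [Ha /mem_marked_trees[Hp Hv] ->]] /=.
move: Ha => /allpairsP[[f f'] /= [Hf Hf' ->]] /=.
have fc := allP (forests_code (trees_code h) L).
have Em : m = (L + (1 + L))%N by rewrite Hm; lia.
have Ff := fc _ Hf; have Ff' := fc _ Hf'.
have Fp : forest_code (1 + L) (p.1 ++ f') := forest_code_cat Hp Ff'.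
split; first by rewrite Em; exact: forest_code_cat.
suff : L :: p.2 \in behead (verts (m :: f ++ p.1 ++ f')) by rewrite mem_behead_verts.
have -> : behead (verts (m :: f ++ p.1 ++ f')) = walk (children [::] m) (f ++ p.1 ++ f').
  by rewrite /verts /= cats0.
have -> : children [::] m = children [::] L ++ [:: L] :: [seq rcons [::] i | i <- iota L.+1 L].
  by rewrite /children Em iotaD map_cat add0n.
rewrite walk_cat mem_cat; apply/orP; right.
rewrite stack_after_forest ?size_children // walk_cat mem_cat; apply/orP; left.
by rewrite walk_tree //; apply/mapP; exists p.2.
Qed.

Lemma configs_uniq L h : uniq (configs L h).
Proof.
have uT := trees_uniq h; have cT := trees_code h.
have fc := allP (forests_code cT L).
apply: allpairs_uniq_key.
- apply: allpairs_uniq_key => [|f _|f f' f1 f1' _ _ _ _ [-> ->] //]; exact: forests_uniq.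
- move=> _ _; apply: allpairs_uniq_key => [|t _|t v t' v' _ _ _ _ [-> ->] //].
    exact: trees_uniq.
  exact: verts_uniq.
move=> [f1 f2] [t v] [f1' f2'] [t' v'] /allpairsP[[a b] /= [Ha Hb [-> ->]]].
move=> /mem_marked_trees[/= Ht _] /allpairsP[[a' b'] /= [Ha' Hb' [-> ->]]].
move=> /mem_marked_trees[/= Ht' _] [E ->].
have [-> E2] := forest_code_inj (fc _ Ha) (fc _ Ha') E.
by have [-> ->] := forest_code_inj Ht Ht' E2.
Qed.

Section ConfigMass.
Variables (R : realType) (w : nat -> R) (tau nu : R).
Hypotheses (Hw : weight_seq w) (Ht : type_II_or_III w tau nu).

Lemma configs_mass L h : \sum_(k <- configs L h) word_law w tau k.1 =
  family_mass w tau (trees h) ^+ (L + L) * family_size w tau (trees h).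
Proof.
have E : \sum_(p <- marked_trees h) word_law w tau p.1 = family_size w tau (trees h).
  rewrite big_allpairs_dep /family_size; apply: eq_big_seq => t tT /=.
  rewrite big_const_seq count_predT iter_addr_0 mulr_natr size_verts //.
  exact: (allP (trees_code h)).
rewrite exprD -E -!forests_mass /family_mass big_allpairs_dep big_allpairs_dep /= !mulr_suml.
apply: eq_bigr => f _; rewrite -mulrA mulr_suml mulr_sumr; apply: eq_bigr => f' _.
rewrite !mulr_sumr; apply: eq_bigr => p _ /=.
by rewrite !word_law_cat; ring.
Qed.

(** Summing over the marked vertex turns the mass of the middle tree into its mean size, close to 1
    / (1 - mu). The 2L side trees have mass close to 1; the product of two factors at least 1 -
    delta is at least 1 - 2 delta. *)
Lemma configs_mass_ge L (delta : R) : 0 < delta -> delta < 1 ->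
  exists h, 1 - 2 * delta <= \sum_(k <- configs L h) word_law w tau k.1 * (1 - mu nu).
Proof.
move=> d0 d1; have [[_ _ _ mu0 mu1] _] := offspring_mean Hw Ht.
have v0 : 0 < 1 - mu nu by rewrite subr_gt0.
have [|h0 Hh0] := trees_size_unbounded Hw Ht (B := (1 - delta) * (1 - mu nu)^-1).
  by rewrite gtr_pMl ?invr_gt0 // ltrBlDr ltrDl.
have Cq : (fun h => family_mass w tau (trees h) ^+ (L + L)) @ \oo --> (1 : R).
  by rewrite -[X in _ --> X](expr1n _ (L + L)); exact: cvg_exprn (trees_mass_cvg Hw Ht).
have [|h1 _ Hh1] := cvgr_gt _ Cq (1 - delta); first by rewrite ltrBlDr ltrDl.
exists (maxn h0 h1); rewrite -mulr_suml configs_mass.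
have /ltW A : 1 - delta < family_mass w tau (trees (maxn h0 h1)) ^+ (L + L).
  by apply: Hh1; rewrite /= leq_maxr.
have B : 1 - delta <= family_size w tau (trees (maxn h0 h1)) * (1 - mu nu).
  rewrite -ler_pdivrMr //; apply: le_trans (ltW Hh0) _.
  by apply: (trees_size_nd Hw Ht); rewrite leq_maxl.
have d10 : 0 <= 1 - delta by rewrite subr_ge0 ltW.
rewrite -mulrA; apply: le_trans (ler_pM d10 d10 A B).
by nra.
Qed.

End ConfigMass.

Lemma visible_bound N : exists L, forall u q, (pickle q < N)%N -> visible L u q.
Proof.
pose b i := if (unpickle i : option nsv) is Some (Some (_, _, l), _) then l.+1 else 0%N.
exists (\max_(i < N) b i)%N => u q qN; have := leq_bigmax (F := fun i : 'I_N => b i) (Ordinal qN).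
by rewrite /b /= pickleK; case: q {qN} => [[[[j s] l]|] v] //= lL; apply/implyP.
Qed.

Section Approximation.
Variables (R : realType) (g : Tbul -> R) (e C : R) (N L m M : nat) (ks : seq (seq nat * seq nat)).
Hypotheses (e0 : 0 <= e) (Hg : forall x y, bul_close N x y -> `|g x - g y| <= e)
  (gC : forall t, `|g t| <= C) (Hvis : forall u q, (pickle q < N)%N -> visible L u q)
  (Hm : m = (2 * L).+1) (HM : (N + m <= M)%N) (uks : uniq ks)
  (cks : forall k, k \in ks -> forest_code m k.1 /\ L :: k.2 \in verts (m :: k.1)).

Let gk k := g (config_point L m k.1 k.2).

Let C0 : 0 <= C. Proof. exact: le_trans (normr_ge0 _) (gC (config_point 0 0 [::] [::])). Qed.

(** The margin N + m on both sides leaves at least N siblings to the left and to the right of the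
    spine child, so the top pair is close to a pair of infinities. *)
Lemma config_hit_close n (S : {set word n}) (Om : R) k v : is_ptree S -> k \in ks ->
  (forall i, i \in k.1 -> i%:R <= Om) -> config_hit S Om L M k v ->
  exists2 z, H_enc (outdeg S) v Om = Some z & `|g z - gk k| <= e.
Proof.
case: k => c u HS kks HOm Hhit; have [Hc Hu] := cks kks.
have mM : (m <= M)%N by apply: leq_trans HM; exact: leq_addl.
have NM : (N <= M)%N by apply: leq_trans HM; exact: leq_addr.
have [z [Ez H1 H2 [a [b [H3 Ma Mb]]]]] := config_hit_point HS Hm mM (And3 Hc Hu HOm) Hhit.
exists z => //; apply: Hg; split => [q qN|j jN]; first by apply: H1; exact: Hvis.
have [Ej|jh] := eqVneq j (size u); last by left; exact: H2.
right; exists (Some a), (Some b), None, None; split.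
- by rewrite Ej.
- by rewrite /config_point /= Ej ltnn eqxx.
- by right; split => //=; exact: leq_trans Ma.
by right; split => //=; rewrite -(leq_add2r m); exact: leq_trans Mb.
Qed.

Lemma EH_configs (w : nat -> R) n (Om c : R) : (forall k, 0 <= w k) -> `|c| <= C ->
  0 < \sum_(q in pointed_trees n) tree_wt w q.1 ->
  (forall k, k \in ks -> forall i, i \in k.1 -> i%:R <= Om) ->
  let p k := avgT w (fun (S : {set word n}) x => (config_hit S Om L M k (wval x))%:R) in
  `|EH w n Om (fun o => if o is Some t then g t else c) - \sum_(k <- ks) gk k * p k| <=
     e + C * (1 - \sum_(k <- ks) p k) /\ \sum_(k <- ks) p k <= 1.
Proof.
move=> w0 cC tot HOm; rewrite EH_avgT.
have mM : (m <= M)%N by apply: leq_trans HM; exact: leq_addl.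
apply: (@avg_disjoint_bound _ _ (pointed_trees n) _ _ ks
  (fun k (q : {set word n} * word n) => config_hit q.1 Om L M k (wval q.2))) => //.
- by move=> q; exact: tree_wt_ge0.
- by move=> q _; case: H_enc.
- move=> k k' [S x]; rewrite inE => /andP[/= HS _] kks k'ks.
  have [h1 h2] := cks kks; have [h1' h2'] := cks k'ks.
  by apply: (config_hit_unique HS Hm mM); split => //; exact: HOm.
move=> k [S x]; rewrite inE => /andP[/= HS _] kks Hhit.
by have [z -> ] := config_hit_close HS kks (HOm _ kks) Hhit.
Qed.

Lemma Tbar_configs (dm : measure_display) (Omega : measurableType dm) (P : probability Omega R)
  (w : nat -> R) (tau nu : R) (X : nsv -> Omega -> nat) (Xh : nat -> Omega -> option nat)
  (Pos : nat -> Omega -> nat) : continuous g -> Tstar_vars P w tau nu X Xh Pos ->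
  let p k := word_law w tau k.1 * (1 - mu nu) in
  `|\int[P]_o g (Tbar_enc (X^~ o) (Xh^~ o) (Pos^~ o)) - \sum_(k <- ks) gk k * p k| <=
     e + C * (1 - \sum_(k <- ks) p k) /\ \sum_(k <- ks) p k <= 1.
Proof.
move=> cg HV p.
have pE k : k \in ks -> Pr P (config_set X Xh Pos L m k.1 k.2) = p k.
  by move=> /cks[h1 h2]; have [] := config_set_prob HV Hm h1 h2.
have E1 : \sum_(k <- ks) p k = \sum_(k <- ks) Pr P (config_set X Xh Pos L m k.1 k.2).
  by apply: eq_big_seq => k /pE.
have E2 : \sum_(k <- ks) gk k * p k =
   \sum_(k <- ks) gk k * Pr P (config_set X Xh Pos L m k.1 k.2).
  by apply: eq_big_seq => k /pE ->.
rewrite E1 E2; apply: integral_disjoint_bound => //.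
- exact: measurable_Tbar HV _ cg.
- by move=> k /cks[h1 h2]; have [] := config_set_prob HV Hm h1 h2.
- move=> [c u] [c' u'] o /cks[/= h1 h2] /cks[/= h1' h2'] H H'.
  exact: (config_event_unique Hm h1 h2 H h1' h2' H').
move=> k o /cks[h1 h2] H; apply: Hg.
have [H1 H2] := config_event_point h1 Hm h2 H.
by split => [q qN|j _]; [apply: H1; exact: Hvis | left; exact: H2].
Qed.

End Approximation.

Theorem theorem5p6 (R : realType) (w : nat -> R) (tau nu : R) (d : nat)
  (Om : nat -> R)
  (dm : measure_display) (Omega : measurableType dm) (P : probability Omega R)
  (X : nsv -> Omega -> nat) (Xh : nat -> Omega -> option nat)
  (Pos : nat -> Omega -> nat) :
  weight_seq w -> type_II_or_III w tau nu -> is_span w d ->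
  Omega_ok w d (mu nu) Om ->
  Tstar_vars P w tau nu X Xh Pos ->
  forall g : Tbul -> R, continuous g -> (exists M : R, forall t, `|g t| <= M) ->
  forall c : R,
    (fun m => EH w (d * m + 1)%N (Om (d * m + 1)%N)
                 (fun o => if o is Some t then g t else c))
      @ \oo -->
    \int[P]_o g (Tbar_enc (fun q => X q o) (fun j => Xh j o) (fun j => Pos j o)).
Proof.
move=> Hw Ht Hd HOm HV g cg [M0 gM0] c.
have w0 := proj1 Hw.
pose C := Num.max M0 `|c|.
have gC t : `|g t| <= C by rewrite le_max gM0.
have cC : `|c| <= C by rewrite le_max lexx orbT.
have C0 : 0 <= C by apply: le_trans cC.
apply/cvgrPdist_le => eps eps0.
pose D := C + 1; have D0 : 0 < D by rewrite ltr_wpDl.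
have e0 : 0 < eps / 4 by rewrite divr_gt0.
have [N HN] := bul_uniform cg e0; have [L HL] := visible_bound N.
(* Both comparisons together cost twice eps / 4 by continuity, 8 C delta for the configurations left
   out and 3 C eta s for the finite tree; the factors 32 here and 12 in [eta] bound the last two by
   eps / 4 each. [D] and s + 1 keep the denominators positive. *)
pose delta := Num.min (1 / 2) (eps / (32 * D)).
have d0 : 0 < delta by rewrite lt_min !divr_gt0 // mulr_gt0.
have d1 : delta < 1 by rewrite gt_min; apply/orP; left; lra.
have Cd : C * delta <= eps / 32.
  apply: le_trans (_ : D * (eps / (32 * D)) <= _); last first.
    by rewrite le_eqVlt; apply/orP; left; apply/eqP; field; rewrite gt_eqF.
  by apply: ler_pM => //; [exact: ltW | rewrite lerDl | rewrite ge_min lexx orbT].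
have [h Hmass] := configs_mass_ge Hw Ht L d0 d1.
set ks := configs L h in Hmass; pose m := (2 * L).+1.
have cks k : k \in ks -> forest_code m k.1 /\ L :: k.2 \in verts (m :: k.1).
  exact: mem_configs.
have uks : uniq ks := configs_uniq L h.
pose s : R := (size ks)%:R; have s0 : 0 <= s by rewrite ler0n.
pose eta := eps / (12 * (D * (s + 1))).
have eta0 : 0 < eta by rewrite divr_gt0 // !mulr_gt0 // ltr_wpDl.
have Ce : C * (eta * s) <= eps / 12.
  apply: le_trans (_ : D * (eta * (s + 1)) <= _); last first.
    by rewrite le_eqVlt; apply/orP; left; apply/eqP; rewrite /eta; field; rewrite !gt_eqF // ltr_wpDl.
  apply: ler_pM => //; first by rewrite mulr_ge0 // ltW.
    by rewrite lerDl.
  by rewrite ler_pM2l // lerDl.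
pose M := (N + m)%N.
have mM : (m <= M)%N by exact: leq_addl.
pose p (k : seq nat * seq nat) := word_law w tau k.1 * (1 - mu nu).
have gkC k : k \in ks -> `|g (config_point L m k.1 k.2)| <= C by move=> _; exact: gC.
have [I1 I2] := Tbar_configs (ltW e0) HN gC HL (erefl m) uks cks cg HV.
(* The limit tree gives configurations their exact probabilities, so the bound is applied with zero
   loss. *)
have pk0 k : k \in ks -> p k - 0 <= p k by rewrite subr0.
have HI := scheffe_bound C0 I1 pk0 gkC (lexx 0) I2 Hmass.
have near_ok : \forall n \near \oo, forall k, k \in ks -> forall i, i \in k.1 ->
    i%:R <= Om (d * n + 1)%N.
  pose B := (\max_(k <- ks) sumn k.1)%N.
  have HB : \forall n \near \oo, B%:R <= Om (d * n + 1)%N.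
    exact: (Om_cvg Hw Hd HOm (nbhs_pinfty_ge (num_real B%:R))).
  apply: filterS HB => n HB k kks i ik; apply: le_trans HB; rewrite ler_nat.
  apply: leq_trans (leq_sumn ik) _.
  by rewrite /B (big_rem k) //= leq_maxl.
have near_hit : \forall n \near \oo, forall k, k \in ks -> p k - eta <=
   avgT w (fun (S : {set word (d * n + 1)}) x => (config_hit S (Om (d * n + 1)%N) L M k (wval x))%:R).
  have H i := prefix_middle_lower Hw Ht Hd HOm (nth ([::], [::]) ks i).1 M eta0.
  have H' := near_forall_lt _ (size ks) H.
  near=> n => k kks.
  have ok : forall k, k \in ks -> forall i, i \in k.1 -> i%:R <= Om (d * n + 1)%N.
    by near: n; exact: near_ok.
  have Hn : forall i, (i < size ks)%N ->
      word_law w tau (nth ([::], [::]) ks i).1 * (1 - mu nu) - eta <=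
      avgT w (fun (S : {set word (d * n + 1)}) x =>
        (config_anchor S (Om (d * n + 1)%N) M (nth ([::], [::]) ks i).1 (wval x))%:R).
    by near: n; exact: H'.
  have := Hn (index k ks); rewrite index_mem nth_index // => /(_ kks) Hk.
  apply: le_trans Hk _.
  have [h1 h2] := cks k kks; case: k kks h1 h2 => c0 u0 kks h1 h2.
  apply: ler_avgT => // S HS; apply: (sum_config_hit HS (erefl m) mM).
  by split => //; exact: ok kks.
have [n0 Hn0] := total_bridges_gt0 Hw Hd.
near=> n.
have ok : forall k, k \in ks -> forall i, i \in k.1 -> i%:R <= Om (d * n + 1)%N.
  by near: n; exact: near_ok.
have tot : 0 < \sum_(q in pointed_trees (d * n + 1)) tree_wt w q.1.
  by rewrite -total_bridges Hn0 //; near: n; exact: nbhs_infty_ge.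
have [J1 J2] := EH_configs (ltW e0) HN gC HL (erefl m) (leqnn M) uks cks w0 cC tot ok.
have hit : forall k, k \in ks -> p k - eta <=
   avgT w (fun (S : {set word (d * n + 1)}) x => (config_hit S (Om (d * n + 1)%N) L M k (wval x))%:R).
  by near: n; exact: near_hit.
have HJ := scheffe_bound C0 J1 hit gkC (ltW eta0) J2 Hmass.
set g1 := \sum_(k <- ks) _ in HI HJ; set I := \int[P]_o _ in HI *; set E := EH _ _ _ _ in HJ *.
rewrite -(subrK g1 I) -addrA; apply: le_trans (ler_normD _ _) _.
apply: le_trans (lerD HI (_ : _ <= eps / 4 + C * (2 * (2 * delta) + 3 * (eta * s)))) _.
  by rewrite distrC.
have E1 : C * (2 * (2 * delta) + 3 * (0 * (size ks)%:R)) = 4 * (C * delta) by ring.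
have E2 : C * (2 * (2 * delta) + 3 * (eta * s)) = 4 * (C * delta) + 3 * (C * (eta * s)) by ring.
rewrite E1 E2; move: Cd Ce; move: (C * delta) (C * (eta * s)) => y x Cd Ce; lra.
Unshelve. all: by end_near. Qed.
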